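(* Let $p\in(0,1]$, $q\in[p,1]$, and let $\mathcal B_q$ be a $q$-quasi-Banach space. Let $s_1,s_2\in\mathbb Z_+$ and, for $i=1,2$, $\sigma_i\in(\max\{n_i/p,\,n_i+s_i\},\,n_i+s_i+1)$. Let $T$ be a $\mathcal B_q$-sublinear operator from $\mathcal D_{s_1,s_2}(\mathbb R^{n_1}\times\mathbb R^{n_2})$ to $\mathcal B_q$. Suppose there exists $C>0$ such that for all $f\in\mathcal D_{s_1,s_2}(\mathbb R^{n_1}\times\mathbb R^{n_2})$, $$\|Tf\|_{\mathcal B_q}\le C\Big[\sup_{x_2\in\mathbb R^{n_2}}\operatorname{diam}(\operatorname{supp}f(\cdot,x_2))\Big]^{n_1/p}\Big[\sup_{x_1\in\mathbb R^{n_1}}\operatorname{diam}(\operatorname{supp}f(x_1,\cdot))\Big]^{n_2/p}\|f\|_{L^\infty}.$$ Then there exists $C'>0$ such that $\|Tf\|_{\mathcal B_q}\le C'\|f\|_{\mathcal D_{s_1,s_2;\sigma_1,\sigma_2}}$ for all $f\in\mathcal D_{s_1,s_2}(\mathbb R^{n_1}\times\mathbb R^{n_2})$; i.e. $T$ extends to a bounded $\mathcal B_q$-sublinear operator from $\mathcal D_{s_1,s_2;\sigma_1,\sigma_2}(\mathbb R^{n_1}\times\mathbb R^{n_2})$ to $\mathcal B_q$.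
   Context: $\mathcal D_{s_1,s_2}(\mathbb R^{n_1}\times\mathbb R^{n_2})$ is the set of smooth compactly supported $f$ on $\mathbb R^{n_1}\times\mathbb R^{n_2}$ with $\int_{\mathbb R^{n_1}}f(x_1,x_2)x_1^{\alpha_1}dx_1=0$ for all $x_2$, $|\alpha_1|\le s_1$, and $\int_{\mathbb R^{n_2}}f(x_1,x_2)x_2^{\alpha_2}dx_2=0$ for all $x_1$, $|\alpha_2|\le s_2$. $\mathcal D_{s_1,s_2;\sigma_1,\sigma_2}$ denotes this space with the norm $\|f\|_{\mathcal D_{s_1,s_2;\sigma_1,\sigma_2}}=\sup_{x_1,x_2}(1+|x_1|)^{\sigma_1}(1+|x_2|)^{\sigma_2}|f(x_1,x_2)|$. Here $\sup_{x_2}\operatorname{diam}(\operatorname{supp}f(\cdot,x_2))=\sup\{|x_1-y_1|: x_2\in\mathbb R^{n_2},\ f(x_1,x_2)\ne0,\ f(y_1,x_2)\ne0\}$, and $\sup_{x_1}\operatorname{diam}(\operatorname{supp}f(x_1,\cdot))$ is defined symmetrically. A $q$-quasi-Banach space ($q\in(0,1]$) is a quasi-Banach space $\mathcal B_q$ whose quasi-norm satisfies $\|f+g\|^q_{\mathcal B_q}\le\|f\|^q_{\mathcal B_q}+\|g\|^q_{\mathcal B_q}$. An operator $T$ from a linear space $\mathcal Y$ into $\mathcal B_q$ is $\mathcal B_q$-sublinear if for all $f,g\in\mathcal Y$ and $\lambda,\nu\in\mathbb C$: $\|T(\lambda f+\nu g)\|_{\mathcal B_q}\le(|\lambda|^q\|Tf\|^q_{\mathcal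 B_q}+|\nu|^q\|Tg\|^q_{\mathcal B_q})^{1/q}$ and $\|Tf-Tg\|_{\mathcal B_q}\le\|T(f-g)\|_{\mathcal B_q}$. *)

(* Defs.v *)
From Stdlib Require Import Reals Lra ClassicalEpsilon.
Open Scope R_scope.

Record Cx := mkC { Re : R; Im : R }.
Definition Cadd (a b : Cx) : Cx := mkC (Re a + Re b) (Im a + Im b).
Definition Cmul (a b : Cx) : Cx :=
  mkC (Re a * Re b - Im a * Im b) (Re a * Im b + Im a * Re b).
Definition Copp (a : Cx) : Cx := mkC (- Re a) (- Im a).
Definition Csub (a b : Cx) : Cx := Cadd a (Copp b).
Definition C0 : Cx := mkC 0 0.
Definition C1 : Cx := mkC 1 0.
Definition Cmod (a : Cx) : R := sqrt (Re a ^ 2 + Im a ^ 2).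

(* ---------- real powers with the convention 0^a = 0 (a > 0) ---------- *)
Definition rpow (x a : R) : R :=
  match Rle_dec x 0 with left _ => 0 | right _ => Rpower x a end.

(* ---------- supremum of a set of reals (0 if empty or unbounded) ---------- *)
Definition Rsup (E : R -> Prop) : R :=
  match excluded_middle_informative (bound E /\ exists x, E x) with
  | left H => proj1_sig (completeness E (proj1 H) (proj2 H))
  | right _ => 0
  end.

(* ---------- points of R^n: x : nat -> R, only coordinates 0..n-1 matter ---------- *)
Fixpoint rsum (n : nat) (g : nat -> R) : R :=
  match n with O => 0 | S m => rsum m g + g m end.
Fixpoint rprod (n : nat) (g : nat -> R) : R :=
  match n with O => 1 | S m => rprod m g * g m end.
Fixpoint nsum (n : nat) (g : nat -> nat) : nat :=
  match n with O => O | S m => (nsum m g + g m)%nat end.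

Definition normn (n : nat) (x : nat -> R) : R := sqrt (rsum n (fun i => x i ^ 2)).
Definition distn (n : nat) (x y : nat -> R) : R := normn n (fun i => x i - y i).
Definition mono (n : nat) (alpha : nat -> nat) (x : nat -> R) : R :=
  rprod n (fun i => x i ^ alpha i).
Definition upd (x : nat -> R) (i : nat) (t : R) : nat -> R :=
  fun k => if Nat.eqb k i then t else x k.

(* ---------- Lebesgue integral over R^n of a continuous compactly supported
   real function, as the limit of midpoint Riemann sums over [-M,M]^n ---------- *)
Fixpoint gridsum (n N : nat) (M : R) (h : (nat -> R) -> R) (x : nat -> R) : R :=
  match n with
  | O => h x
  | S m => rsum N (fun k =>
             gridsum m N M h (upd x m (- M + (2 * INR k + 1) * M / INR N)))
  end.
Definition Rn_integral_is (n : nat) (h : (nat -> R) -> R) (v : R) : Prop :=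
  exists M, 0 < M /\
    (forall x, h x <> 0 -> forall i, (i < n)%nat -> Rabs (x i) <= M) /\
    Un_cv (fun m => (2 * M / INR (S m)) ^ n * gridsum n (S m) M h (fun _ => 0)) v.

Definition Fn := (nat -> R) -> (nat -> R) -> Cx.

Definition well_def (n1 n2 : nat) (f : Fn) : Prop :=
  forall x1 y1 x2 y2, (forall i, (i < n1)%nat -> x1 i = y1 i) ->
    (forall j, (j < n2)%nat -> x2 j = y2 j) -> f x1 x2 = f y1 y2.

Definition cont2 (n1 n2 : nat) (g : Fn) : Prop :=
  forall x1 x2 eps, 0 < eps -> exists delta, 0 < delta /\
    forall y1 y2, (forall i, (i < n1)%nat -> Rabs (y1 i - x1 i) < delta) ->
      (forall j, (j < n2)%nat -> Rabs (y2 j - x2 j) < delta) ->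
      Cmod (Csub (g y1 y2) (g x1 x2)) < eps.

(* C^infinity: a family D of all iterated partial derivatives (indexed by the
   list of differentiation directions, inl i = d/dx1_i, inr j = d/dx2_j),
   all of which exist and are continuous. *)
Definition smooth2 (n1 n2 : nat) (f : Fn) : Prop :=
  exists D : list (nat + nat) -> Fn,
    D nil = f /\
    (forall a, cont2 n1 n2 (D a)) /\
    (forall a i x1 x2, (i < n1)%nat ->
       derivable_pt_lim (fun t => Re (D a (upd x1 i t) x2)) (x1 i)
                        (Re (D (cons (inl i) a) x1 x2)) /\
       derivable_pt_lim (fun t => Im (D a (upd x1 i t) x2)) (x1 i)
                        (Im (D (cons (inl i) a) x1 x2))) /\
    (forall a j x1 x2, (j < n2)%nat ->
       derivable_pt_lim (fun t => Re (D a x1 (upd x2 j t))) (x2 j)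
                        (Re (D (cons (inr j) a) x1 x2)) /\
       derivable_pt_lim (fun t => Im (D a x1 (upd x2 j t))) (x2 j)
                        (Im (D (cons (inr j) a) x1 x2))).

Definition compact_supp (n1 n2 : nat) (f : Fn) : Prop :=
  exists M, forall x1 x2, f x1 x2 <> C0 ->
    (forall i, (i < n1)%nat -> Rabs (x1 i) <= M) /\
    (forall j, (j < n2)%nat -> Rabs (x2 j) <= M).

Definition inD (n1 n2 s1 s2 : nat) (f : Fn) : Prop :=
  well_def n1 n2 f /\ smooth2 n1 n2 f /\ compact_supp n1 n2 f /\
  (forall (alpha1 : nat -> nat) x2, (nsum n1 alpha1 <= s1)%nat ->
     Rn_integral_is n1 (fun x1 => Re (f x1 x2) * mono n1 alpha1 x1) 0 /\
     Rn_integral_is n1 (fun x1 => Im (f x1 x2) * mono n1 alpha1 x1) 0) /\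
  (forall (alpha2 : nat -> nat) x1, (nsum n2 alpha2 <= s2)%nat ->
     Rn_integral_is n2 (fun x2 => Re (f x1 x2) * mono n2 alpha2 x2) 0 /\
     Rn_integral_is n2 (fun x2 => Im (f x1 x2) * mono n2 alpha2 x2) 0).

Definition Fcomb (l : Cx) (f : Fn) (m : Cx) (g : Fn) : Fn :=
  fun x1 x2 => Cadd (Cmul l (f x1 x2)) (Cmul m (g x1 x2)).
Definition Fsub (f g : Fn) : Fn := fun x1 x2 => Csub (f x1 x2) (g x1 x2).

Definition Linf (f : Fn) : R := Rsup (fun r => exists x1 x2, r = Cmod (f x1 x2)).
Definition Dnorm (n1 n2 : nat) (sg1 sg2 : R) (f : Fn) : R :=
  Rsup (fun r => exists x1 x2,
    r = Rpower (1 + normn n1 x1) sg1 * Rpower (1 + normn n2 x2) sg2 * Cmod (f x1 x2)).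
Definition diam1 (n1 : nat) (f : Fn) : R :=
  Rsup (fun r => exists x2 x1 y1, f x1 x2 <> C0 /\ f y1 x2 <> C0 /\ r = distn n1 x1 y1).
Definition diam2 (n2 : nat) (f : Fn) : R :=
  Rsup (fun r => exists x1 x2 y2, f x1 x2 <> C0 /\ f x1 y2 <> C0 /\ r = distn n2 x2 y2).

Record qBanach (q : R) (B : Type) (zero : B) (add : B -> B -> B) (opp : B -> B)
    (scal : Cx -> B -> B) (nrm : B -> R) : Prop := {
  qb_addA : forall x y z, add x (add y z) = add (add x y) z;
  qb_addC : forall x y, add x y = add y x;
  qb_add0 : forall x, add x zero = x;
  qb_addN : forall x, add x (opp x) = zero;
  qb_scal1 : forall x, scal C1 x = x;
  qb_scalA : forall a b x, scal a (scal b x) = scal (Cmul a b) x;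
  qb_scalDl : forall a b x, scal (Cadd a b) x = add (scal a x) (scal b x);
  qb_scalDr : forall a x y, scal a (add x y) = add (scal a x) (scal a y);
  qb_nrm_ge0 : forall x, 0 <= nrm x;
  qb_nrm_eq0 : forall x, nrm x = 0 <-> x = zero;
  qb_nrm_scal : forall a x, nrm (scal a x) = Cmod a * nrm x;
  qb_nrm_q : forall x y, rpow (nrm (add x y)) q <= rpow (nrm x) q + rpow (nrm y) q;
  qb_complete : forall u : nat -> B,
    (forall eps, 0 < eps -> exists N, forall m k, (N <= m)%nat -> (N <= k)%nat ->
        nrm (add (u m) (opp (u k))) < eps) ->
    exists l, forall eps, 0 < eps -> exists N, forall m, (N <= m)%nat ->
        nrm (add (u m) (opp l)) < eps
}.

Definition sublinear (n1 n2 s1 s2 : nat) (q : R) (B : Type) (add : B -> B -> B)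
    (opp : B -> B) (nrm : B -> R) (T : Fn -> B) : Prop :=
  forall f g, inD n1 n2 s1 s2 f -> inD n1 n2 s1 s2 g ->
    (forall l m, nrm (T (Fcomb l f m g)) <=
       rpow (rpow (Cmod l) q * rpow (nrm (T f)) q + rpow (Cmod m) q * rpow (nrm (T g)) q) (1 / q)) /\
    nrm (add (T f) (opp (T g))) <= nrm (T (Fsub f g)).

(* Main.v *)
From Stdlib Require Import Reals Lra Lia List FunctionalExtensionality ClassicalEpsilon Classical.
From Coquelicot Require Import Rcomplements Hierarchy Continuity Derive RInt RInt_analysis.
From Coquelicot Require Import AutoDerive Compactness.
Require Import Defs.
Open Scope R_scope.

(** The function is cut dyadically in each block of variables.  Let [Phi_k] be a smooth cutoff of
    the box of side [2^k] and let [psi^k_a] be functions living at scale [2^k] that are dual to the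
    monomials [x^b], [|b| <= s].  The operator
      [F_k u = u Phi_k - sum_(|a| <= s) (int u Phi_k x^a) psi^k_a]
    restores the vanishing moments, preserves those in the other block by Fubini, and [F_k u = u]
    for large [k].  Since [u] has vanishing moments, [int u Phi_k x^a = - int u (1 - Phi_k) x^a],
    which is [O(2^(k (n + |a| - sigma)))] because [sigma > n + s]; hence the layers
    [F_k u - F_(k-1) u] are [O(2^(-k sigma))] and live in a box of size [2^k].  Layering in both
    blocks writes [f] as a finite sum of pieces [f_(k1,k2)] with
      [|T f_(k1,k2)| <= C 2^(k1 (n1/p - sigma1)) 2^(k2 (n2/p - sigma2)) |f|_D],
    and [q]-subadditivity of [T] sums the two geometric series. *)

(** * Smooth functions of one real variable *)

(** The sum of pieces has to be finite: [T] is only subadditive on pairs, and no continuity is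
    available to pass to a limit. Hence truncations that reach [u] exactly, which works because the
    correction coefficients become zero, not merely small, once the cutoff covers the support.
    Smooth cutting alone is not enough, since [T] is controlled only on functions with vanishing
    moments in both blocks; each layer must return to that space while keeping its support and
    decay. No constant may depend on the size of the support of [f]. This is why moments are
    estimated downwards from an arbitrarily remote scale, and why integrals are bounded by the
    support of the integrand rather than by the box of integration. Estimates in one block hold on
    each fibre separately, with the other variables frozen, so that the weight of the other block
    can be carried along unchanged. The condition [n / p < sigma] enters only at the end, as
    convergence of the two series. All analysis is on real functions; real and imaginary parts are
    layered separately and recombined layer by layer, up to the larger of the two numbers of
    layers. *)

Fixpoint Ck1 (k : nat) (g : R -> R) : Prop :=
  match k with
  | O => forall t, continuous g t
  | S k => exists g', (forall t, is_derive g t (g' t)) /\ Ck1 k g'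
  end.

Definition smooth1 (g : R -> R) : Prop := forall k, Ck1 k g.

Lemma Ck1_continuous k g t : Ck1 k g -> continuous g t.
Proof.
destruct k as [|k]; [intros H; apply H|].
intros [g' [Hd _]]; apply (ex_derive_continuous (V := R_NormedModule)).
exists (g' t); apply Hd.
Qed.

Lemma Ck1_pred k g : Ck1 (S k) g -> Ck1 k g.
Proof.
revert g; induction k as [|k IH]; intros g H.
- intros t; exact (Ck1_continuous _ _ t H).
- destruct H as [g' [Hd Hg']]; exists g'; split; [exact Hd|]; now apply IH.
Qed.

Lemma Ck1_const k c : Ck1 k (fun _ => c).
Proof.
revert c; induction k as [|k IH]; intros c.
- intros t; apply continuous_const.
- exists (fun _ => 0); split; [intros t; apply (is_derive_const (K := R_AbsRing) (V := R_NormedModule))|apply IH].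
Qed.

Lemma Ck1_plus k f g : Ck1 k f -> Ck1 k g -> Ck1 k (fun t => f t + g t).
Proof.
revert f g; induction k as [|k IH]; intros f g Hf Hg.
- intros t; apply (continuous_plus (V := R_NormedModule)); [apply Hf|apply Hg].
- destruct Hf as [f' [Df Cf]], Hg as [g' [Dg Cg]].
  exists (fun t => f' t + g' t); split; [|now apply IH].
  intros t; apply (is_derive_plus (K := R_AbsRing) (V := R_NormedModule)); [apply Df|apply Dg].
Qed.

Lemma Ck1_mult k f g : Ck1 k f -> Ck1 k g -> Ck1 k (fun t => f t * g t).
Proof.
revert f g; induction k as [|k IH]; intros f g Hf Hg.
- intros t; apply (continuous_mult (U := R_UniformSpace) (K := R_AbsRing)); [apply Hf|apply Hg].
- pose proof (Ck1_pred _ _ Hf) as Pf; pose proof (Ck1_pred _ _ Hg) as Pg.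
  destruct Hf as [f' [Df Cf]], Hg as [g' [Dg Cg]].
  exists (fun t => f' t * g t + f t * g' t); split.
  + intros t; apply is_derive_Reals, derivable_pt_lim_mult; apply is_derive_Reals;
      [apply Df|apply Dg].
  + apply Ck1_plus; now apply IH.
Qed.

Lemma Ck1_comp_affine k g a b : Ck1 k g -> Ck1 k (fun t => g (a * t + b)).
Proof.
revert g; induction k as [|k IH]; intros g Hg.
- intros t; apply (continuous_comp (fun t => a * t + b) g); [|apply Hg].
  apply (continuous_plus (V := R_NormedModule) (fun t => a * t) (fun _ => b));
    [|apply continuous_const].
  apply (continuous_mult (U := R_UniformSpace) (K := R_AbsRing) (fun _ => a) (fun t => t));
    [apply continuous_const|apply continuous_id].
- destruct Hg as [g' [Dg Cg]].
  exists (fun t => a * g' (a * t + b)); split.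
  + intros t.
    apply (is_derive_comp g (fun t => a * t + b)); [apply Dg|].
    auto_derive; [trivial|ring].
  + apply (Ck1_mult k (fun _ => a)); [apply Ck1_const|now apply IH].
Qed.

Lemma smooth1_const c : smooth1 (fun _ => c).
Proof. intros k; apply Ck1_const. Qed.

Lemma smooth1_plus f g : smooth1 f -> smooth1 g -> smooth1 (fun t => f t + g t).
Proof. intros Hf Hg k; now apply Ck1_plus. Qed.

Lemma smooth1_mult f g : smooth1 f -> smooth1 g -> smooth1 (fun t => f t * g t).
Proof. intros Hf Hg k; now apply Ck1_mult. Qed.

Lemma smooth1_comp_affine g a b : smooth1 g -> smooth1 (fun t => g (a * t + b)).
Proof. intros Hg k; now apply Ck1_comp_affine. Qed.

Lemma smooth1_continuous g t : smooth1 g -> continuous g t.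
Proof. intros H; exact (H O t). Qed.

Lemma smooth1_pow i : smooth1 (fun t => t ^ i).
Proof.
induction i as [|i IH]; [apply (smooth1_const 1)|].
apply (smooth1_mult (fun t => t)); [|exact IH].
intros [|k].
- intros t; apply continuous_id.
- exists (fun _ => 1); split; [|apply Ck1_const].
  intros t; apply (is_derive_id (K := R_AbsRing)).
Qed.

(** * Flat functions and a bump on the unit interval *)

Definition flat (m : nat) (t : R) : R :=
  if Rle_dec t 0 then 0 else (/ t) ^ m * exp (- / t).

Lemma flat_nonpos m t : t <= 0 -> flat m t = 0.
Proof. unfold flat; destruct (Rle_dec t 0); lra. Qed.

Lemma flat_pos m t : 0 < t -> flat m t = (/ t) ^ m * exp (- / t).
Proof. unfold flat; destruct (Rle_dec t 0); lra. Qed.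

Lemma flat_gt0 m t : 0 < t -> 0 < flat m t.
Proof.
intros Ht; rewrite flat_pos by exact Ht.
apply Rmult_lt_0_compat; [apply pow_lt, Rinv_0_lt_compat, Ht|apply exp_pos].
Qed.

Lemma flat_ge0 m t : 0 <= flat m t.
Proof.
destruct (Rle_lt_dec t 0) as [H|H]; [rewrite flat_nonpos; lra|].
left; now apply flat_gt0.
Qed.

(** The inequality [1 + x <= exp x] at [x = y / (n + 1)], raised to the power [n + 1]. *)
Lemma exp_ge_pow (n : nat) (y : R) : 0 <= y -> (y / INR (S n)) ^ S n <= exp y.
Proof.
intros Hy.
assert (Hn : 0 < INR (S n)) by (apply lt_0_INR; lia).
replace (exp y) with (exp (y / INR (S n)) ^ S n).
- apply pow_incr; split.
  + apply Rdiv_le_0_compat; lra.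
  + pose proof (exp_ineq1_le (y / INR (S n))); lra.
- rewrite <- (Rpower_pow (S n)) by apply exp_pos.
  unfold Rpower; rewrite ln_exp; f_equal; field; lra.
Qed.

(** Quadratic smallness at the origin makes the difference quotient there tend to 0. The exponent
    [S (S m)] in the constant leaves two spare powers of [/ t] to pay for [t ^ 2]. *)
Lemma flat_quadratic m : exists c, 0 < c /\ forall t, Rabs (flat m t) <= c * t ^ 2.
Proof.
exists (INR (S (S m)) ^ S (S m)).
assert (Hn : 0 < INR (S (S m))) by (apply lt_0_INR; lia).
split; [now apply pow_lt|].
intros t; rewrite Rabs_pos_eq by apply flat_ge0.
destruct (Rle_lt_dec t 0) as [H|H].
- rewrite flat_nonpos by exact H.
  apply Rmult_le_pos; [left; now apply pow_lt|apply pow2_ge_0].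
- rewrite flat_pos by exact H.
  pose proof (Rinv_0_lt_compat _ H) as Hi.
  pose proof (exp_ge_pow (S m) (/ t) (Rlt_le _ _ Hi)) as He.
  unfold Rdiv in He; rewrite Rpow_mult_distr in He.
  set (c := INR (S (S m)) ^ S (S m)).
  assert (Hc : 0 < c) by now apply pow_lt.
  assert (He' : (/ t) ^ S (S m) <= c * exp (/ t)).
  { rewrite (pow_inv (INR (S (S m)))) in He; fold c in He.
    replace ((/ t) ^ S (S m)) with (c * ((/ t) ^ S (S m) * / c)) by (field; lra).
    apply Rmult_le_compat_l; lra. }
  rewrite exp_Ropp.
  pose proof (exp_pos (/ t)) as Hp.
  apply Rmult_le_reg_r with (exp (/ t)); [exact Hp|].
  replace ((/ t) ^ m * / exp (/ t) * exp (/ t)) with ((/ t) ^ S (S m) * t ^ 2).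
  + replace (c * t ^ 2 * exp (/ t)) with (c * exp (/ t) * t ^ 2) by ring.
    apply Rmult_le_compat_r; [apply pow2_ge_0|exact He'].
  + simpl; field; lra.
Qed.

(** The index [m] exists for this formula: [exp (- / t)] alone is not stable under differentiation,
    whereas the span of all [flat m] is, so smoothness follows by induction for all [m] at once. *)
Lemma is_derive_flat m t :
  is_derive (flat m) t (- INR m * flat (S m) t + flat (S (S m)) t).
Proof.
destruct (Rtotal_order t 0) as [H|[H|H]].
- rewrite 2!flat_nonpos by lra.
  apply is_derive_ext_loc with (fun _ => 0).
  + exists (mkposreal (- t) ltac:(lra)); intros y Hy.
    unfold ball in Hy; simpl in Hy; unfold AbsRing_ball, abs, minus, plus, opp in Hy; simpl in Hy.
    apply Rabs_def2 in Hy; rewrite flat_nonpos; lra.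
  + replace (- INR m * 0 + 0) with (@zero R_AbsRing) by (unfold zero; simpl; ring).
    apply (is_derive_const (K := R_AbsRing) (V := R_NormedModule)).
- subst t; rewrite 2!flat_nonpos by lra.
  replace (- INR m * 0 + 0) with 0 by ring.
  apply is_derive_Reals; intros eps Heps.
  destruct (flat_quadratic m) as [c [Hc Hq]].
  assert (Hd : 0 < eps / c) by (apply Rdiv_lt_0_compat; lra).
  exists (mkposreal _ Hd); intros h Hh Hlt; simpl in Hlt.
  rewrite Rplus_0_l, (flat_nonpos m 0), !Rminus_0_r by lra.
  unfold Rdiv; rewrite Rabs_mult, Rabs_inv.
  pose proof (Rabs_pos_lt h Hh) as Hpos.
  apply Rle_lt_trans with (c * Rabs h).
  + apply Rmult_le_reg_r with (Rabs h); [exact Hpos|].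
    rewrite Rmult_assoc, Rinv_l, Rmult_1_r by lra.
    replace (c * Rabs h * Rabs h) with (c * (Rabs h) ^ 2) by ring.
    rewrite pow2_abs; apply Hq.
  + replace eps with (c * (eps / c)) by (field; lra).
    now apply Rmult_lt_compat_l.
- rewrite 2!flat_pos by lra.
  apply is_derive_ext_loc with (fun t => (/ t) ^ m * exp (- / t)).
  + exists (mkposreal t H); intros y Hy.
    unfold ball in Hy; simpl in Hy; unfold AbsRing_ball, abs, minus, plus, opp in Hy; simpl in Hy.
    apply Rabs_def2 in Hy; rewrite flat_pos; lra.
  + destruct m as [|m].
    * auto_derive; [lra|]. simpl; field; lra.
    * auto_derive; [repeat split; lra|].
      rewrite S_INR; replace (match m with 0%nat => 1 | S _ => INR m + 1 end) with (INR m + 1)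
        by (destruct m; simpl; ring).
      simpl pred; simpl; field; lra.
Qed.

Lemma smooth1_flat m : smooth1 (flat m).
Proof.
intros k; revert m; induction k as [|k IH]; intros m.
- intros t; apply (ex_derive_continuous (V := R_NormedModule)).
  eexists; apply is_derive_flat.
- exists (fun t => - INR m * flat (S m) t + flat (S (S m)) t); split;
    [intros t; apply is_derive_flat|].
  apply Ck1_plus; [apply Ck1_mult; [apply Ck1_const|]|]; apply IH.
Qed.

Definition bump (t : R) : R := flat 0 t * flat 0 (- 1 * t + 1).

Lemma smooth1_bump : smooth1 bump.
Proof. apply smooth1_mult; [|apply smooth1_comp_affine]; apply smooth1_flat. Qed.

Lemma bump_gt0 t : 0 < t < 1 -> 0 < bump t.
Proof. intros H; apply Rmult_lt_0_compat; apply flat_gt0; lra. Qed.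

Lemma bump_ge0 t : 0 <= bump t.
Proof. apply Rmult_le_pos; apply flat_ge0. Qed.

Lemma bump_out t : t <= 0 \/ 1 <= t -> bump t = 0.
Proof.
intros [H|H]; unfold bump;
  [rewrite (flat_nonpos 0 t)|rewrite (flat_nonpos 0 (- 1 * t + 1))]; lra.
Qed.

Lemma flat0_le1 t : flat 0 t <= 1.
Proof.
destruct (Rle_lt_dec t 0) as [H|H]; [rewrite flat_nonpos; lra|].
rewrite flat_pos by exact H; simpl; rewrite Rmult_1_l, <- exp_0.
pose proof (Rinv_0_lt_compat _ H).
left; apply exp_increasing; lra.
Qed.

Lemma bump_le1 t : bump t <= 1.
Proof.
unfold bump; rewrite <- (Rmult_1_r 1).
apply Rmult_le_compat; auto using flat_ge0, flat0_le1.
Qed.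

(** * Integrals of continuous functions over intervals *)

Lemma ex_RInt_continuous' (g : R -> R) a b : (forall t, continuous g t) -> ex_RInt g a b.
Proof. intros H; apply (ex_RInt_continuous (V := R_CompleteNormedModule)); intros; apply H. Qed.

Lemma RInt_ext_all (f g : R -> R) a b : (forall t, f t = g t) -> RInt f a b = RInt g a b :> R.
Proof. intros H; apply RInt_ext; intros; apply H. Qed.

Lemma RInt_zero_on (g : R -> R) a b :
  (forall t, Rmin a b < t < Rmax a b -> g t = 0) -> RInt g a b = 0 :> R.
Proof.
intros H; rewrite (RInt_ext _ (fun _ => 0)) by exact H.
rewrite RInt_const; unfold scal; simpl; unfold mult; simpl; ring.
Qed.

Lemma RInt_split (g : R -> R) a b c : (forall t, continuous g t) ->
  RInt g a c = RInt g a b + RInt g b c :> R.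
Proof.
intros H; symmetry; apply (RInt_Chasles (V := R_CompleteNormedModule));
  now apply ex_RInt_continuous'.
Qed.

Lemma RInt_enlarge (g : R -> R) a b a' b' : (forall t, continuous g t) ->
  a' <= a -> a <= b -> b <= b' -> (forall t, t < a \/ b < t -> g t = 0) ->
  RInt g a' b' = RInt g a b :> R.
Proof.
intros Hc Ha Hab Hb Hz.
rewrite (RInt_split g a' a b'), (RInt_split g a b b') by exact Hc.
rewrite (RInt_zero_on g a' a), (RInt_zero_on g b b'); [ring| |];
  intros t Ht; apply Hz; [rewrite Rmin_left in Ht by lra|rewrite Rmax_right in Ht by lra]; lra.
Qed.

(** * A smooth step and a smooth cutoff *)

Definition bumpmass : R := RInt bump 0 1.

Lemma bumpmass_gt0 : 0 < bumpmass.
Proof.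
apply RInt_gt_0; [lra|exact bump_gt0|].
intros; apply smooth1_continuous, smooth1_bump.
Qed.

Definition step (t : R) : R := / bumpmass * RInt bump 0 t.

Lemma smooth1_step : smooth1 step.
Proof.
apply smooth1_mult; [apply smooth1_const|].
assert (D : forall t, is_derive (fun t => RInt bump 0 t) t (bump t)).
{ intros t; apply (is_derive_RInt (V := R_NormedModule) bump _ 0).
  - exists (mkposreal 1 Rlt_0_1); intros y _.
    apply (RInt_correct (V := R_CompleteNormedModule)), ex_RInt_continuous'.
    intros; apply smooth1_continuous, smooth1_bump.
  - apply smooth1_continuous, smooth1_bump. }
intros [|k].
- intros t; apply (ex_derive_continuous (V := R_NormedModule)); eexists; apply D.
- exists bump; split; [exact D|apply smooth1_bump].
Qed.

Lemma continuous_bump t : continuous bump t.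
Proof. apply smooth1_continuous, smooth1_bump. Qed.

Lemma step_0 t : t <= 0 -> step t = 0.
Proof.
intros H; unfold step; rewrite RInt_zero_on; [ring|].
intros y Hy; apply bump_out; rewrite Rmax_left in Hy by lra; lra.
Qed.

Lemma step_1 t : 1 <= t -> step t = 1.
Proof.
intros H; unfold step.
rewrite (RInt_enlarge bump 0 1 0 t); try lra.
- fold bumpmass; apply Rinv_l, Rgt_not_eq, bumpmass_gt0.
- apply continuous_bump.
- intros y Hy; apply bump_out; lra.
Qed.

Lemma step_range t : 0 <= step t <= 1.
Proof.
destruct (Rle_lt_dec t 0) as [H|H]; [rewrite step_0; lra|].
destruct (Rle_lt_dec 1 t) as [H1|H1]; [rewrite step_1; lra|].
pose proof bumpmass_gt0 as Hm.
assert (G : forall a b, a <= b -> 0 <= RInt bump a b).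
{ intros a b Hab; apply RInt_ge_0; [exact Hab| |].
  - apply ex_RInt_continuous', continuous_bump.
  - intros; apply bump_ge0. }
assert (H2 : RInt bump 0 t + RInt bump t 1 = bumpmass)
  by (symmetry; apply RInt_split, continuous_bump).
pose proof (G 0 t ltac:(lra)); pose proof (G t 1 ltac:(lra)).
pose proof (Rinv_0_lt_compat _ Hm); unfold step; split.
- apply Rmult_le_pos; lra.
- apply Rmult_le_reg_l with bumpmass; [exact Hm|].
  rewrite <- Rmult_assoc, Rinv_r; lra.
Qed.

Definition cutoff (t : R) : R := step (- 1 * t + 2) * step (1 * t + 2).

Lemma smooth1_cutoff : smooth1 cutoff.
Proof. apply smooth1_mult; apply smooth1_comp_affine, smooth1_step. Qed.

Lemma cutoff_in t : Rabs t <= 1 -> cutoff t = 1.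
Proof.
intros H; apply Rabs_le_between in H; unfold cutoff; rewrite 2!step_1; lra.
Qed.

Lemma cutoff_out t : 2 <= Rabs t -> cutoff t = 0.
Proof.
intros H; unfold cutoff; destruct (Rle_lt_dec 0 t) as [H0|H0].
- rewrite Rabs_pos_eq in H by exact H0; rewrite step_0; lra.
- rewrite Rabs_left in H by exact H0; rewrite (step_0 (1 * t + 2)); lra.
Qed.

Lemma cutoff_range t : 0 <= cutoff t <= 1.
Proof.
pose proof (step_range (- 1 * t + 2)); pose proof (step_range (1 * t + 2)).
unfold cutoff; split; [apply Rmult_le_pos; lra|].
apply Rle_trans with (1 * 1); [apply Rmult_le_compat|]; lra.
Qed.

(* With [D g t = g (t / 2) / 2], the operator [D - 2^i] multiplies the moment of order [j] by
   [2^j - 2^i]; composing over all [i < N] with [i <> j] isolates the moment of order [j]. *)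
Fixpoint isolate (j N : nat) : R -> R :=
  match N with
  | O => bump
  | S i => if Nat.eqb i j then isolate j i
           else fun t => / 2 * isolate j i (/ 2 * t + 0) + - 2 ^ i * isolate j i t
  end.

Lemma smooth1_isolate j N : smooth1 (isolate j N).
Proof.
induction N as [|i IH]; [apply smooth1_bump|].
simpl; destruct (Nat.eqb i j); [exact IH|].
apply smooth1_plus; (apply smooth1_mult; [apply smooth1_const|]);
  [apply smooth1_comp_affine|]; exact IH.
Qed.

(** The support of [bump] lies in the unit interval and each stage at most doubles it by
    dilation. *)
Lemma isolate_supp j N t : 2 ^ N < Rabs t -> isolate j N t = 0.
Proof.
revert t; induction N as [|i IH]; intros t Ht.
- simpl in *; apply bump_out.
  destruct (Rle_lt_dec t 0); [lra|]; rewrite Rabs_pos_eq in Ht; lra.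
- assert (Hp : 0 < 2 ^ i) by (apply pow_lt; lra).
  simpl in *; destruct (Nat.eqb i j); [apply IH; lra|].
  rewrite (IH t), (IH (/ 2 * t + 0)); [ring| |lra].
  rewrite Rplus_0_r, Rabs_mult, (Rabs_pos_eq (/ 2)); lra.
Qed.

Lemma isolate_bounded j N : exists B, forall t, Rabs (isolate j N t) <= B.
Proof.
induction N as [|i [B IH]].
- exists 1; intros t; simpl; rewrite Rabs_pos_eq; [apply bump_le1|apply bump_ge0].
- simpl; destruct (Nat.eqb i j); [now exists B|].
  assert (Hp : 0 < 2 ^ i) by (apply pow_lt; lra).
  exists (/ 2 * B + 2 ^ i * B); intros t.
  eapply Rle_trans; [apply Rabs_triang|].
  rewrite 2!Rabs_mult, Rabs_Ropp, (Rabs_pos_eq (/ 2)), (Rabs_pos_eq (2 ^ i)) by lra.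
  apply Rplus_le_compat; apply Rmult_le_compat_l; auto; lra.
Qed.

(** * Moments and functions dual to the monomials *)

Lemma continuous_moment g i t : smooth1 g -> continuous (fun t => g t * t ^ i) t.
Proof.
intros H; apply smooth1_continuous, smooth1_mult; [exact H|apply smooth1_pow].
Qed.

Lemma RInt_mult_l (c : R) (g : R -> R) a b : (forall t, continuous g t) ->
  RInt (fun t => c * g t) a b = c * RInt g a b :> R.
Proof.
intros H; apply (RInt_scal (V := R_CompleteNormedModule)); now apply ex_RInt_continuous'.
Qed.

Lemma RInt_add (f g : R -> R) a b : (forall t, continuous f t) -> (forall t, continuous g t) ->
  RInt (fun t => f t + g t) a b = RInt f a b + RInt g a b :> R.
Proof.
intros Hf Hg; apply (RInt_plus (V := R_CompleteNormedModule)); now apply ex_RInt_continuous'.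
Qed.

Lemma RInt_dilate (g : R -> R) (l M : R) i : smooth1 g -> 0 < l ->
  RInt (fun t => g (/ l * t + 0) * t ^ i) (- M) M =
  l ^ S i * RInt (fun t => g t * t ^ i) (- (M / l)) (M / l) :> R.
Proof.
intros Hg Hl.
replace (- (M / l)) with (/ l * (- M) + 0) by (field; lra).
replace (M / l) with (/ l * M + 0) by (field; lra).
rewrite <- (RInt_comp_lin (V := R_CompleteNormedModule) (fun t => g t * t ^ i) (/ l) 0).
2: now apply ex_RInt_continuous'; intros; apply continuous_moment.
rewrite <- (RInt_mult_l (l ^ S i)).
- apply RInt_ext; intros t _; unfold scal; simpl; unfold mult; simpl.
  rewrite (Rplus_0_r (/ l * t)), Rpow_mult_distr, pow_inv.
  field; split; [apply pow_nonzero; lra|lra].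
- intros t; apply smooth1_continuous.
  apply (smooth1_mult (fun _ => / l)); [apply smooth1_const|].
  apply (smooth1_comp_affine (fun t => g t * t ^ i)), smooth1_mult; [exact Hg|apply smooth1_pow].
Qed.

(** Stage [m] multiplies the moment of order [i] by [2 ^ i - 2 ^ m]: it kills order [m], keeps
    killed orders at zero, and cannot kill order [j] because powers of 2 are distinct. The moments
    are those over the whole line, as the box already contains the support. *)
Lemma isolate_moments j N : exists v : nat -> R,
  (forall i M, 2 ^ N <= M -> RInt (fun t => isolate j N t * t ^ i) (- M) M = v i :> R) /\
  (forall i, (i < N)%nat -> i <> j -> v i = 0) /\ v j <> 0.
Proof.
induction N as [|m [v [Hv [Hz Hj]]]].
- exists (fun i => RInt (fun t => bump t * t ^ i) 0 1); split; [|split].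
  + intros i M HM; simpl in *; apply RInt_enlarge; try lra.
    * intros; apply continuous_moment, smooth1_bump.
    * intros t Ht; rewrite bump_out by lra; ring.
  + intros i Hi; lia.
  (* The bump sits on (0, 1) and not on a symmetric interval precisely for this point: [t ^ j] is
     positive there, so odd moments do not vanish either. *)
  + apply Rgt_not_eq, RInt_gt_0; [lra| |].
    * intros t Ht; apply Rmult_lt_0_compat; [now apply bump_gt0|apply pow_lt; lra].
    * intros; apply continuous_moment, smooth1_bump.
- assert (Hp : 0 < 2 ^ m) by (apply pow_lt; lra).
  simpl; destruct (Nat.eqb_spec m j) as [->|Hmj].
  + exists v; split; [|split; [|exact Hj]].
    * intros i M HM; apply Hv; lra.
    * intros i Hi Hij; apply Hz; [lia|exact Hij].
  + exists (fun i => (2 ^ i - 2 ^ m) * v i); split; [|split].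
    * intros i M HM.
      set (g := isolate j m) in *.
      assert (Sg : smooth1 g) by apply smooth1_isolate.
      rewrite (RInt_ext _ (fun t => / 2 * (g (/ 2 * t + 0) * t ^ i)
                                    + - 2 ^ m * (g t * t ^ i))) by (intros; simpl; ring).
      assert (Hdil : forall t, continuous (fun t => g (/ 2 * t + 0) * t ^ i) t).
      { intros t; apply (continuous_moment (fun t => g (/ 2 * t + 0))).
        now apply smooth1_comp_affine. }
      rewrite RInt_add, 2!RInt_mult_l, RInt_dilate; try lra; auto.
      -- rewrite 2!Hv by lra; simpl; field.
      -- intros; now apply continuous_moment.
      -- intros t; apply (continuous_mult (U := R_UniformSpace) (K := R_AbsRing) (fun _ => / 2));
           [apply continuous_const|apply Hdil].
      -- intros t; apply (continuous_mult (U := R_UniformSpace) (K := R_AbsRing) (fun _ => - 2 ^ m));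
           [apply continuous_const|now apply continuous_moment].
    * intros i Hi Hij; destruct (Nat.eq_dec i m) as [->|Him]; [ring|].
      rewrite Hz by (assumption || lia); ring.
    * apply Rmult_integral_contrapositive_currified; [|exact Hj].
      intros E; assert (E' : 2 ^ j = 2 ^ m) by lra.
      destruct (Nat.lt_total j m) as [L|[L|L]]; [|congruence|].
      -- pose proof (Rlt_pow 2 j m ltac:(lra) L); lra.
      -- pose proof (Rlt_pow 2 m j ltac:(lra) L); lra.
Qed.

(** [R0] and [B] are shared by the whole family, so that products of its members over the
    coordinates have one support radius and one bound. *)
Record dual_family (s : nat) (eta : nat -> R -> R) (R0 B : R) : Prop := {
  dual_smooth : forall j, smooth1 (eta j);
  dual_supp : forall j t, R0 < Rabs t -> eta j t = 0;
  dual_bound : forall j t, (j <= s)%nat -> Rabs (eta j t) <= B;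
  dual_moment : forall j i M, (j <= s)%nat -> (i <= s)%nat -> R0 <= M ->
    RInt (fun t => eta j t * t ^ i) (- M) M = (if Nat.eqb j i then 1 else 0) :> R
}.

Lemma finite_max (n : nat) (P : nat -> R -> Prop) :
  (forall j a b, a <= b -> P j a -> P j b) -> (forall j, exists B, P j B) ->
  exists B, 1 <= B /\ forall j, (j <= n)%nat -> P j B.
Proof.
intros Hm He; induction n as [|n [B [HB IH]]].
- destruct (He O) as [B HB]; exists (Rmax 1 B); split; [apply Rmax_l|].
  intros j Hj; replace j with O by lia; apply Hm with B; [apply Rmax_r|exact HB].
- destruct (He (S n)) as [B' HB']; exists (Rmax B B'); split.
  + eapply Rle_trans; [exact HB|apply Rmax_l].
  + intros j Hj; destruct (Nat.eq_dec j (S n)) as [->|Hne].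
    * apply Hm with B'; [apply Rmax_r|exact HB'].
    * apply Hm with B; [apply Rmax_l|apply IH; lia].
Qed.

Lemma dual_family_exists s : exists eta R0 B, 1 <= R0 /\ 1 <= B /\ dual_family s eta R0 B.
Proof.
(* Isolation among the orders below [S s] kills every order up to [s] other than [j]; dividing by
   the surviving moment normalises it to 1. *)
assert (H : forall j, exists c, forall i M, (i <= s)%nat -> 2 ^ S s <= M -> (j <= s)%nat ->
  RInt (fun t => c * isolate j (S s) t * t ^ i) (- M) M = (if Nat.eqb j i then 1 else 0) :> R).
{ intros j; destruct (isolate_moments j (S s)) as [v [Hv [Hz Hj]]].
  exists (/ v j); intros i M Hi HM Hjs.
  rewrite (RInt_ext_all _ (fun t => / v j * (isolate j (S s) t * t ^ i))) by (intros; ring).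
  rewrite RInt_mult_l, Hv by (exact HM || intros; apply continuous_moment, smooth1_isolate).
  destruct (Nat.eqb_spec j i) as [<-|Hne]; [field; exact Hj|].
  rewrite (Hz i) by lia; ring. }
destruct (choice _ H) as [c Hc]; clear H.
destruct (finite_max s (fun j B => forall t, Rabs (c j * isolate j (S s) t) <= B))
  as [B [HB1 HB]].
{ intros j a b Hab H t; specialize (H t); lra. }
{ intros j; destruct (isolate_bounded j (S s)) as [B HB]; exists (Rabs (c j) * B); intros t.
  rewrite Rabs_mult; apply Rmult_le_compat_l; [apply Rabs_pos|apply HB]. }
exists (fun j t => c j * isolate j (S s) t), (2 ^ S s), B; split; [|split; [exact HB1|split]].
- apply pow_R1_Rle; lra.
- intros j; apply smooth1_mult; [apply smooth1_const|apply smooth1_isolate].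
- intros j t Ht; rewrite isolate_supp by exact Ht; ring.
- intros j t Hj; now apply HB.
- intros j i M Hj Hi HM; now apply Hc.
Qed.

(** * Continuous functions and iterated integrals *)

(* A point of R^n1 x R^n2 is a function on [nat + nat]: [inl i] and [inr j] index the coordinates of
   the two factors, and only the coordinates in an explicit finite list [L] are relevant. *)
Notation dir := (nat + nat)%type.
Notation pt := (dir -> R).

Definition dir_eq_dec (a b : dir) : {a = b} + {a <> b}.
Proof. decide equality; apply Nat.eq_dec. Defined.

Definition set (z : pt) (d : dir) (t : R) : pt := fun e => if dir_eq_dec e d then t else z e.

Lemma set_same z d t : set z d t d = t.
Proof. unfold set; destruct (dir_eq_dec d d); congruence. Qed.

Lemma set_other z d t e : e <> d -> set z d t e = z e.
Proof. intros H; unfold set; destruct (dir_eq_dec e d); congruence. Qed.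

Lemma set_id z d : set z d (z d) = z.
Proof.
apply functional_extensionality; intros e; unfold set.
destruct (dir_eq_dec e d); congruence.
Qed.

Lemma set_set z d t t' : set (set z d t) d t' = set z d t'.
Proof.
apply functional_extensionality; intros e; unfold set.
destruct (dir_eq_dec e d); congruence.
Qed.

Lemma set_comm z a b s t : a <> b -> set (set z a s) b t = set (set z b t) a s.
Proof.
intros H; apply functional_extensionality; intros e; unfold set.
destruct (dir_eq_dec e b), (dir_eq_dec e a); congruence.
Qed.

Definition near (L : list dir) (r : R) (z w : pt) : Prop :=
  forall d, In d L -> Rabs (w d - z d) < r.
Definition inbox (L : list dir) (M : R) (z : pt) : Prop := forall d, In d L -> Rabs (z d) <= M.
Definition cont (L : list dir) (h : pt -> R) : Prop :=
  forall z eps, 0 < eps -> exists delta, 0 < delta /\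
    forall w, near L delta z w -> Rabs (h w - h z) < eps.

Lemma near_le L r r' z w : r <= r' -> near L r z w -> near L r' z w.
Proof. intros H Hn d Hd; specialize (Hn d Hd); lra. Qed.

Lemma near_set L r z w d t : 0 < r -> near L r z w -> near L r (set z d t) (set w d t).
Proof.
intros Hr H e He; unfold set; destruct (dir_eq_dec e d); [|now apply H].
rewrite Rminus_diag, Rabs_R0; exact Hr.
Qed.

Lemma near_set_coord L r z d s t : 0 < r -> Rabs (s - t) < r -> near L r (set z d t) (set z d s).
Proof.
intros Hr H e He; unfold set; destruct (dir_eq_dec e d); [exact H|].
rewrite Rminus_diag, Rabs_R0; exact Hr.
Qed.

Lemma inbox_le L M M' z : M <= M' -> inbox L M z -> inbox L M' z.
Proof. intros H Hb d Hd; specialize (Hb d Hd); lra. Qed.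

Lemma inbox_set L M z d t : Rabs t <= M -> inbox L M z -> inbox L M (set z d t).
Proof.
intros H Hb e He; unfold set; destruct (dir_eq_dec e d); [exact H|now apply Hb].
Qed.

Lemma inbox_exists L z : exists M, 0 < M /\ inbox L M z.
Proof.
induction L as [|a L [M [HM IH]]]; [exists 1; split; [lra|intros d []]|].
exists (Rmax M (Rabs (z a))); split; [eapply Rlt_le_trans; [exact HM|apply Rmax_l]|].
intros d [<-|Hd]; [apply Rmax_r|].
eapply Rle_trans; [now apply IH|apply Rmax_l].
Qed.

(** Moving a coordinate outside [L] costs nothing in [near L], so [cont L h] already contains the
    fact that [h] depends on the coordinates in [L] alone. *)
Lemma cont_agree L h z w : cont L h -> (forall d, In d L -> w d = z d) -> h w = h z.
Proof.
intros Hc H; destruct (Req_dec (h w) (h z)) as [E|E]; [exact E|exfalso].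
destruct (Hc z (Rabs (h w - h z))) as [delta [Hd Hw]]; [apply Rabs_pos_lt; lra|].
apply (Rlt_irrefl (Rabs (h w - h z))), Hw.
intros d Hin; rewrite H, Rminus_diag, Rabs_R0 by exact Hin; exact Hd.
Qed.

(** * Compactness, uniform continuity and boundedness on boxes *)

Lemma compact_interval (M : R) (delta : R -> R) : (forall t, 0 < delta t) ->
  exists d, 0 < d /\ forall x, Rabs x <= M -> exists t, Rabs (x - t) < delta t /\ d <= delta t.
Proof.
intros Hd.
destruct (compactness_value_1d (- M) M (fun t => mkposreal _ (Hd t))) as [d H].
exists d; split; [apply cond_pos|]; intros x Hx.
apply Rabs_le_between in Hx.
(* Compactness in gauge form yields the point of the cover only up to double negation. *)
destruct (NNPP _ (H x Hx)) as [t [_ [H1 H2]]]; exists t; split; assumption.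
Qed.

(* Tube-lemma induction: the coordinates in [K] are freed one at a time. *)
Lemma heine_cantor_partial L h M K : cont L h -> forall z0 eps, 0 < eps ->
  exists delta, 0 < delta /\
    forall z, (forall d, ~ In d K -> z d = z0 d) -> inbox K M z ->
    forall w, near L delta z w -> Rabs (h w - h z) < eps.
Proof.
intros Hc; induction K as [|a K IH]; intros z0 eps Heps.
- destruct (Hc z0 eps Heps) as [delta [Hd H]]; exists delta; split; [exact Hd|].
  intros z Hz _ w Hw; replace z with z0 in *; [now apply H|].
  apply functional_extensionality; intros d; symmetry; apply Hz; intros [].
- destruct (in_dec dir_eq_dec a K) as [HaK|HaK].
  { destruct (IH z0 eps Heps) as [delta [Hd H]]; exists delta; split; [exact Hd|].
    intros z Hz Hb; apply H.
    - intros d Hd'; apply Hz; intros [<-|]; contradiction.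
    - intros d Hd'; apply Hb; now right. }
  assert (Ht : forall t, exists delta, 0 < delta /\
    forall z, (forall d, ~ In d K -> z d = set z0 a t d) -> inbox K M z ->
    forall w, near L delta z w -> Rabs (h w - h z) < eps / 2)
    by (intros t; apply IH; lra).
  destruct (choice _ Ht) as [delta Hdelta]; clear Ht.
  (* Half of the gauge is spent on moving coordinate [a] to the covering point [t], the other half
     on moving from [z] to [w]. *)
  destruct (compact_interval M (fun t => delta t / 2)) as [d [Hd Hcov]].
  { intros t; destruct (Hdelta t); lra. }
  exists d; split; [exact Hd|]; intros z Hz Hb w Hw.
  destruct (Hcov (z a)) as [t [H1 H2]]; [apply Hb; now left|].
  destruct (Hdelta t) as [Hdt H].
  assert (Hoff : forall e, ~ In e K -> set z a t e = set z0 a t e).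
  { intros e He; unfold set; destruct (dir_eq_dec e a) as [E|E]; [reflexivity|].
    apply Hz; intros [<-|]; contradiction || congruence. }
  assert (Hbox : inbox K M (set z a t)).
  { intros e He; rewrite set_other; [apply Hb; now right|congruence]. }
  assert (Hz1 : near L (delta t / 2) (set z a t) z).
  { intros e _; unfold set; destruct (dir_eq_dec e a) as [->|E]; [exact H1|].
    rewrite Rminus_diag, Rabs_R0; lra. }
  assert (Hhalf : delta t / 2 <= delta t) by lra.
  assert (G1 := H _ Hoff Hbox z (near_le _ _ _ _ _ Hhalf Hz1)).
  assert (G2 : Rabs (h w - h (set z a t)) < eps / 2).
  { apply (H _ Hoff Hbox); intros e He; specialize (Hz1 e He); specialize (Hw e He).
    replace (w e - set z a t e) with ((w e - z e) + (z e - set z a t e)) by ring.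
    eapply Rle_lt_trans; [apply Rabs_triang|]; lra. }
  replace (h w - h z) with ((h w - h (set z a t)) - (h z - h (set z a t))) by ring.
  eapply Rle_lt_trans; [apply Rabs_triang|]; rewrite Rabs_Ropp; lra.
Qed.

Lemma heine_cantor L h M eps : cont L h -> 0 < eps ->
  exists delta, 0 < delta /\
    forall z w, inbox L M z -> near L delta z w -> Rabs (h w - h z) < eps.
Proof.
intros Hc Heps.
destruct (heine_cantor_partial L h M L Hc (fun _ => 0) eps Heps) as [delta [Hd H]].
exists delta; split; [exact Hd|]; intros z w Hz Hw.
(* Zeroing the irrelevant coordinates makes [z'] agree with the base point 0 off [L], so the partial
   version applies with all of [L] freed. *)
set (z' := fun d => if in_dec dir_eq_dec d L then z d else 0).
assert (E : forall d, In d L -> z' d = z d)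
  by (intros d Hin; unfold z'; destruct (in_dec dir_eq_dec d L); tauto).
rewrite <- (cont_agree L h z z' Hc E).
apply H.
- intros d Hd'; unfold z'; destruct (in_dec dir_eq_dec d L); tauto.
- intros d Hin; rewrite E by exact Hin; now apply Hz.
- intros d Hin; rewrite E by exact Hin; now apply Hw.
Qed.

(** The segment from 0 to [z] is cut into [S N] steps, each shorter than the modulus of uniform
    continuity for the tolerance 1; so [h] changes by less than 1 per step, and [N] depends only on
    [M]. *)
Lemma cont_bounded L h M : cont L h -> exists B, forall z, inbox L M z -> Rabs (h z) <= B.
Proof.
intros Hc; destruct (heine_cantor L h M 1 Hc Rlt_0_1) as [delta [Hd H]].
destruct (INR_unbounded (Rabs M / delta)) as [N HN].
exists (Rabs (h (fun _ => 0)) + INR (S N)); intros z Hz.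
assert (HS : 0 < INR (S N)) by (apply lt_0_INR; lia).
assert (K : forall k, (k <= S N)%nat ->
  Rabs (h (fun d => INR k / INR (S N) * z d)) <= Rabs (h (fun _ => 0)) + INR k).
{ induction k as [|k IH]; intros Hk.
  - change (INR 0) with 0; rewrite Rplus_0_r; right; do 2 f_equal.
    apply functional_extensionality; intros d; field; lra.
  - specialize (IH ltac:(lia)).
    set (u := fun d => INR k / INR (S N) * z d) in *.
    set (v := fun d => INR (S k) / INR (S N) * z d).
    assert (Hk1 : 0 <= INR k <= INR (S N)) by (split; [apply pos_INR|apply le_INR; lia]).
    assert (Rabs (h v - h u) < 1).
    { apply H.
      - intros d Hin; unfold u; specialize (Hz d Hin).
        rewrite Rabs_mult, Rabs_pos_eq by (apply Rdiv_le_0_compat; lra).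
        assert (INR k / INR (S N) <= 1) by (apply Rle_div_l; lra).
        pose proof (Rabs_pos (z d)); nra.
      - intros d Hin; unfold u, v; specialize (Hz d Hin).
        replace (INR (S k) / INR (S N) * z d - INR k / INR (S N) * z d)
          with (z d / INR (S N)) by (rewrite (S_INR k); field; lra).
        unfold Rdiv; rewrite Rabs_mult, Rabs_inv, (Rabs_pos_eq (INR (S N))) by lra.
        apply Rlt_div_l; [lra|].
        apply Rlt_div_l in HN; [|exact Hd].
        pose proof (Rle_abs M); rewrite S_INR; nra. }
    replace (h v) with ((h v - h u) + h u) by ring.
    eapply Rle_trans; [apply Rabs_triang|]; rewrite S_INR; lra. }
specialize (K (S N) (Nat.le_refl _)).
replace z with (fun d => INR (S N) / INR (S N) * z d); [exact K|].
apply functional_extensionality; intros d; field; lra.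
Qed.

Lemma cont_line L h z d t : cont L h -> continuous (fun t => h (set z d t)) t.
Proof.
intros Hc; apply continuity_pt_filterlim; intros eps Heps.
destruct (Hc (set z d t) eps Heps) as [delta [Hd H]].
exists delta; split; [exact Hd|]; intros s [_ Hs].
apply H, near_set_coord; assumption.
Qed.

(** * Algebra of continuous functions, finite sums and products *)

Lemma cont_const L c : cont L (fun _ => c).
Proof.
intros z eps He; exists 1; split; [lra|]; intros w _; rewrite Rminus_diag, Rabs_R0; exact He.
Qed.

Lemma cont_plus L f g : cont L f -> cont L g -> cont L (fun z => f z + g z).
Proof.
intros Hf Hg z eps He.
destruct (Hf z (eps / 2)) as [d1 [P1 H1]]; [lra|].
destruct (Hg z (eps / 2)) as [d2 [P2 H2]]; [lra|].
exists (Rmin d1 d2); split; [now apply Rmin_pos|]; intros w Hw.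
specialize (H1 w (near_le _ _ _ _ _ (Rmin_l _ _) Hw)).
specialize (H2 w (near_le _ _ _ _ _ (Rmin_r _ _) Hw)).
replace (f w + g w - (f z + g z)) with ((f w - f z) + (g w - g z)) by ring.
eapply Rle_lt_trans; [apply Rabs_triang|]; lra.
Qed.

Lemma cont_mult L f g : cont L f -> cont L g -> cont L (fun z => f z * g z).
Proof.
intros Hf Hg z eps He.
set (a := Rabs (f z) + 1); set (b := Rabs (g z) + 1).
assert (Ha : 0 < a) by (pose proof (Rabs_pos (f z)); unfold a; lra).
assert (Hb : 0 < b) by (pose proof (Rabs_pos (g z)); unfold b; lra).
destruct (Hf z (eps / (2 * b))) as [d1 [P1 H1]]; [apply Rdiv_lt_0_compat; lra|].
destruct (Hg z (Rmin 1 (eps / (2 * a)))) as [d2 [P2 H2]];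
  [apply Rmin_pos; [lra|apply Rdiv_lt_0_compat; lra]|].
exists (Rmin d1 d2); split; [now apply Rmin_pos|]; intros w Hw.
specialize (H1 w (near_le _ _ _ _ _ (Rmin_l _ _) Hw)).
specialize (H2 w (near_le _ _ _ _ _ (Rmin_r _ _) Hw)).
assert (H3 : Rabs (g w - g z) < 1) by (eapply Rlt_le_trans; [exact H2|apply Rmin_l]).
assert (H4 : Rabs (g w - g z) < eps / (2 * a)) by (eapply Rlt_le_trans; [exact H2|apply Rmin_r]).
assert (H5 : Rabs (g w) <= b).
{ unfold b; replace (g w) with ((g w - g z) + g z) by ring.
  eapply Rle_trans; [apply Rabs_triang|]; lra. }
replace (f w * g w - f z * g z) with ((f w - f z) * g w + f z * (g w - g z)) by ring.
eapply Rle_lt_trans; [apply Rabs_triang|]; rewrite !Rabs_mult.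
assert (Rabs (f w - f z) * Rabs (g w) <= eps / (2 * b) * b)
  by (apply Rmult_le_compat; (apply Rabs_pos || lra)).
assert (Rabs (f z) * Rabs (g w - g z) <= Rabs (f z) * (eps / (2 * a)))
  by (apply Rmult_le_compat_l; [apply Rabs_pos|lra]).
assert (Rabs (f z) * (eps / (2 * a)) < a * (eps / (2 * a)))
  by (apply Rmult_lt_compat_r; [apply Rdiv_lt_0_compat; lra|unfold a; lra]).
replace (a * (eps / (2 * a))) with (eps / 2) in * by (field; lra).
replace (eps / (2 * b) * b) with (eps / 2) in * by (field; lra).
lra.
Qed.

Lemma cont_coord L g d : (forall t, continuous g t) -> In d L -> cont L (fun z => g (z d)).
Proof.
intros Hg Hd z eps He.
assert (Hc : continuity_pt g (z d)) by apply continuity_pt_filterlim, Hg.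
destruct (Hc eps He) as [delta [Hdelta H]].
exists delta; split; [exact Hdelta|]; intros w Hw.
destruct (Req_dec (w d) (z d)) as [E|E]; [rewrite E, Rminus_diag, Rabs_R0; exact He|].
apply H; split; [split; [exact I|congruence]|now apply Hw].
Qed.

Lemma cont_rprod L n (F : nat -> pt -> R) : (forall i, (i < n)%nat -> cont L (F i)) ->
  cont L (fun z => rprod n (fun i => F i z)).
Proof.
induction n as [|n IH]; intros H; [apply (cont_const L 1)|].
apply (cont_mult L (fun z => rprod n (fun i => F i z)) (F n)); auto.
Qed.

Lemma rsum_ext n f g : (forall i, (i < n)%nat -> f i = g i) -> rsum n f = rsum n g.
Proof. induction n as [|n IH]; intros H; simpl; [reflexivity|]; rewrite IH, H; auto. Qed.

Lemma rprod_ext n f g : (forall i, (i < n)%nat -> f i = g i) -> rprod n f = rprod n g.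
Proof. induction n as [|n IH]; intros H; simpl; [reflexivity|]; rewrite IH, H; auto. Qed.

Lemma rsum_scal n c f : rsum n (fun i => c * f i) = c * rsum n f.
Proof. induction n as [|n IH]; simpl; [ring|]; rewrite IH; ring. Qed.

Lemma rsum_const n c : rsum n (fun _ => c) = INR n * c.
Proof. induction n as [|n IH]; [simpl; ring|]; rewrite S_INR; simpl rsum; rewrite IH; ring. Qed.

Lemma rsum_le n f g : (forall i, (i < n)%nat -> f i <= g i) -> rsum n f <= rsum n g.
Proof.
induction n as [|n IH]; intros H; simpl; [lra|].
apply Rplus_le_compat; [apply IH|apply H]; auto.
Qed.

Lemma rsum_abs n f : Rabs (rsum n f) <= rsum n (fun i => Rabs (f i)).
Proof.
induction n as [|n IH]; simpl; [rewrite Rabs_R0; lra|].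
eapply Rle_trans; [apply Rabs_triang|]; lra.
Qed.

Lemma rsum_0 n f : (forall i, (i < n)%nat -> f i = 0) -> rsum n f = 0.
Proof.
intros H; rewrite (rsum_ext n f (fun _ => 0)), rsum_const by exact H; ring.
Qed.

Lemma rsum_dist n f g eps : (forall i, (i < n)%nat -> Rabs (f i - g i) <= eps) ->
  Rabs (rsum n f - rsum n g) <= INR n * eps.
Proof.
intros H.
replace (rsum n f - rsum n g) with (rsum n (fun i => f i - g i)).
- eapply Rle_trans; [apply rsum_abs|]; rewrite <- rsum_const; now apply rsum_le.
- clear H; induction n as [|n IH]; simpl; [ring|]; rewrite IH; ring.
Qed.

Lemma rprod_mult n f g : rprod n (fun i => f i * g i) = rprod n f * rprod n g.
Proof. induction n as [|n IH]; simpl; [ring|]; rewrite IH; ring. Qed.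

(** * Iterated integrals and midpoint Riemann sums *)

Definition slice (M : R) (d : dir) (h : pt -> R) (z : pt) : R :=
  RInt (fun t => h (set z d t)) (- M) M.

(** The last coordinate is outermost, as in [gridsum], so that integral and grid sum can be compared
    level by level. The value stays a function of the whole point, which lets integrals over
    different blocks be nested and multiplied by functions of the remaining variables. *)
Fixpoint integ (c : nat -> dir) (n : nat) (M : R) (h : pt -> R) : pt -> R :=
  match n with
  | O => h
  | S m => slice M (c m) (integ c m M h)
  end.

Lemma RInt_minus_cont (f g : R -> R) a b : (forall t, continuous f t) -> (forall t, continuous g t) ->
  RInt (fun t => f t - g t) a b = RInt f a b - RInt g a b :> R.
Proof.
intros Hf Hg; apply (RInt_minus (V := R_CompleteNormedModule)); now apply ex_RInt_continuous'.
Qed.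

Lemma RInt_dist (f g : R -> R) M eps : 0 <= M ->
  (forall t, continuous f t) -> (forall t, continuous g t) ->
  (forall t, Rabs t <= M -> Rabs (f t - g t) <= eps) ->
  Rabs (RInt f (- M) M - RInt g (- M) M) <= 2 * M * eps.
Proof.
intros HM Hf Hg H; rewrite <- RInt_minus_cont by assumption.
replace (2 * M) with (M - - M) by ring.
apply abs_RInt_le_const; [lra| |intros t Ht; apply H, Rabs_le_between, Ht].
apply ex_RInt_continuous'; intros t.
apply (continuous_minus (V := R_NormedModule)); auto.
Qed.

Lemma cont_slice L M d h : 0 <= M -> cont L h -> cont L (slice M d h).
Proof.
intros HM Hc z eps He.
destruct (inbox_exists L z) as [M1 [HM1 Hz]].
assert (He' : 0 < eps / (2 * M + 1)) by (apply Rdiv_lt_0_compat; lra).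
destruct (heine_cantor L h (Rmax M M1) _ Hc He') as [delta [Hd H]].
exists delta; split; [exact Hd|]; intros w Hw.
apply Rle_lt_trans with (2 * M * (eps / (2 * M + 1))).
- apply RInt_dist; try (intros; now apply (cont_line L)); [exact HM|].
  intros t Ht; left; apply H; [|now apply near_set].
  apply inbox_set; [eapply Rle_trans; [exact Ht|apply Rmax_l]|].
  apply (inbox_le L M1); [apply Rmax_r|exact Hz].
- apply Rlt_le_trans with ((2 * M + 1) * (eps / (2 * M + 1))).
  + apply Rmult_lt_compat_r; lra.
  + right; field; lra.
Qed.

Lemma cont_integ L c n M h : 0 <= M -> cont L h -> cont L (integ c n M h).
Proof. intros HM Hc; induction n as [|n IH]; [exact Hc|]; now apply cont_slice. Qed.

(** On one cell the midpoint value differs from the integrand by at most [eps]; the partial sums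
    over the first [j] cells are compared with the integral up to the right end of cell [j]. *)
Lemma riemann_1d (g : R -> R) (M eps : R) (N : nat) : 0 < M -> (0 < N)%nat ->
  (forall t, continuous g t) ->
  (forall t t', Rabs t <= M -> Rabs (t' - t) <= M / INR N -> Rabs (g t' - g t) <= eps) ->
  Rabs (2 * M / INR N * rsum N (fun k => g (- M + (2 * INR k + 1) * M / INR N))
        - RInt g (- M) M) <= 2 * M * eps.
Proof.
intros HM HN Hg Hu.
assert (HN' : 0 < INR N) by now apply lt_0_INR.
assert (Hw : 0 < M / INR N) by (apply Rdiv_lt_0_compat; lra).
assert (K : forall j, (j <= N)%nat ->
  Rabs (2 * M / INR N * rsum j (fun k => g (- M + (2 * INR k + 1) * M / INR N))
        - RInt g (- M) (- M + 2 * INR j * (M / INR N))) <= INR j * (2 * M / INR N) * eps).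
{ induction j as [|j IH]; intros Hj.
  - simpl; replace (- M + 2 * 0 * (M / INR N)) with (- M) by ring.
    rewrite RInt_point; unfold zero; simpl.
    rewrite Rmult_0_r, Rminus_0_r, Rabs_R0; right; ring.
  - specialize (IH ltac:(lia)).
    set (a := - M + 2 * INR j * (M / INR N)) in *.
    replace (- M + 2 * INR (S j) * (M / INR N)) with (a + 2 * (M / INR N))
      by (unfold a; rewrite S_INR; ring).
    rewrite (RInt_split g (- M) a) by exact Hg.
    set (m := - M + (2 * INR j + 1) * M / INR N).
    assert (Em : m = a + M / INR N) by (unfold a, m; field; lra).
    assert (Hjn : INR j + 1 <= INR N) by (rewrite <- S_INR; apply le_INR; lia).
    assert (Hcell : Rabs (2 * M / INR N * g m - RInt g a (a + 2 * (M / INR N)))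
                    <= 2 * M / INR N * eps).
    { replace (2 * M / INR N * g m) with (RInt (fun _ => g m) a (a + 2 * (M / INR N))).
      2: { rewrite RInt_const; unfold scal; simpl; unfold mult; simpl; field; lra. }
      rewrite <- RInt_minus_cont by (intros; apply continuous_const || apply Hg).
      replace (2 * M / INR N * eps) with ((a + 2 * (M / INR N) - a) * eps) by (field; lra).
      apply abs_RInt_le_const; [lra| |].
      - apply ex_RInt_continuous'; intros t.
        apply (continuous_minus (V := R_NormedModule)); [apply continuous_const|apply Hg].
      - intros t Ht.
        assert (Hj0 := pos_INR j).
        assert (INR j * (M / INR N) + M / INR N <= M).
        { replace M with (INR N * (M / INR N)) at 3 by (field; lra).
          rewrite <- (Rmult_1_l (M / INR N)) at 2; rewrite <- Rmult_plus_distr_r.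
          apply Rmult_le_compat_r; lra. }
        assert (0 <= INR j * (M / INR N)) by (apply Rmult_le_pos; lra).
        apply Hu; apply Rabs_le; rewrite ?Em; unfold a in *; lra. }
    simpl rsum; fold m.
    rewrite S_INR.
    match goal with |- Rabs ?e <= _ => replace e with
      ((2 * M / INR N * rsum j (fun k => g (- M + (2 * INR k + 1) * M / INR N)) - RInt g (- M) a)
       + (2 * M / INR N * g m - RInt g a (a + 2 * (M / INR N)))) by ring end.
    eapply Rle_trans; [apply Rabs_triang|]; lra. }
specialize (K N (Nat.le_refl _)).
replace (- M + 2 * INR N * (M / INR N)) with M in K by (field; lra).
replace (INR N * (2 * M / INR N) * eps) with (2 * M * eps) in K by (field; lra).
exact K.
Qed.

Lemma eventually_small (M delta : R) : 0 < M -> 0 < delta ->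
  exists N0, forall N, (N0 <= N)%nat -> (0 < N)%nat /\ M / INR N < delta.
Proof.
intros HM Hd; destruct (INR_unbounded (M / delta)) as [N0 H0].
assert (0 < M / delta) by (apply Rdiv_lt_0_compat; lra).
exists N0; intros N HN.
assert (HN' : M / delta < INR N) by (eapply Rlt_le_trans; [exact H0|now apply le_INR]).
split.
- destruct N; [simpl in HN'; lra|lia].
- apply Rlt_div_l; [lra|]; apply Rlt_div_l in HN'; lra.
Qed.

(** Uniformity in [z] is the point here. It comes from uniform continuity on the box of side
    [Rmax M M'], which holds both the parameters and the integration variable. *)
Lemma riemann_slice L h M M' d eps : cont L h -> 0 < M -> 0 < eps ->
  exists N0, forall N, (N0 <= N)%nat -> (0 < N)%nat /\ forall z, inbox L M' z ->
    Rabs (2 * M / INR N * rsum N (fun k => h (set z d (- M + (2 * INR k + 1) * M / INR N)))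
          - slice M d h z) <= eps.
Proof.
intros Hc HM He.
assert (He' : 0 < eps / (2 * M)) by (apply Rdiv_lt_0_compat; lra).
destruct (heine_cantor L h (Rmax M M') _ Hc He') as [delta [Hd H]].
destruct (eventually_small M delta HM Hd) as [N0 HN0].
exists N0; intros N HN; destruct (HN0 N HN) as [HNp Hsm]; split; [exact HNp|].
intros z Hz; replace eps with (2 * M * (eps / (2 * M))) by (field; lra).
apply (riemann_1d (fun t => h (set z d t))); auto; [intros; now apply (cont_line L)|].
intros t t' Ht Htt'; left; apply H; [|apply near_set_coord; lra].
apply inbox_set; [eapply Rle_trans; [exact Ht|apply Rmax_l]|].
apply (inbox_le L M'); [apply Rmax_r|exact Hz].
Qed.

Fixpoint gridsum_dir (c : nat -> dir) (n N : nat) (M : R) (h : pt -> R) (z : pt) : R :=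
  match n with
  | O => h z
  | S m => rsum N (fun k =>
             gridsum_dir c m N M h (set z (c m) (- M + (2 * INR k + 1) * M / INR N)))
  end.

Lemma midpoint_in (M : R) (N k : nat) : 0 < M -> (k < N)%nat ->
  Rabs (- M + (2 * INR k + 1) * M / INR N) <= M.
Proof.
intros HM Hk; assert (HN : 0 < INR N) by (apply lt_0_INR; lia).
assert (Hk1 : INR k + 1 <= INR N) by (rewrite <- S_INR; apply le_INR; lia).
assert (Hk0 := pos_INR k).
assert (0 <= (2 * INR k + 1) * M / INR N)
  by (apply Rdiv_le_0_compat; [apply Rmult_le_pos|]; lra).
assert ((2 * INR k + 1) * M / INR N <= 2 * M) by (apply Rle_div_l; nra).
apply Rabs_le; lra.
Qed.

(** The inner sums are evaluated at points whose coordinate has been moved to a grid node; [M <= M']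
    keeps these points in the box where the inductive estimate is uniform. *)
Lemma riemann_integ L h c n M M' eps : cont L h -> 0 < M -> M <= M' -> 0 < eps ->
  exists N0, forall N, (N0 <= N)%nat -> forall z, inbox L M' z ->
    Rabs ((2 * M / INR N) ^ n * gridsum_dir c n N M h z - integ c n M h z) <= eps.
Proof.
intros Hc HM HMM'; revert eps; induction n as [|n IH]; intros eps He.
- exists O; intros N _ z _; simpl; rewrite Rmult_1_l, Rminus_diag, Rabs_R0; lra.
(* The outer sum has total weight [2 * M], which multiplies the error of the inner level. *)
- assert (He1 : 0 < eps / 2 / (2 * M)) by (repeat apply Rdiv_lt_0_compat; lra).
  destruct (IH _ He1) as [N1 H1].
  destruct (riemann_slice L (integ c n M h) M M' (c n) (eps / 2)) as [N2 H2]; try lra.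
  { apply cont_integ; [lra|exact Hc]. }
  exists (Nat.max N1 N2); intros N HN z Hz.
  destruct (H2 N ltac:(lia)) as [HNp H2'].
  assert (HN' : 0 < INR N) by now apply lt_0_INR.
  assert (Hw : 0 < 2 * M / INR N) by (apply Rdiv_lt_0_compat; lra).
  specialize (H2' z Hz); simpl.
  set (mid := fun k => - M + (2 * INR k + 1) * M / INR N) in *.
  assert (H3 : Rabs (rsum N (fun k => (2 * M / INR N) ^ n * gridsum_dir c n N M h (set z (c n) (mid k)))
                - rsum N (fun k => integ c n M h (set z (c n) (mid k)))) <= INR N * (eps / 2 / (2 * M))).
  { apply rsum_dist; intros k Hk; apply H1; [lia|].
    apply inbox_set; [|exact Hz].
    eapply Rle_trans; [apply midpoint_in; assumption|exact HMM']. }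
  rewrite rsum_scal in H3.
  match goal with |- Rabs ?e <= _ => replace e with
    (2 * M / INR N * ((2 * M / INR N) ^ n * rsum N (fun k => gridsum_dir c n N M h (set z (c n) (mid k)))
       - rsum N (fun k => integ c n M h (set z (c n) (mid k)))) +
     (2 * M / INR N * rsum N (fun k => integ c n M h (set z (c n) (mid k)))
       - slice M (c n) (integ c n M h) z)) by (unfold mid; ring) end.
  eapply Rle_trans; [apply Rabs_triang|].
  rewrite Rabs_mult, (Rabs_pos_eq (2 * M / INR N)) by lra.
  assert (2 * M / INR N * Rabs ((2 * M / INR N) ^ n *
            rsum N (fun k => gridsum_dir c n N M h (set z (c n) (mid k)))
            - rsum N (fun k => integ c n M h (set z (c n) (mid k)))) <= eps / 2).
  { eapply Rle_trans; [apply Rmult_le_compat_l; [lra|exact H3]|].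
    right; field; lra. }
  change (fun k => integ c n M h (set z (c n) (- M + (2 * INR k + 1) * M / INR N)))
    with (fun k => integ c n M h (set z (c n) (mid k))) in H2'.
  lra.
Qed.

(** * Interchange of integrals and their algebra *)

Lemma continuous_rsum n (F : nat -> R -> R) t : (forall i t, continuous (F i) t) ->
  continuous (fun t => rsum n (fun i => F i t)) t.
Proof.
intros H; revert t; induction n as [|n IH]; intros t; [apply continuous_const|].
apply (continuous_plus (V := R_NormedModule) (fun t => rsum n (fun i => F i t)) (F n)); auto.
Qed.

Lemma RInt_rsum n (F : nat -> R -> R) a b : (forall i t, continuous (F i) t) ->
  RInt (fun t => rsum n (fun i => F i t)) a b = rsum n (fun i => RInt (F i) a b) :> R.
Proof.
intros H; induction n as [|n IH]; simpl.
- apply RInt_zero_on; reflexivity.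
- rewrite RInt_add, IH; auto; intros; now apply continuous_rsum.
Qed.

(** Fubini by discretising only the integral in [b]: a finite sum commutes with the integral in [a],
    and the resulting mixed expression [X] is close to both iterated integrals. *)
Lemma slice_comm L M a b h : 0 < M -> cont L h -> a <> b ->
  slice M a (slice M b h) = slice M b (slice M a h).
Proof.
intros HM Hc Hab; apply functional_extensionality; intros z.
apply cond_eq; intros eps He.
destruct (inbox_exists L z) as [M1 [HM1 Hz]].
set (M' := Rmax M M1).
assert (Hz' : inbox L M' z) by (apply (inbox_le L M1); [apply Rmax_r|exact Hz]).
assert (He1 : 0 < eps / 4 / (2 * M)) by (repeat apply Rdiv_lt_0_compat; lra).
destruct (riemann_slice L h M M' b _ Hc HM He1) as [N1 H1].
destruct (riemann_slice L (slice M a h) M M' b (eps / 4)) as [N2 H2]; try lra.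
{ apply cont_slice; [lra|exact Hc]. }
set (N := Nat.max N1 N2).
destruct (H1 N ltac:(lia)) as [HN H1']; destruct (H2 N ltac:(lia)) as [_ H2'].
specialize (H2' z Hz').
set (mid := fun k => - M + (2 * INR k + 1) * M / INR N) in *.
change (fun k => slice M a h (set z b (- M + (2 * INR k + 1) * M / INR N)))
  with (fun k => slice M a h (set z b (mid k))) in H2'.
assert (Hcl : forall k t, continuous (fun s => h (set (set z a s) b (mid k))) t).
{ intros k t.
  apply (continuous_ext (fun s => h (set (set z b (mid k)) a s))).
  - intros s; now rewrite set_comm by congruence.
  - now apply (cont_line L). }
assert (E : 2 * M / INR N * rsum N (fun k => slice M a h (set z b (mid k))) =
  RInt (fun s => 2 * M / INR N * rsum N (fun k => h (set (set z a s) b (mid k)))) (- M) M :> R).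
{ rewrite RInt_mult_l by (intros; now apply continuous_rsum).
  rewrite RInt_rsum by exact Hcl; f_equal; apply rsum_ext; intros k _.
  apply RInt_ext_all; intros s; now rewrite set_comm by congruence. }
rewrite E in H2'.
assert (H3 : Rabs (RInt (fun s => 2 * M / INR N * rsum N (fun k => h (set (set z a s) b (mid k)))) (- M) M
   - slice M a (slice M b h) z) <= 2 * M * (eps / 4 / (2 * M))).
{ apply RInt_dist; [lra| | |].
  - intros t; apply (continuous_mult (U := R_UniformSpace) (K := R_AbsRing) (fun _ => 2 * M / INR N));
      [apply continuous_const|now apply continuous_rsum].
  - intros t; apply (cont_line L), cont_slice; [lra|exact Hc].
  - intros t Ht; apply H1'; apply inbox_set; [|exact Hz'].
    eapply Rle_trans; [exact Ht|apply Rmax_l]. }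
replace (2 * M * (eps / 4 / (2 * M))) with (eps / 4) in H3 by (field; lra).
match type of H3 with Rabs (?x - _) <= _ => set (X := x) in * end.
replace (slice M a (slice M b h) z - slice M b (slice M a h) z)
  with ((X - slice M b (slice M a h) z) - (X - slice M a (slice M b h) z)) by ring.
eapply Rle_lt_trans; [apply Rabs_triang|]; rewrite Rabs_Ropp; lra.
Qed.

Lemma integ_slice_comm L c n M b h : 0 < M -> cont L h -> (forall i, c i <> b) ->
  integ c n M (slice M b h) = slice M b (integ c n M h).
Proof.
intros HM Hc Hb; induction n as [|n IH]; [reflexivity|]; simpl; rewrite IH.
apply (slice_comm L); [exact HM|apply cont_integ; [lra|exact Hc]|apply Hb].
Qed.

Lemma integ_comm L c n c' n' M h : 0 < M -> cont L h -> (forall i j, c i <> c' j) ->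
  integ c n M (integ c' n' M h) = integ c' n' M (integ c n M h).
Proof.
intros HM Hc Hb; induction n' as [|n' IH]; [reflexivity|]; simpl.
rewrite (integ_slice_comm L), IH; auto; apply cont_integ; [lra|exact Hc].
Qed.

Lemma slice_plus L M d f g : cont L f -> cont L g ->
  slice M d (fun z => f z + g z) = fun z => slice M d f z + slice M d g z.
Proof.
intros Hf Hg; apply functional_extensionality; intros z.
apply RInt_add; intros; now apply (cont_line L).
Qed.

Lemma integ_plus L c n M f g : 0 <= M -> cont L f -> cont L g ->
  integ c n M (fun z => f z + g z) = fun z => integ c n M f z + integ c n M g z.
Proof.
intros HM Hf Hg; induction n as [|n IH]; [reflexivity|]; simpl; rewrite IH.
apply (slice_plus L); now apply cont_integ.
Qed.

Definition indep (c : nat -> dir) (n : nat) (K : pt -> R) : Prop :=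
  forall z i t, (i < n)%nat -> K (set z (c i) t) = K z.

Lemma integ_indep_mult L c n M K h : 0 <= M -> cont L h -> indep c n K ->
  integ c n M (fun z => K z * h z) = fun z => K z * integ c n M h z.
Proof.
intros HM Hh HK; induction n as [|n IH]; [reflexivity|]; simpl.
rewrite IH by (intros z i t Hi; apply HK; lia).
apply functional_extensionality; intros z; unfold slice.
rewrite <- RInt_mult_l by (intros; apply (cont_line L), cont_integ; assumption).
apply RInt_ext_all; intros t; rewrite HK by lia; reflexivity.
Qed.

Lemma indep_const c n a : indep c n (fun _ => a).
Proof. intros z i t _; reflexivity. Qed.

Lemma integ_scal L c n M a h : 0 <= M -> cont L h ->
  integ c n M (fun z => a * h z) = fun z => a * integ c n M h z.
Proof. intros HM Hh; apply (integ_indep_mult L); auto; apply indep_const. Qed.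

Lemma integ_minus L c n M f g : 0 <= M -> cont L f -> cont L g ->
  integ c n M (fun z => f z - g z) = fun z => integ c n M f z - integ c n M g z.
Proof.
intros HM Hf Hg.
replace (fun z => f z - g z) with (fun z => f z + - 1 * g z)
  by (apply functional_extensionality; intros; ring).
rewrite (integ_plus L), (integ_scal L); auto.
- apply functional_extensionality; intros; ring.
- apply (cont_mult L (fun _ => - 1)); [apply cont_const|exact Hg].
Qed.

(** * Integrals along the fibre through a point, and their supports *)

Definition agree (c : nat -> dir) (n : nat) (w z : pt) : Prop :=
  forall d, (forall i, (i < n)%nat -> d <> c i) -> w d = z d.

Lemma agree_refl c n z : agree c n z z.
Proof. intros d _; reflexivity. Qed.

Lemma agree_set c n w z t : agree c n w (set z (c n) t) -> agree c (S n) w z.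
Proof.
intros H d Hd; rewrite H; [|intros i Hi; apply Hd; lia].
apply set_other, Hd; lia.
Qed.

Lemma integ_zero c n M h z : (forall w, agree c n w z -> h w = 0) -> integ c n M h z = 0.
Proof.
revert z; induction n as [|n IH]; intros z H; [apply H, agree_refl|].
apply RInt_zero_on; intros t _; apply IH; intros w Hw; eapply H, agree_set, Hw.
Qed.

Lemma indep_integ c n M h : indep c n (integ c n M h).
Proof.
intros z i t Hi; revert z; induction n as [|n IH]; intros z; [lia|].
simpl; unfold slice; apply RInt_ext_all; intros s.
destruct (dir_eq_dec (c i) (c n)) as [E|E]; [rewrite E, set_set; reflexivity|].
rewrite set_comm by exact E; apply IH.
destruct (Nat.eq_dec i n) as [->|]; [congruence|lia].
Qed.

(** Injectivity of [c] prevents the inner integration variables from overwriting the outer one. *)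
Lemma agree_set_val c n w z t : (forall i j, c i = c j -> i = j) ->
  agree c n w (set z (c n) t) -> w (c n) = t.
Proof.
intros Hc H; rewrite H, set_same; [reflexivity|].
intros i Hi E; apply Hc in E; lia.
Qed.

Lemma integ_enlarge L c n M M' h z : (forall i j, c i = c j -> i = j) -> cont L h ->
  0 <= M <= M' ->
  (forall w i, agree c n w z -> (i < n)%nat -> M < Rabs (w (c i)) -> h w = 0) ->
  integ c n M' h z = integ c n M h z.
Proof.
intros Hc Hh HM; revert z; induction n as [|n IH]; intros z Hs; [reflexivity|]; simpl; unfold slice.
rewrite (RInt_ext_all _ (fun t => integ c n M h (set z (c n) t))).
- apply RInt_enlarge; try lra.
  + intros; apply (cont_line L), cont_integ; [lra|exact Hh].
  + intros t Ht; apply integ_zero; intros w Hw.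
    apply (Hs w n); [eapply agree_set, Hw|lia|]; rewrite (agree_set_val _ _ _ _ _ Hc Hw).
    destruct Ht; [rewrite Rabs_left|rewrite Rabs_pos_eq]; lra.
- intros t; apply IH; intros w i Hw Hi; apply Hs; [eapply agree_set, Hw|lia].
Qed.

Lemma integ_agree c n M h z z' : agree c n z' z -> integ c n M h z' = integ c n M h z.
Proof.
revert z z'; induction n as [|n IH]; intros z z' H.
- simpl; f_equal; apply functional_extensionality; intros d; apply H; intros; lia.
- apply RInt_ext_all; intros t; apply IH; intros d Hd; unfold set.
  destruct (dir_eq_dec d (c n)); [reflexivity|]; apply H; intros i Hi.
  destruct (Nat.eq_dec i n) as [->|]; [assumption|apply Hd; lia].
Qed.

Lemma integ_agree_on L c n M h z w : 0 <= M -> cont L h ->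
  (forall d, In d L -> (forall i, (i < n)%nat -> d <> c i) -> w d = z d) ->
  integ c n M h w = integ c n M h z.
Proof.
(* [y] follows [z] on [L] and [w] elsewhere: the passage from [z] to [y] is invisible to a function
   continuous in [L], the one from [y] to [w] only moves integrated coordinates. *)
intros HM Hh H; set (y := fun d => if in_dec dir_eq_dec d L then z d else w d).
rewrite <- (cont_agree L (integ c n M h) z y).
- apply integ_agree; intros d Hd; unfold y; destruct (in_dec dir_eq_dec d L); auto.
- now apply cont_integ.
- intros d Hd; unfold y; destruct (in_dec dir_eq_dec d L); [reflexivity|contradiction].
Qed.

(** The bound involves the radius [r] of the support and not the interval, so the later moment
    estimates do not feel how large the support of the original function is. *)
Lemma RInt_bound_supp (g : R -> R) M r A : 0 <= M -> 0 <= r -> (forall t, continuous g t) ->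
  (forall t, Rabs (g t) <= A) -> (forall t, r < Rabs t -> g t = 0) ->
  Rabs (RInt g (- M) M) <= 2 * r * A.
Proof.
intros HM Hr Hc HA Hs.
assert (HA0 : 0 <= A) by (eapply Rle_trans; [apply Rabs_pos|apply (HA 0)]).
assert (B : forall a, 0 <= a -> Rabs (RInt g (- a) a) <= 2 * a * A).
{ intros a Ha; replace (2 * a) with (a - - a) by ring.
  apply abs_RInt_le_const; [lra|now apply ex_RInt_continuous'|auto]. }
destruct (Rle_lt_dec M r) as [H|H].
- eapply Rle_trans; [now apply B|]; apply Rmult_le_compat_r; lra.
- rewrite (RInt_enlarge g (- r) r) by
    (lra || exact Hc || (intros t Ht; apply Hs; destruct Ht; [rewrite Rabs_left|rewrite Rabs_pos_eq]; lra)).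
  now apply B.
Qed.

Lemma integ_bound L c n M r A h z : (forall i j, c i = c j -> i = j) -> cont L h ->
  0 <= M -> 0 <= r -> (forall w, agree c n w z -> Rabs (h w) <= A) ->
  (forall w i, agree c n w z -> (i < n)%nat -> r < Rabs (w (c i)) -> h w = 0) ->
  Rabs (integ c n M h z) <= (2 * r) ^ n * A.
Proof.
intros Hc Hh HM Hr; revert z; induction n as [|n IH]; intros z HA Hs.
- simpl; rewrite Rmult_1_l; apply HA, agree_refl.
- simpl; rewrite Rmult_assoc; apply RInt_bound_supp; auto.
  + intros; now apply (cont_line L), cont_integ.
  + intros t; apply IH.
    * intros w Hw; eapply HA, agree_set, Hw.
    * intros w i Hw Hi; apply Hs; [eapply agree_set, Hw|lia].
  + intros t Ht; apply integ_zero; intros w Hw.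
    apply (Hs w n); [eapply agree_set, Hw|lia|].
    rewrite (agree_set_val _ _ _ _ _ Hc Hw); exact Ht.
Qed.

Lemma integ_rprod L c n M (g : nat -> R -> R) z : (forall i j, c i = c j -> i = j) ->
  0 <= M -> (forall i, (i < n)%nat -> In (c i) L) -> (forall i t, continuous (g i) t) ->
  integ c n M (fun z => rprod n (fun i => g i (z (c i)))) z
  = rprod n (fun i => RInt (g i) (- M) M).
Proof.
intros Hc HM HL Hg; revert z; induction n as [|n IH]; intros z; [reflexivity|]; simpl.
replace (fun z => rprod n (fun i => g i (z (c i))) * g n (z (c n)))
  with (fun z => g n (z (c n)) * rprod n (fun i => g i (z (c i))))
  by (apply functional_extensionality; intros; ring).
rewrite (integ_indep_mult L); auto.
- unfold slice; rewrite Rmult_comm.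
  rewrite (RInt_ext_all _ (fun t => rprod n (fun i => RInt (g i) (- M) M) * g n t)).
  + rewrite RInt_mult_l by auto; ring.
  + intros t; rewrite set_same, IH by auto; ring.
- apply (cont_rprod L n (fun i z => g i (z (c i)))); intros i Hi; apply cont_coord; auto.
- intros w i t Hi; rewrite set_other; [reflexivity|].
  intros E; apply Hc in E; lia.
Qed.

(** * Smooth functions of several variables *)

Definition partial (d : dir) (h v : pt -> R) : Prop :=
  forall z, is_derive (fun t => h (set z d t)) (z d) (v z).

Fixpoint Ck (L : list dir) (k : nat) (h : pt -> R) : Prop :=
  match k with
  | O => cont L h
  | S k => cont L h /\ forall d, In d L -> exists v, Ck L k v /\ partial d h v
  end.

Definition smooth (L : list dir) (h : pt -> R) : Prop := forall k, Ck L k h.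

Lemma Ck_cont L k h : Ck L k h -> cont L h.
Proof. destruct k; [trivial|intros [H _]; exact H]. Qed.

Lemma smooth_cont L h : smooth L h -> cont L h.
Proof. intros H; exact (H O). Qed.

Lemma Ck_pred L k h : Ck L (S k) h -> Ck L k h.
Proof.
revert h; induction k as [|k IH]; intros h [Hc H]; [exact Hc|].
split; [exact Hc|]; intros d Hd; destruct (H d Hd) as [v [Hv Hp]]; exists v; auto.
Qed.

Lemma partial_const d c : partial d (fun _ => c) (fun _ => 0).
Proof. intros z; apply (is_derive_const (K := R_AbsRing) (V := R_NormedModule)). Qed.

Lemma smooth_const L c : smooth L (fun _ => c).
Proof.
intros k; revert c; induction k as [|k IH]; intros c; [apply cont_const|].
split; [apply cont_const|]; intros d _; exists (fun _ => 0); split; [apply IH|apply partial_const].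
Qed.

Lemma Ck_plus L k f g : Ck L k f -> Ck L k g -> Ck L k (fun z => f z + g z).
Proof.
revert f g; induction k as [|k IH]; intros f g Hf Hg; [now apply cont_plus|].
split; [apply cont_plus; eapply Ck_cont; eassumption|]; intros d Hd.
destruct Hf as [_ Hf], Hg as [_ Hg].
destruct (Hf d Hd) as [f' [Cf Df]], (Hg d Hd) as [g' [Cg Dg]].
exists (fun z => f' z + g' z); split; [now apply IH|]; intros z.
apply (is_derive_plus (K := R_AbsRing) (V := R_NormedModule)); [apply Df|apply Dg].
Qed.

Lemma Ck_mult L k f g : Ck L k f -> Ck L k g -> Ck L k (fun z => f z * g z).
Proof.
revert f g; induction k as [|k IH]; intros f g Hf Hg; [now apply cont_mult|].
split; [apply cont_mult; eapply Ck_cont; eassumption|]; intros d Hd.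
pose proof (Ck_pred _ _ _ Hf) as Pf; pose proof (Ck_pred _ _ _ Hg) as Pg.
destruct Hf as [_ Hf], Hg as [_ Hg].
destruct (Hf d Hd) as [f' [Cf Df]], (Hg d Hd) as [g' [Cg Dg]].
exists (fun z => f' z * g z + f z * g' z); split; [apply Ck_plus; now apply IH|]; intros z.
replace (f' z * g z + f z * g' z)
  with (f' z * g (set z d (z d)) + f (set z d (z d)) * g' z) by now rewrite set_id.
apply is_derive_Reals, derivable_pt_lim_mult; apply is_derive_Reals; [apply Df|apply Dg].
Qed.

Lemma smooth_plus L f g : smooth L f -> smooth L g -> smooth L (fun z => f z + g z).
Proof. intros Hf Hg k; now apply Ck_plus. Qed.

Lemma smooth_mult L f g : smooth L f -> smooth L g -> smooth L (fun z => f z * g z).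
Proof. intros Hf Hg k; now apply Ck_mult. Qed.

Lemma smooth_minus L f g : smooth L f -> smooth L g -> smooth L (fun z => f z - g z).
Proof.
intros Hf Hg; replace (fun z => f z - g z) with (fun z => f z + - 1 * g z)
  by (apply functional_extensionality; intros; ring).
apply smooth_plus; [exact Hf|]; apply (smooth_mult L (fun _ => - 1)); [apply smooth_const|exact Hg].
Qed.

Lemma smooth_rprod L n (F : nat -> pt -> R) : (forall i, (i < n)%nat -> smooth L (F i)) ->
  smooth L (fun z => rprod n (fun i => F i z)).
Proof.
induction n as [|n IH]; intros H; [apply (smooth_const L 1)|].
apply (smooth_mult L (fun z => rprod n (fun i => F i z)) (F n)); auto.
Qed.

Lemma smooth_coord L g d : smooth1 g -> In d L -> smooth L (fun z => g (z d)).
Proof.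
intros Hg Hd k; specialize (Hg k); revert g Hg; induction k as [|k IH]; intros g Hg.
- apply cont_coord; [exact Hg|exact Hd].
- split; [apply cont_coord; [intros t; exact (Ck1_continuous _ _ t Hg)|exact Hd]|].
  destruct Hg as [g' [Dg Cg]]; intros e He.
  destruct (dir_eq_dec e d) as [->|Hne].
  + exists (fun z => g' (z d)); split; [now apply IH|]; intros z.
    apply (is_derive_ext g); [intros t; now rewrite set_same|apply Dg].
  + exists (fun _ => 0); split; [apply smooth_const|]; intros z.
    apply (is_derive_ext (fun _ => g (z d))); [intros t; now rewrite set_other by congruence|].
    apply (is_derive_const (K := R_AbsRing) (V := R_NormedModule)).
Qed.

(** Differentiation under the integral sign; the joint continuity of the derivative in parameter and
    variable is a special case of [cont L v]. *)
Lemma partial_slice L M d e h v : cont L h -> cont L v -> e <> d ->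
  partial e h v -> partial e (slice M d h) (slice M d v).
Proof.
intros Hh Hv Hne Hp z; unfold slice.
assert (D : forall s t, is_derive (fun s => h (set (set z e s) d t)) s (v (set (set z e s) d t))).
{ intros s t; specialize (Hp (set (set z e s) d t)).
  rewrite set_other, set_same in Hp by exact Hne.
  eapply is_derive_ext; [|exact Hp]; intros u; simpl.
  rewrite set_comm, set_set by congruence; reflexivity. }
assert (E : forall s t, Derive (fun s : R => h (set (set z e s) d t)) s = v (set (set z e s) d t) :> R)
  by (intros; apply is_derive_unique, D).
replace (RInt (fun t => v (set z d t)) (- M) M)
  with (RInt (fun t => Derive (fun s => h (set (set z e s) d t)) (z e)) (- M) M).
2: { apply RInt_ext_all; intros t; rewrite E, set_id; reflexivity. }
apply (is_derive_RInt_param (fun s t => h (set (set z e s) d t))).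
- exists (mkposreal 1 Rlt_0_1); intros s _ t _; eexists; apply D.
- intros t _ eps.
  destruct (Hv (set (set z e (z e)) d t) eps (cond_pos eps)) as [delta [Hd H]].
  exists (mkposreal delta Hd); intros s t' Hs Ht'; simpl in Hs, Ht'.
  rewrite 2!E.
  apply H; intros a _; unfold set.
  destruct (dir_eq_dec a d); [exact Ht'|]; destruct (dir_eq_dec a e); [exact Hs|].
  rewrite Rminus_diag, Rabs_R0; exact Hd.
- exists (mkposreal 1 Rlt_0_1); intros s _; apply ex_RInt_continuous'.
  intros t; now apply (cont_line L).
Qed.

Lemma smooth_slice L M d h : 0 <= M -> smooth L h -> smooth L (slice M d h).
Proof.
intros HM Hh k; specialize (Hh k); revert h Hh; induction k as [|k IH]; intros h Hh.
- now apply cont_slice.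
- split; [apply cont_slice; [exact HM|exact (Ck_cont _ _ _ Hh)]|]; intros e He.
  destruct Hh as [Hc Hh]; destruct (dir_eq_dec e d) as [->|Hne].
  + exists (fun _ => 0); split; [apply smooth_const|]; intros z.
    apply (is_derive_ext (fun _ => slice M d h z)).
    * intros t; apply RInt_ext_all; intros s; now rewrite set_set.
    * apply (is_derive_const (K := R_AbsRing) (V := R_NormedModule)).
  + destruct (Hh e He) as [v [Cv Pv]]; exists (slice M d v); split; [now apply IH|].
    apply (partial_slice L); auto; exact (Ck_cont _ _ _ Cv).
Qed.

Lemma smooth_integ L c n M h : 0 <= M -> smooth L h -> smooth L (integ c n M h).
Proof. intros HM Hh; induction n as [|n IH]; [exact Hh|]; now apply smooth_slice. Qed.

Lemma partial_unique d h v v' : partial d h v -> partial d h v' -> v = v'.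
Proof.
intros H H'; apply functional_extensionality; intros z.
rewrite <- (is_derive_unique _ _ _ (H z)); apply is_derive_unique, H'.
Qed.

(** For each [k] the definition provides some derivative of class [k], a priori depending on [k];
    uniqueness of derivatives glues them into one smooth function. *)
Lemma smooth_partial L d h : smooth L h -> In d L -> exists v, smooth L v /\ partial d h v.
Proof.
intros Hh Hd; destruct (Hh 1%nat) as [_ H1]; destruct (H1 d Hd) as [v [_ Pv]].
exists v; split; [|exact Pv]; intros k.
destruct (Hh (S k)) as [_ Hk]; destruct (Hk d Hd) as [w [Cw Pw]].
rewrite (partial_unique _ _ _ _ Pv Pw); exact Cw.
Qed.

(** [smooth2] asks for a single family indexed by words of directions. A differentiation operator is
    chosen once for all functions and directions, then folded along the word. *)
Lemma smooth_iterated_partials L h : smooth L h -> exists D : list dir -> pt -> R,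
  D nil = h /\ (forall a, smooth L (D a)) /\
  forall a d, In d L -> partial d (D a) (D (d :: a)).
Proof.
intros Hh.
assert (E : forall p : (pt -> R) * dir, exists v, smooth L (fst p) ->
  smooth L v /\ (In (snd p) L -> partial (snd p) (fst p) v)).
{ intros [u d]; simpl; destruct (classic (smooth L u /\ In d L)) as [[Hu Hd]|Hn].
  - destruct (smooth_partial L d u Hu Hd) as [v Hv]; exists v; tauto.
  (* Dummy value making the operator total when there is nothing to differentiate; smoothness must
     survive even for directions outside [L]. *)
  - exists u; intros Hu; split; [exact Hu|tauto]. }
destruct (choice _ E) as [der Hder].
exists (fun a => fold_right (fun d u => der (u, d)) h a).
assert (S : forall a, smooth L (fold_right (fun d u => der (u, d)) h a)).
{ induction a as [|d a IH]; [exact Hh|]; exact (proj1 (Hder (_, d) IH)). }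
split; [reflexivity|split; [exact S|]]; intros a d Hd.
exact (proj2 (Hder (_, d) (S a)) Hd).
Qed.

Lemma iterated_partials_smooth L (D : list dir -> pt -> R) :
  (forall a, cont L (D a)) -> (forall a d, In d L -> partial d (D a) (D (d :: a))) ->
  smooth L (D nil).
Proof.
intros Hc Hp k; generalize (@nil dir); induction k as [|k IH]; intros a; [apply Hc|].
split; [apply Hc|]; intros d Hd; exists (D (d :: a)); auto.
Qed.

(** * Dyadic layers in one block of variables *)

Definition lsum (l : list (nat -> nat)) (F : (nat -> nat) -> R) : R :=
  fold_right (fun a r => F a + r) 0 l.

Lemma lsum_cons a l F : lsum (a :: l) F = F a + lsum l F.
Proof. reflexivity. Qed.

Lemma lsum_ext l F G : (forall a, In a l -> F a = G a) -> lsum l F = lsum l G.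
Proof.
induction l as [|a l IH]; intros H; [reflexivity|]; simpl.
rewrite H by now left. f_equal; apply IH; intros b Hb; apply H; now right.
Qed.

Lemma lsum_app l l' F : lsum (l ++ l') F = lsum l F + lsum l' F.
Proof. induction l as [|a l IH]; simpl; [ring|]; rewrite IH; ring. Qed.

Lemma lsum_0 l F : (forall a, In a l -> F a = 0) -> lsum l F = 0.
Proof.
induction l as [|a l IH]; intros H; [reflexivity|]; simpl.
rewrite H, IH; [ring|intros; apply H; now right|now left].
Qed.

Lemma lsum_abs_le l F A : (forall a, In a l -> Rabs (F a) <= A) ->
  Rabs (lsum l F) <= INR (length l) * A.
Proof.
induction l as [|a l IH]; intros H; [simpl; rewrite Rabs_R0; lra|].
change (length (a :: l)) with (S (length l)); rewrite S_INR; simpl lsum.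
eapply Rle_trans; [apply Rabs_triang|].
assert (Rabs (F a) <= A) by (apply H; now left).
assert (Rabs (lsum l F) <= INR (length l) * A) by (apply IH; intros; apply H; now right).
unfold lsum in *; lra.
Qed.

Lemma smooth_lsum L l (F : (nat -> nat) -> pt -> R) : (forall a, In a l -> smooth L (F a)) ->
  smooth L (fun z => lsum l (fun a => F a z)).
Proof.
induction l as [|a l IH]; intros H; [apply (smooth_const L 0)|].
apply (smooth_plus L (F a) (fun z => lsum l (fun a => F a z))); [apply H; now left|].
apply IH; intros; apply H; now right.
Qed.

Lemma integ_lsum L c n M l (F : (nat -> nat) -> pt -> R) : 0 <= M ->
  (forall a, In a l -> smooth L (F a)) ->
  integ c n M (fun z => lsum l (fun a => F a z)) = fun z => lsum l (fun a => integ c n M (F a) z).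
Proof.
intros HM; induction l as [|a l IH]; intros H.
- apply functional_extensionality; intros z; apply integ_zero; reflexivity.
- change (integ c n M (fun z => F a z + lsum l (fun b => F b z))
    = fun z => integ c n M (F a) z + lsum l (fun b => integ c n M (F b) z)).
  rewrite (integ_plus L c n M (F a)), IH; auto.
  + intros; apply H; now right.
  + apply smooth_cont, H; now left.
  + apply smooth_cont, smooth_lsum; intros; apply H; now right.
Qed.

(** * Enumeration of multi-indices *)

Definition updn (a : nat -> nat) (m k : nat) : nat -> nat :=
  fun i => if Nat.eqb i m then k else a i.

Fixpoint all_indices (n s : nat) : list (nat -> nat) :=
  match n with
  | O => (fun _ => O) :: nil
  | S m => flat_map (fun a => map (updn a m) (seq 0 (S s))) (all_indices m s)
  end.

Definition kron (i j : nat) : R := if Nat.eqb i j then 1 else 0.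

Lemma lsum_flat_map l f F : lsum (flat_map f l) F = lsum l (fun a => lsum (f a) F).
Proof.
induction l as [|a l IH]; simpl; [reflexivity|]; rewrite lsum_app, IH; reflexivity.
Qed.

Lemma lsum_map_kron (g : nat -> nat -> nat) a b len (F : nat -> R) (H : (nat -> nat) -> R) :
  (a <= b < a + len)%nat -> (forall k, H (g k) = F k * kron k b) ->
  lsum (map g (seq a len)) H = F b.
Proof.
intros Hb HH; revert a Hb; induction len as [|len IH]; intros a Hb; [lia|]; simpl.
rewrite HH; unfold kron; destruct (Nat.eqb_spec a b) as [->|Hne].
- replace (fold_right _ _ _) with (lsum (map g (seq (S b) len)) H) by reflexivity.
  rewrite lsum_0; [ring|]; intros x Hx; apply in_map_iff in Hx.
  destruct Hx as [k [<- Hk]]; apply in_seq in Hk; rewrite HH; unfold kron.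
  destruct (Nat.eqb_spec k b); [lia|ring].
- replace (fold_right _ _ _) with (lsum (map g (seq (S a) len)) H) by reflexivity.
  rewrite IH by lia; ring.
Qed.

(** Each multi-index with entries at most [s] is listed exactly once, up to its values beyond [n],
    so the Kronecker product selects one term; the second hypothesis makes the choice of
    representative irrelevant. *)
Lemma lsum_all_indices n s b (F : (nat -> nat) -> R) :
  (forall i, (i < n)%nat -> (b i <= s)%nat) ->
  (forall a a', (forall i, (i < n)%nat -> a i = a' i) -> F a = F a') ->
  lsum (all_indices n s) (fun a => F a * rprod n (fun i => kron (a i) (b i))) = F b.
Proof.
revert F; induction n as [|n IH]; intros F Hb HF.
- simpl; rewrite Rmult_1_r, Rplus_0_r; apply HF; intros; lia.
- change (all_indices (S n) s)
    with (flat_map (fun a => map (updn a n) (seq 0 (S s))) (all_indices n s)).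
  rewrite lsum_flat_map.
  rewrite (lsum_ext _ _ (fun a => F (updn a n (b n)) * rprod n (fun i => kron (a i) (b i)))).
  + rewrite IH.
    * apply HF; intros i _; unfold updn; destruct (Nat.eqb_spec i n); congruence.
    * intros i Hi; apply Hb; lia.
    * intros a a' H; apply HF; intros i Hi; unfold updn.
      destruct (Nat.eqb_spec i n); [reflexivity|apply H; lia].
  + intros a _; apply (lsum_map_kron (updn a n) 0 (b n) (S s)
      (fun k => F (updn a n k) * rprod n (fun i => kron (a i) (b i)))).
    * specialize (Hb n); lia.
    * intros k; simpl; rewrite Rmult_assoc; do 2 f_equal.
      -- apply rprod_ext; intros i Hi; unfold updn; destruct (Nat.eqb_spec i n); [lia|reflexivity].
      -- unfold updn; rewrite Nat.eqb_refl; reflexivity.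
Qed.

Definition indices (n s : nat) : list (nat -> nat) :=
  filter (fun a => Nat.leb (nsum n a) s) (all_indices n s).

Lemma lsum_filter l p F : lsum (filter p l) F = lsum l (fun a => (if p a then 1 else 0) * F a).
Proof.
induction l as [|a l IH]; [reflexivity|]; simpl filter; rewrite (lsum_cons a l).
destruct (p a); [rewrite lsum_cons|]; rewrite IH; ring.
Qed.

Lemma nsum_ge n a i : (i < n)%nat -> (a i <= nsum n a)%nat.
Proof.
induction n as [|n IH]; intros Hi; simpl; [lia|].
destruct (Nat.eq_dec i n) as [->|]; [lia|]; specialize (IH ltac:(lia)); lia.
Qed.

Lemma nsum_ext n a a' : (forall i, (i < n)%nat -> a i = a' i) -> nsum n a = nsum n a'.
Proof. induction n as [|n IH]; intros H; simpl; [reflexivity|]; rewrite IH, H; auto. Qed.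

Lemma indices_nsum n s a : In a (indices n s) -> (nsum n a <= s)%nat.
Proof. intros H; apply filter_In in H; apply Nat.leb_le, H. Qed.

Lemma lsum_indices n s b (F : (nat -> nat) -> R) : (nsum n b <= s)%nat ->
  (forall a a', (forall i, (i < n)%nat -> a i = a' i) -> F a = F a') ->
  lsum (indices n s) (fun a => F a * rprod n (fun i => kron (a i) (b i))) = F b.
Proof.
intros Hb HF; unfold indices; rewrite lsum_filter.
rewrite (lsum_ext _ _ (fun a => (if Nat.leb (nsum n a) s then 1 else 0) * F a
                                * rprod n (fun i => kron (a i) (b i)))) by (intros; ring).
rewrite (lsum_all_indices n s b (fun a => (if Nat.leb (nsum n a) s then 1 else 0) * F a)).
- apply Nat.leb_le in Hb; rewrite Hb; ring.
- intros i Hi; pose proof (nsum_ge n b i Hi); lia.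
- intros a a' H; rewrite (nsum_ext n a a' H), (HF a a' H); reflexivity.
Qed.

Lemma rprod_abs_le n f g : (forall i, (i < n)%nat -> Rabs (f i) <= g i) ->
  Rabs (rprod n f) <= rprod n g.
Proof.
induction n as [|n IH]; intros H; simpl; [rewrite Rabs_R1; lra|].
rewrite Rabs_mult; apply Rmult_le_compat; try apply Rabs_pos; auto.
Qed.

Lemma rprod_0 n f i : (i < n)%nat -> f i = 0 -> rprod n f = 0.
Proof.
induction n as [|n IH]; intros Hi H; [lia|]; simpl.
destruct (Nat.eq_dec i n) as [->|]; [rewrite H; ring|]; rewrite IH by (assumption || lia); ring.
Qed.

Lemma rprod_1 n f : (forall i, (i < n)%nat -> f i = 1) -> rprod n f = 1.
Proof. induction n as [|n IH]; intros H; simpl; [reflexivity|]; rewrite IH, H; auto; ring. Qed.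

Lemma rprod_pow n r a : rprod n (fun i => r ^ a i) = r ^ nsum n a.
Proof. induction n as [|n IH]; simpl; [reflexivity|]; rewrite IH, pow_add; reflexivity. Qed.

Lemma rprod_const n r : rprod n (fun _ => r) = r ^ n.
Proof. induction n as [|n IH]; simpl; [reflexivity|]; rewrite IH; ring. Qed.

Lemma nsum_S n a : nsum n (fun i => S (a i)) = (n + nsum n a)%nat.
Proof. induction n as [|n IH]; simpl; [reflexivity|]; rewrite IH; lia. Qed.

(** * Functions with vanishing moments in two blocks *)

Definition monodir (c : nat -> dir) (n : nat) (a : nat -> nat) (z : pt) : R :=
  mono n a (fun i => z (c i)).

Definition supported (L : list dir) (M : R) (u : pt -> R) : Prop :=
  forall z d, In d L -> M < Rabs (z d) -> u z = 0.

Definition moments (c : nat -> dir) (n s : nat) (M : R) (u : pt -> R) : Prop :=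
  forall a z, (nsum n a <= s)%nat -> integ c n M (fun z => u z * monodir c n a z) z = 0.

(** Requiring the moments on every box beyond some [M0] expresses integrals over the whole space
    without improper integrals. The two blocks play symmetric roles, so a single decomposition
    serves both. *)
Definition testfun L c n s c' n' s' (u : pt -> R) : Prop :=
  smooth L u /\ exists M0, 0 < M0 /\ supported L M0 u /\
    forall M, M0 <= M -> moments c n s M u /\ moments c' n' s' M u.

Lemma testfun_sym L c n s c' n' s' u :
  testfun L c n s c' n' s' u -> testfun L c' n' s' c n s u.
Proof.
intros [Hs [M0 [HM [Hsup H]]]]; split; [exact Hs|]; exists M0; split; [exact HM|split; [exact Hsup|]].
intros M HM'; destruct (H M HM'); now split.
Qed.

Lemma smooth_monodir L c n a : (forall i, (i < n)%nat -> In (c i) L) -> smooth L (monodir c n a).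
Proof.
intros HL; apply (smooth_rprod L n (fun i z => z (c i) ^ a i)); intros i Hi.
apply (smooth_coord L (fun t => t ^ a i)); [apply smooth1_pow|auto].
Qed.

Lemma moments_minus L c n s M u v : (forall i, (i < n)%nat -> In (c i) L) -> 0 <= M ->
  smooth L u -> smooth L v -> moments c n s M u -> moments c n s M v ->
  moments c n s M (fun z => u z - v z).
Proof.
intros HL HM Hu Hv Mu Mv a z Ha.
replace (fun z => (u z - v z) * monodir c n a z)
  with (fun z => u z * monodir c n a z - v z * monodir c n a z)
  by (apply functional_extensionality; intros; ring).
rewrite (integ_minus L); auto; [rewrite Mu, Mv by exact Ha; ring| |];
  apply smooth_cont, smooth_mult; auto; now apply smooth_monodir.
Qed.

Lemma testfun_minus L c n s c' n' s' u v :
  (forall i, (i < n)%nat -> In (c i) L) -> (forall i, (i < n')%nat -> In (c' i) L) ->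
  testfun L c n s c' n' s' u -> testfun L c n s c' n' s' v ->
  testfun L c n s c' n' s' (fun z => u z - v z).
Proof.
intros HL HL' [Su [M1 [P1 [Supu Mu]]]] [Sv [M2 [P2 [Supv Mv]]]].
split; [now apply smooth_minus|]; exists (Rmax M1 M2).
pose proof (Rmax_l M1 M2); pose proof (Rmax_r M1 M2); split; [lra|split].
- intros z d Hd Hz; rewrite (Supu z d), (Supv z d) by (assumption || lra); ring.
- intros M HM; destruct (Mu M ltac:(lra)), (Mv M ltac:(lra)).
  split; apply (moments_minus L); auto; lra.
Qed.

Lemma testfun_zero L c n s c' n' s' : testfun L c n s c' n' s' (fun _ => 0).
Proof.
split; [apply smooth_const|]; exists 1; split; [lra|split; [intros z d _ _; reflexivity|]].
intros M _; split; intros a z _; apply integ_zero; intros; ring.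
Qed.

Lemma testfun_plus L c n s c' n' s' u v :
  (forall i, (i < n)%nat -> In (c i) L) -> (forall i, (i < n')%nat -> In (c' i) L) ->
  testfun L c n s c' n' s' u -> testfun L c n s c' n' s' v ->
  testfun L c n s c' n' s' (fun z => u z + v z).
Proof.
intros HL HL' Hu Hv.
replace (fun z => u z + v z) with (fun z => u z - (0 - v z))
  by (apply functional_extensionality; intros; ring).
apply testfun_minus; auto; apply (testfun_minus L c n s c' n' s' (fun _ => 0) v); auto.
apply testfun_zero.
Qed.

(** * Truncation at scale [2 ^ k] with restored moments *)

Section Decomposition.

Variables (L : list dir) (c c' : nat -> dir) (n n' s s' : nat) (eta : nat -> R -> R) (R0 B : R).
Hypothesis Hinj : forall i j, c i = c j -> i = j.
Hypothesis Hdisj : forall i j, c i <> c' j.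
Hypothesis HL : forall i, (i < n)%nat -> In (c i) L.
Hypothesis HL' : forall i, (i < n')%nat -> In (c' i) L.
Hypothesis HR0 : 1 <= R0.
Hypothesis HB : 1 <= B.
Hypothesis Heta : dual_family s eta R0 B.

Definition cut (k : nat) (z : pt) : R := rprod n (fun i => cutoff (/ 2 ^ k * z (c i) + 0)).

(** The prefactor cancels the Jacobian [2 ^ k] and the homogeneity [(2 ^ k) ^ j] of the monomial, so
    duality holds with the same constant 1 at every scale. *)
Definition etas (k j : nat) (t : R) : R := / (2 ^ k) ^ S j * eta j (/ 2 ^ k * t + 0).

Definition psi (k : nat) (a : nat -> nat) (z : pt) : R := rprod n (fun i => etas k (a i) (z (c i))).

Lemma pow2_gt0 k : 0 < 2 ^ k.
Proof. apply pow_lt; lra. Qed.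

Lemma scale_le k x r : Rabs x <= r * 2 ^ k -> Rabs (/ 2 ^ k * x + 0) <= r.
Proof.
intros H; pose proof (pow2_gt0 k) as Hp.
rewrite Rplus_0_r, Rabs_mult, Rabs_inv, (Rabs_pos_eq (2 ^ k)), Rmult_comm by lra.
apply Rle_div_l; lra.
Qed.

Lemma scale_ge k x r : r * 2 ^ k <= Rabs x -> r <= Rabs (/ 2 ^ k * x + 0).
Proof.
intros H; pose proof (pow2_gt0 k) as Hp.
rewrite Rplus_0_r, Rabs_mult, Rabs_inv, (Rabs_pos_eq (2 ^ k)), Rmult_comm by lra.
apply Rle_div_r; lra.
Qed.

Lemma scale_gt k x r : r * 2 ^ k < Rabs x -> r < Rabs (/ 2 ^ k * x + 0).
Proof.
intros H; pose proof (pow2_gt0 k) as Hp.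
rewrite Rplus_0_r, Rabs_mult, Rabs_inv, (Rabs_pos_eq (2 ^ k)), Rmult_comm by lra.
apply Rlt_div_r; lra.
Qed.

Lemma cut_range k z : 0 <= cut k z <= 1.
Proof.
unfold cut; induction n as [|m IH]; simpl; [lra|].
pose proof (cutoff_range (/ 2 ^ k * z (c m) + 0)).
specialize (IH (fun i Hi => HL i ltac:(lia))).
split; [apply Rmult_le_pos; lra|].
apply Rle_trans with (1 * 1); [apply Rmult_le_compat|]; lra.
Qed.

Lemma cut_in k z : (forall i, (i < n)%nat -> Rabs (z (c i)) <= 2 ^ k) -> cut k z = 1.
Proof.
intros H; apply rprod_1; intros i Hi; apply cutoff_in, scale_le; rewrite Rmult_1_l; auto.
Qed.

Lemma cut_out k z i : (i < n)%nat -> 2 * 2 ^ k <= Rabs (z (c i)) -> cut k z = 0.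
Proof. intros Hi H; apply (rprod_0 n _ i Hi), cutoff_out, scale_ge, H. Qed.

Lemma smooth_cut k : smooth L (cut k).
Proof.
apply (smooth_rprod L n (fun i z => cutoff (/ 2 ^ k * z (c i) + 0))); intros i Hi.
apply (smooth_coord L (fun t => cutoff (/ 2 ^ k * t + 0))); [|auto].
apply smooth1_comp_affine, smooth1_cutoff.
Qed.

Lemma smooth1_etas k j : smooth1 (etas k j).
Proof.
apply smooth1_mult; [apply smooth1_const|].
apply smooth1_comp_affine, (dual_smooth _ _ _ _ Heta).
Qed.

Lemma smooth_psi k a : smooth L (psi k a).
Proof.
apply (smooth_rprod L n (fun i z => etas k (a i) (z (c i)))); intros i Hi.
apply smooth_coord; [apply smooth1_etas|auto].
Qed.

Lemma psi_out k a z i : (i < n)%nat -> R0 * 2 ^ k < Rabs (z (c i)) -> psi k a z = 0.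
Proof.
intros Hi H; apply (rprod_0 n _ i Hi); unfold etas.
rewrite (dual_supp _ _ _ _ Heta); [ring|]; now apply scale_gt.
Qed.

Lemma psi_bound k a z : (nsum n a <= s)%nat ->
  Rabs (psi k a z) <= B ^ n * / (2 ^ k) ^ (n + nsum n a).
Proof.
intros Ha; pose proof (pow2_gt0 k) as Hp.
rewrite <- nsum_S, <- pow_inv, <- rprod_pow, <- rprod_const, <- rprod_mult.
apply rprod_abs_le; intros i Hi; unfold etas; rewrite Rabs_mult.
rewrite <- pow_inv, Rmult_comm, (Rabs_pos_eq ((/ 2 ^ k) ^ _))
  by (apply pow_le; left; now apply Rinv_0_lt_compat).
apply Rmult_le_compat_r; [apply pow_le; left; now apply Rinv_0_lt_compat|].
apply (dual_bound _ _ _ _ Heta); pose proof (nsum_ge n a i Hi); lia.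
Qed.

Lemma etas_moment k j i M : (j <= s)%nat -> (i <= s)%nat -> R0 * 2 ^ k <= M ->
  RInt (fun t => etas k j t * t ^ i) (- M) M = kron j i :> R.
Proof.
intros Hj Hi HM; pose proof (pow2_gt0 k) as Hp.
rewrite (RInt_ext_all _ (fun t => / (2 ^ k) ^ S j * (eta j (/ 2 ^ k * t + 0) * t ^ i)))
  by (intros; unfold etas; ring).
pose proof (dual_smooth _ _ _ _ Heta j) as Sj.
rewrite RInt_mult_l, RInt_dilate, (dual_moment _ _ _ _ Heta j i); auto.
- unfold kron; destruct (Nat.eqb_spec j i) as [->|]; [|ring].
  rewrite Rmult_1_r; apply Rinv_l, pow_nonzero; lra.
- apply Rle_div_r; lra.
- intros t; apply (continuous_moment (fun t => eta j (/ 2 ^ k * t + 0))).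
  now apply smooth1_comp_affine.
Qed.

Lemma psi_moment k a b M z : (nsum n a <= s)%nat -> (nsum n b <= s)%nat -> R0 * 2 ^ k <= M ->
  integ c n M (fun z => psi k a z * monodir c n b z) z = rprod n (fun i => kron (a i) (b i)).
Proof.
intros Ha Hb HM; pose proof (pow2_gt0 k) as Hp.
replace (fun z => psi k a z * monodir c n b z)
  with (fun z : pt => rprod n (fun i => etas k (a i) (z (c i)) * z (c i) ^ b i))
  by (apply functional_extensionality; intros w; apply rprod_mult).
rewrite (integ_rprod L c n M (fun i t => etas k (a i) t * t ^ b i)); auto.
- apply rprod_ext; intros i Hi; apply etas_moment; [| |exact HM];
    [pose proof (nsum_ge n a i Hi)|pose proof (nsum_ge n b i Hi)]; lia.
- nra.
- intros; apply continuous_moment, smooth1_etas.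
Qed.

Lemma indep_coords (G : (nat -> R) -> R) : indep c' n' (fun z => G (fun i => z (c i))).
Proof.
intros z i t Hi; f_equal; apply functional_extensionality; intros j; apply set_other, Hdisj.
Qed.

Variables (u : pt -> R) (M0 : R).
Hypothesis Hu : smooth L u.
Hypothesis HM0 : 0 < M0.
Hypothesis Hsupp : supported L M0 u.
Hypothesis Hmom : forall M, M0 <= M -> moments c n s M u.
Hypothesis Hmom' : forall M, M0 <= M -> moments c' n' s' M u.

(** The box is the support box [M0] of [u], the same for all [k], so that coefficients at different
    scales can be subtracted under one integral. The result depends only on the variables outside
    the block. *)
Definition mom (k : nat) (a : nat -> nat) : pt -> R :=
  integ c n M0 (fun z => u z * cut k z * monodir c n a z).

Lemma smooth_mom_integrand k a : smooth L (fun z => u z * cut k z * monodir c n a z).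
Proof.
apply (smooth_mult L (fun z => u z * cut k z)); [|now apply smooth_monodir].
apply smooth_mult; [exact Hu|apply smooth_cut].
Qed.

Lemma smooth_mom k a : smooth L (mom k a).
Proof. apply smooth_integ; [lra|apply smooth_mom_integrand]. Qed.

Lemma mom_enlarge k a M : M0 <= M ->
  mom k a = integ c n M (fun z => u z * cut k z * monodir c n a z).
Proof.
intros HM; apply functional_extensionality; intros z; symmetry.
apply (integ_enlarge L); auto; [apply smooth_cont, smooth_mom_integrand|lra|].
intros w i _ Hi Hw; rewrite (Hsupp w (c i)); auto; ring.
Qed.

Lemma mom_ext k a a' : (forall i, (i < n)%nat -> a i = a' i) -> mom k a = mom k a'.
Proof.
intros H; unfold mom; f_equal; apply functional_extensionality; intros z; f_equal.
apply rprod_ext; intros i Hi; rewrite H by exact Hi; reflexivity.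
Qed.

Definition trunc (k : nat) (z : pt) : R :=
  u z * cut k z - lsum (indices n s) (fun a => mom k a z * psi k a z).

Lemma smooth_trunc k : smooth L (trunc k).
Proof.
apply smooth_minus; [apply smooth_mult; [exact Hu|apply smooth_cut]|].
apply (smooth_lsum L (indices n s) (fun a z => mom k a z * psi k a z)); intros a _.
apply smooth_mult; [apply smooth_mom|apply smooth_psi].
Qed.

Lemma trunc_mult k (h : pt -> R) : (fun z => trunc k z * h z) =
  fun z => u z * cut k z * h z
           - lsum (indices n s) (fun a => mom k a z * psi k a z * h z).
Proof.
apply functional_extensionality; intros z; unfold trunc.
induction (indices n s) as [|a l IH]; simpl; [ring|]; unfold lsum in *; simpl in *; lra.
Qed.

Lemma integ_trunc_mult c0 n0 k M h : 0 <= M -> smooth L h ->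
  integ c0 n0 M (fun z => trunc k z * h z) = fun z =>
    integ c0 n0 M (fun z => u z * cut k z * h z) z
    - lsum (indices n s) (fun a => integ c0 n0 M (fun z => mom k a z * psi k a z * h z) z).
Proof.
intros HM Hh; rewrite trunc_mult.
assert (S1 : forall a, smooth L (fun z => mom k a z * psi k a z * h z)).
{ intros a; apply (smooth_mult L (fun z => mom k a z * psi k a z)); [|exact Hh].
  apply smooth_mult; [apply smooth_mom|apply smooth_psi]. }
rewrite (integ_minus L); auto.
- rewrite (integ_lsum L c0 n0 M (indices n s) (fun a z => mom k a z * psi k a z * h z)); auto.
- apply smooth_cont, (smooth_mult L (fun z => u z * cut k z)); [|exact Hh].
  apply smooth_mult; [exact Hu|apply smooth_cut].
- apply smooth_cont, (smooth_lsum L (indices n s) (fun a z => mom k a z * psi k a z * h z)); auto.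
Qed.

(** By duality the subtracted sum has [b]-th moment exactly [mom k b], which is that of the cut
    function. The coefficients leave the integral since they are constant along the block; the box
    must also contain the support of [psi]. *)
Lemma trunc_moments k M : M0 <= M -> R0 * 2 ^ k <= M -> moments c n s M (trunc k).
Proof.
intros HM1 HM2 b z Hb.
rewrite integ_trunc_mult by (lra || now apply smooth_monodir).
rewrite <- mom_enlarge by exact HM1.
rewrite (lsum_ext _ _ (fun a => mom k a z * rprod n (fun i => kron (a i) (b i)))).
- rewrite (lsum_indices n s b (fun a => mom k a z)) by
    (exact Hb || (intros a a' H; now rewrite (mom_ext k a a' H))).
  ring.
- intros a Ha; apply indices_nsum in Ha.
  rewrite <- (psi_moment k a b M z Ha Hb HM2).
  replace (fun z => mom k a z * psi k a z * monodir c n b z)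
    with (fun z => mom k a z * (psi k a z * monodir c n b z))
    by (apply functional_extensionality; intros; ring).
  rewrite (integ_indep_mult L); auto; [lra| |apply indep_integ].
  apply smooth_cont, smooth_mult; [apply smooth_psi|now apply smooth_monodir].
Qed.

(* Fubini: the moment coefficients of a function with vanishing [c']-moments inherit them. *)
Lemma mom_moments k a M : M0 <= M -> moments c' n' s' M (mom k a).
Proof.
intros HM b z Hb; rewrite (mom_enlarge k a M) by exact HM.
assert (Hm : smooth L (monodir c' n' b)) by now apply smooth_monodir.
assert (Hindep : indep c n (monodir c' n' b)).
{ intros w i t Hi; unfold monodir; f_equal; apply functional_extensionality; intros j.
  apply set_other; intros E; apply (Hdisj i j); congruence. }
pose proof (smooth_mom_integrand k a) as Hs.
assert (Hs2 : smooth L (fun z => monodir c' n' b z * (u z * cut k z * monodir c n a z)))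
  by now apply smooth_mult.
replace (fun z => integ c n M (fun z => u z * cut k z * monodir c n a z) z * monodir c' n' b z)
  with (integ c n M (fun z => monodir c' n' b z * (u z * cut k z * monodir c n a z))).
- rewrite <- (integ_comm L); [|lra|now apply smooth_cont|exact Hdisj].
  apply integ_zero; intros w _.
  replace (fun z => monodir c' n' b z * (u z * cut k z * monodir c n a z))
    with (fun z => (cut k z * monodir c n a z) * (u z * monodir c' n' b z))
    by (apply functional_extensionality; intros; ring).
  rewrite (integ_indep_mult L); [rewrite Hmom' by assumption; ring|lra| |].
  + apply smooth_cont, smooth_mult; assumption.
  + apply (indep_coords (fun x => rprod n (fun i => cutoff (/ 2 ^ k * x i + 0)) * mono n a x)).
- rewrite (integ_indep_mult L); [|lra|now apply smooth_cont|exact Hindep].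
  apply functional_extensionality; intros; ring.
Qed.

(** [cut] and [psi] involve only the block [c], hence act as constants for the integral over [c'];
    what remains are the moments of [u] and of its coefficients. *)
Lemma trunc_moments' k M : M0 <= M -> moments c' n' s' M (trunc k).
Proof.
intros HM b z Hb.
assert (Hm : smooth L (monodir c' n' b)) by now apply smooth_monodir.
rewrite integ_trunc_mult by (lra || exact Hm).
rewrite lsum_0.
- replace (fun z => u z * cut k z * monodir c' n' b z)
    with (fun z => cut k z * (u z * monodir c' n' b z))
    by (apply functional_extensionality; intros; ring).
  rewrite (integ_indep_mult L); [rewrite Hmom' by assumption; ring|lra| |].
  + apply smooth_cont, smooth_mult; assumption.
  + apply (indep_coords (fun x => rprod n (fun i => cutoff (/ 2 ^ k * x i + 0)))).
- intros a Ha.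
  replace (fun z => mom k a z * psi k a z * monodir c' n' b z)
    with (fun z => psi k a z * (mom k a z * monodir c' n' b z))
    by (apply functional_extensionality; intros; ring).
  rewrite (integ_indep_mult L); [rewrite mom_moments by assumption; ring|lra| |].
  + apply smooth_cont, smooth_mult; [apply smooth_mom|exact Hm].
  + apply (indep_coords (fun x => rprod n (fun i => etas k (a i) (x i)))).
Qed.

Lemma trunc_out k z i : (i < n)%nat -> 2 * R0 * 2 ^ k < Rabs (z (c i)) -> trunc k z = 0.
Proof.
intros Hi H; pose proof (pow2_gt0 k) as Hp; unfold trunc.
rewrite (cut_out k z i Hi) by nra.
rewrite lsum_0; [ring|]; intros a _; rewrite (psi_out k a z i Hi) by nra; ring.
Qed.

Lemma trunc_supported k : supported L (Rmax M0 (2 * R0 * 2 ^ k)) (trunc k).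
Proof.
intros z d Hd Hz.
pose proof (Rmax_l M0 (2 * R0 * 2 ^ k)); pose proof (Rmax_r M0 (2 * R0 * 2 ^ k)).
destruct (classic (exists i, (i < n)%nat /\ d = c i)) as [[i [Hi ->]]|Hn].
- apply (trunc_out k z i Hi); lra.
(* A coordinate outside the block is the same along the whole fibre, so [u] vanishes on that fibre
   and all coefficients at [z] vanish with it. *)
- assert (Hw : forall w, agree c n w z -> u w = 0).
  { intros w Hw; apply (Hsupp w d Hd); rewrite Hw; [lra|].
    intros i Hi E; apply Hn; exists i; tauto. }
  unfold trunc; rewrite (Hw z) by apply agree_refl.
  rewrite lsum_0; [ring|]; intros a _; unfold mom; rewrite integ_zero; [ring|].
  intros w Hw'; rewrite Hw by exact Hw'; ring.
Qed.

Lemma testfun_trunc k : testfun L c n s c' n' s' (trunc k).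
Proof.
split; [apply smooth_trunc|]; exists (Rmax M0 (2 * R0 * 2 ^ k)).
pose proof (Rmax_l M0 (2 * R0 * 2 ^ k)); pose proof (Rmax_r M0 (2 * R0 * 2 ^ k)).
pose proof (pow2_gt0 k).
split; [lra|split; [apply trunc_supported|]]; intros M HM; split.
- apply trunc_moments; [lra|nra].
- apply trunc_moments'; lra.
Qed.

Lemma cut_mult_large k z : M0 <= 2 ^ k -> u z * cut k z = u z.
Proof.
intros Hk; destruct (Req_dec (u z) 0) as [E|E]; [rewrite E; ring|].
rewrite cut_in; [ring|]; intros i Hi.
destruct (Rle_lt_dec (Rabs (z (c i))) (2 ^ k)) as [H|H]; [exact H|].
exfalso; apply E, (Hsupp z (c i)); auto; lra.
Qed.

(** This is where the vanishing moments of [u] in its own block enter: once the cutoff is 1 on the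
    support, the coefficients are the moments of [u] itself. *)
Lemma mom_large k a : M0 <= 2 ^ k -> (nsum n a <= s)%nat -> mom k a = fun _ => 0.
Proof.
intros Hk Ha; apply functional_extensionality; intros z; unfold mom.
replace (fun z => u z * cut k z * monodir c n a z) with (fun z => u z * monodir c n a z).
- apply Hmom; [lra|exact Ha].
- apply functional_extensionality; intros w; rewrite cut_mult_large by exact Hk; reflexivity.
Qed.

Lemma trunc_large k : M0 <= 2 ^ k -> trunc k = u.
Proof.
intros Hk; apply functional_extensionality; intros z; unfold trunc.
rewrite cut_mult_large, lsum_0; [ring| |exact Hk].
intros a Ha; rewrite mom_large; [ring|exact Hk|now apply indices_nsum].
Qed.

(* [theta] stands for [2^-sigma]. *)
Variables (theta A : R) (z0 : pt).
Hypothesis Htheta : 0 < theta <= 1.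
Hypothesis Hrho : 2 ^ (n + s) * theta < 1.
Hypothesis HA1 : forall w, agree c n w z0 -> Rabs (u w) <= A.
Hypothesis HA2 : forall w i j, agree c n w z0 -> (i < n)%nat -> 2 ^ j <= Rabs (w (c i)) ->
  Rabs (u w) <= A * theta ^ j.

(** * Decay estimates on the fibre through [z0] *)

Lemma A_ge0 : 0 <= A.
Proof. eapply Rle_trans; [apply Rabs_pos|apply (HA1 z0), agree_refl]. Qed.

(** Two consecutive cutoffs are both 1 where all block coordinates are at most [2 ^ k]; elsewhere
    one coordinate is large and the decay of [u] applies. *)
Lemma annulus_bound k w : agree c n w z0 ->
  Rabs (u w * (cut (S k) w - cut k w)) <= A * theta ^ k.
Proof.
intros Hw; pose proof A_ge0; pose proof (pow2_gt0 k) as Hp.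
assert (Ht : 0 < theta ^ k) by (apply pow_lt; lra).
assert (0 <= A * theta ^ k) by (apply Rmult_le_pos; lra).
destruct (classic (exists i, (i < n)%nat /\ 2 ^ k < Rabs (w (c i)))) as [[i [Hi Hwi]]|Hn].
- rewrite Rabs_mult, <- (Rmult_1_r (A * theta ^ k)).
  apply Rmult_le_compat; try apply Rabs_pos; [apply (HA2 w i k); auto; lra|].
  pose proof (cut_range k w); pose proof (cut_range (S k) w); apply Rabs_le; lra.
- rewrite 2!cut_in, Rminus_diag, Rmult_0_r, Rabs_R0; [lra| |];
    intros i Hi; destruct (Rle_lt_dec (Rabs (w (c i))) (2 ^ k)) as [H'|H'];
    try (exfalso; apply Hn; exists i; tauto); simpl; lra.
Qed.

Lemma mono_bound a r w : 0 <= r -> (forall i, (i < n)%nat -> Rabs (w (c i)) <= r) ->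
  Rabs (monodir c n a w) <= r ^ nsum n a.
Proof.
intros Hr H; rewrite <- rprod_pow; apply rprod_abs_le; intros i Hi.
rewrite <- RPow_abs; apply pow_incr; split; [apply Rabs_pos|auto].
Qed.

(** The difference of cutoffs lives where the coordinates are at most [4 * 2 ^ k]: the box has side
    [8 * 2 ^ k], giving [8 ^ n], and the monomial contributes [4 ^ nsum n a]. *)
Lemma mom_step_bound k a :
  Rabs (mom (S k) a z0 - mom k a z0)
  <= A * 8 ^ n * 4 ^ nsum n a * (2 ^ (n + nsum n a) * theta) ^ k.
Proof.
pose proof (pow2_gt0 k) as Hp; pose proof A_ge0 as HA.
assert (Ht : 0 < theta ^ k) by (apply pow_lt; lra).
assert (E : mom (S k) a z0 - mom k a z0 =
  integ c n M0 (fun z => u z * (cut (S k) z - cut k z) * monodir c n a z) z0).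
{ replace (fun z => u z * (cut (S k) z - cut k z) * monodir c n a z)
    with (fun z => u z * cut (S k) z * monodir c n a z - u z * cut k z * monodir c n a z)
    by (apply functional_extensionality; intros; ring).
  rewrite (integ_minus L); [reflexivity|lra| |]; apply smooth_cont, smooth_mom_integrand. }
rewrite E.
replace (A * 8 ^ n * 4 ^ nsum n a * (2 ^ (n + nsum n a) * theta) ^ k)
  with ((2 * (4 * 2 ^ k)) ^ n * (A * theta ^ k * (4 * 2 ^ k) ^ nsum n a)).
2: { rewrite !Rpow_mult_distr, <- !pow_mult, (Nat.mul_comm k), (Nat.mul_comm k),
       Nat.mul_add_distr_r, pow_add.
     replace (8 ^ n) with (2 ^ n * 4 ^ n) by (rewrite <- Rpow_mult_distr; f_equal; ring); ring. }
assert (Hout : forall w i, (i < n)%nat -> 4 * 2 ^ k < Rabs (w (c i)) ->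
  u w * (cut (S k) w - cut k w) * monodir c n a w = 0).
{ intros w i Hi Hwi; rewrite (cut_out (S k) w i Hi), (cut_out k w i Hi); simpl; lra. }
apply (integ_bound L); auto; [|lra|lra| |intros w i _; apply Hout].
- apply smooth_cont, (smooth_mult L (fun z => u z * (cut (S k) z - cut k z)));
    [|now apply smooth_monodir].
  apply smooth_mult; [exact Hu|apply smooth_minus; apply smooth_cut].
- intros w Hw.
  destruct (classic (exists i, (i < n)%nat /\ 4 * 2 ^ k < Rabs (w (c i)))) as [[i [Hi Hwi]]|Hn].
  + rewrite (Hout w i Hi Hwi), Rabs_R0.
    repeat apply Rmult_le_pos; try lra; apply pow_le; lra.
  + rewrite Rabs_mult; apply Rmult_le_compat; try apply Rabs_pos; [now apply annulus_bound|].
    apply mono_bound; [lra|]; intros i Hi.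
    destruct (Rle_lt_dec (Rabs (w (c i))) (4 * 2 ^ k)) as [H'|H']; [exact H'|].
    exfalso; apply Hn; exists i; tauto.
Qed.

Lemma ratio_bound a : (nsum n a <= s)%nat ->
  0 < 2 ^ (n + nsum n a) * theta <= 2 ^ (n + s) * theta.
Proof.
intros Ha; split; [apply Rmult_lt_0_compat; [apply pow2_gt0|lra]|].
apply Rmult_le_compat_r; [lra|]; apply Rle_pow; [lra|lia].
Qed.

(* Downward induction from a scale beyond the support, where the moment vanishes. *)
Lemma mom_bound k a : (nsum n a <= s)%nat ->
  Rabs (mom k a z0) <= A * (8 ^ n * 4 ^ s / (1 - 2 ^ (n + s) * theta))
                       * (2 ^ (n + nsum n a) * theta) ^ k.
Proof.
intros Ha; pose proof A_ge0 as HA.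
destruct (ratio_bound a Ha) as [Hr1 Hr2].
set (r := 2 ^ (n + nsum n a) * theta) in *; set (rho := 2 ^ (n + s) * theta) in *.
set (K0 := 8 ^ n * 4 ^ s).
assert (HK0 : 0 < K0) by (apply Rmult_lt_0_compat; apply pow_lt; lra).
assert (HK1 : 0 < K0 / (1 - rho)) by (apply Rdiv_lt_0_compat; lra).
assert (Hpos : forall j, 0 <= A * (K0 / (1 - rho)) * r ^ j).
{ intros j; apply Rmult_le_pos; [apply Rmult_le_pos; lra|apply pow_le; lra]. }
destruct (Pow_x_infinity 2 ltac:(rewrite Rabs_pos_eq; lra) M0) as [K HK].
(* [m] counts the scales left before [K], beyond which the moment is zero; [K] does not enter the
   bound. *)
assert (G : forall m k, (K <= k + m)%nat -> Rabs (mom k a z0) <= A * (K0 / (1 - rho)) * r ^ k).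
{ induction m as [|m IH]; intros j Hj.
  - rewrite mom_large; [rewrite Rabs_R0; apply Hpos| |exact Ha].
    specialize (HK j ltac:(lia)); rewrite Rabs_pos_eq in HK by (left; apply pow2_gt0); lra.
  - specialize (IH (S j) ltac:(lia)).
    pose proof (mom_step_bound j a) as Hstep; fold r in Hstep.
    assert (H4 : A * 8 ^ n * 4 ^ nsum n a * r ^ j <= A * K0 * r ^ j).
    { apply Rmult_le_compat_r; [apply pow_le; lra|]; unfold K0; rewrite Rmult_assoc.
      apply Rmult_le_compat_l; [exact HA|]; apply Rmult_le_compat_l; [apply pow_le; lra|].
      apply Rle_pow; [lra|exact Ha]. }
    replace (mom j a z0) with (mom (S j) a z0 - (mom (S j) a z0 - mom j a z0)) by ring.
    eapply Rle_trans; [apply Rabs_triang|]; rewrite Rabs_Ropp.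
    assert (Hrj : 0 <= A * r ^ j * K0)
      by (apply Rmult_le_pos; [apply Rmult_le_pos; [lra|apply pow_le; lra]|lra]).
    (* The constant is chosen to reproduce itself: [x * r + K0 <= x] for [x = K0 / (1 - rho)],
       because [r <= rho]. *)
    assert (E : A * (K0 / (1 - rho)) * r ^ S j + A * K0 * r ^ j <= A * (K0 / (1 - rho)) * r ^ j).
    { simpl.
      replace (A * (K0 / (1 - rho)) * (r * r ^ j)) with ((A * r ^ j * K0) * (r / (1 - rho))) by (field; lra).
      replace (A * (K0 / (1 - rho)) * r ^ j) with ((A * r ^ j * K0) * (1 / (1 - rho))) by (field; lra).
      replace (A * K0 * r ^ j) with ((A * r ^ j * K0) * ((1 - rho) / (1 - rho))) by (field; lra).
      rewrite <- Rmult_plus_distr_l; apply Rmult_le_compat_l; [exact Hrj|].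
      unfold Rdiv; rewrite <- Rmult_plus_distr_r; apply Rmult_le_compat_r; [|lra].
      left; apply Rinv_0_lt_compat; lra. }
    lra. }
apply (G K); lia.
Qed.

Definition corr_const : R :=
  INR (length (indices n s)) * (8 ^ n * 4 ^ s / (1 - 2 ^ (n + s) * theta) * B ^ n).

Lemma corr_const_ge0 : 0 <= corr_const.
Proof.
apply Rmult_le_pos; [apply pos_INR|]; apply Rmult_le_pos; [|apply pow_le; lra].
apply Rdiv_le_0_compat; [|lra]; apply Rmult_le_pos; apply pow_le; lra.
Qed.

(** The growth [2 ^ (k (n + |a|))] in the bound of the coefficient is cancelled by the size of
    [psi], so every multi-index contributes the same decay [theta ^ k]. *)
Lemma corr_bound k :
  Rabs (lsum (indices n s) (fun a => mom k a z0 * psi k a z0)) <= corr_const * (A * theta ^ k).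
Proof.
unfold corr_const; rewrite Rmult_assoc; apply lsum_abs_le; intros a Ha.
apply indices_nsum in Ha; pose proof (pow2_gt0 k) as Hp.
rewrite Rabs_mult.
eapply Rle_trans; [apply Rmult_le_compat; try apply Rabs_pos;
  [now apply mom_bound|now apply psi_bound]|].
right; rewrite Rpow_mult_distr, <- !pow_mult, (Nat.mul_comm k).
field; split; [lra|apply pow_nonzero; lra].
Qed.

Definition layer (k : nat) (z : pt) : R :=
  match k with O => trunc O z | S j => trunc (S j) z - trunc j z end.

(** Layer [S k] is controlled by the decay at scale [k], one step earlier; the division by [theta]
    absorbs this shift. The factor 2 counts the corrections at the two scales. *)
Lemma layer_bound k : Rabs (layer k z0) <= (1 + 2 * corr_const) / theta * theta ^ k * A.
Proof.
pose proof A_ge0 as HA; pose proof corr_const_ge0 as HC.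
assert (Hi : 1 <= / theta) by (rewrite <- Rinv_1; apply Rinv_le_contravar; lra).
destruct k as [|k]; unfold layer.
- pose proof (corr_bound 0) as H0; simpl pow in *.
  assert (H1 : Rabs (u z0 * cut 0 z0) <= A * 1).
  { rewrite Rabs_mult; apply Rmult_le_compat; try apply Rabs_pos; [apply HA1, agree_refl|].
    pose proof (cut_range 0 z0); apply Rabs_le; lra. }
  unfold trunc; eapply Rle_trans; [apply Rabs_triang|]; rewrite Rabs_Ropp.
  apply Rle_trans with ((1 + 2 * corr_const) * 1 * A); [nra|].
  do 2 (apply Rmult_le_compat_r; [lra|]).
  unfold Rdiv; rewrite <- (Rmult_1_r (1 + 2 * corr_const)) at 1.
  apply Rmult_le_compat_l; lra.
- pose proof (corr_bound k) as H0; pose proof (corr_bound (S k)) as H1.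
  pose proof (annulus_bound k z0 (agree_refl _ _ _)) as H2.
  set (X := lsum _ _) in H0; set (Y := lsum _ _) in H1.
  replace (trunc (S k) z0 - trunc k z0) with (u z0 * (cut (S k) z0 - cut k z0) - Y + X)
    by (unfold trunc, X, Y; ring).
  eapply Rle_trans; [apply Rabs_triang|].
  eapply Rle_trans; [apply Rplus_le_compat_r, Rabs_triang|]; rewrite Rabs_Ropp.
  assert (Hk : 0 <= A * theta ^ k) by (apply Rmult_le_pos; [lra|apply pow_le; lra]).
  replace ((1 + 2 * corr_const) / theta * theta ^ S k * A)
    with ((1 + 2 * corr_const) * (A * theta ^ k)) by (simpl; field; lra).
  assert (corr_const * (A * theta ^ S k) <= corr_const * (A * theta ^ k)).
  { apply Rmult_le_compat_l; [exact HC|]; simpl; nra. }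
  lra.
Qed.

End Decomposition.

(** * Weights and the decomposition in one block *)

Lemma rsum_ge0 n f : (forall i, (i < n)%nat -> 0 <= f i) -> 0 <= rsum n f.
Proof. intros H; rewrite <- (rsum_0 n (fun _ => 0)) by reflexivity; now apply rsum_le. Qed.

Lemma normn_ge n x i : (i < n)%nat -> Rabs (x i) <= normn n x.
Proof.
intros Hi; unfold normn; rewrite <- sqrt_Rsqr_abs; apply sqrt_le_1_alt; unfold Rsqr.
replace (x i * x i) with (x i ^ 2) by ring.
induction n as [|n IH]; [lia|].
change (x i ^ 2 <= rsum n (fun i => x i ^ 2) + x n ^ 2).
assert (H0 : 0 <= rsum n (fun i => x i ^ 2)) by (apply rsum_ge0; intros; apply pow2_ge_0).
pose proof (pow2_ge_0 (x n)).
destruct (Nat.eq_dec i n) as [->|]; [lra|]; specialize (IH ltac:(lia)); lra.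
Qed.

Lemma normn_ge0 n x : 0 <= normn n x.
Proof. apply sqrt_pos. Qed.

Lemma Rpower_ge1 x a : 1 <= x -> 0 <= a -> 1 <= Rpower x a.
Proof.
intros Hx Ha; rewrite <- (Rpower_O x) by lra; apply Rle_Rpower; lra.
Qed.

Lemma Rpower_pow_base x a k : 0 < x -> Rpower (x ^ k) a = Rpower x a ^ k.
Proof.
intros Hx; rewrite <- (Rpower_pow k x), <- (Rpower_pow k (Rpower x a)) by
  (assumption || apply exp_pos).
rewrite 2!Rpower_mult, Rmult_comm; reflexivity.
Qed.

Definition weight (sg : R) (c : nat -> dir) (n : nat) (z : pt) : R :=
  Rpower (1 + normn n (fun i => z (c i))) sg.

(** [C] and [R1] are fixed before [u]; only the number of layers depends on [u]. The size estimate
    asks for the weighted bound on the fibre through [z] only, so [A] may vary with the other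
    variables. *)
Lemma layer_decomposition L c n s c' n' s' sg :
  (forall i j, c i = c j -> i = j) -> (forall i j, c i <> c' j) ->
  (forall i, (i < n)%nat -> In (c i) L) -> (forall i, (i < n')%nat -> In (c' i) L) ->
  INR (n + s) < sg ->
  exists C R1, 0 < C /\ 0 < R1 /\
  forall u, testfun L c n s c' n' s' u -> exists w : nat -> pt -> R,
    (forall k, testfun L c n s c' n' s' (w k)) /\
    (forall k z i, (i < n)%nat -> R1 * 2 ^ k < Rabs (z (c i)) -> w k z = 0) /\
    (forall k z A, (forall y, agree c n y z -> weight sg c n y * Rabs (u y) <= A) ->
       Rabs (w k z) <= C * Rpower 2 (- sg) ^ k * A) /\
    exists K, forall K', (K <= K')%nat -> forall z, rsum K' (fun k => w k z) = u z.
Proof.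
intros Hinj Hdisj HL HL' Hsg.
destruct (dual_family_exists s) as [eta [R0 [B [HR0 [HB Heta]]]]].
set (theta := Rpower 2 (- sg)).
assert (Hsg0 : 0 < sg) by (pose proof (pos_INR (n + s)); lra).
assert (Ht0 : 0 < theta) by apply exp_pos.
assert (Ht1 : theta <= 1) by (rewrite <- (Rpower_O 2) by lra; apply Rle_Rpower; lra).
assert (Hrho : 2 ^ (n + s) * theta < 1).
{ rewrite <- (Rpower_O 2), <- Rpower_pow by lra; unfold theta.
  rewrite <- Rpower_plus; apply Rpower_lt; lra. }
assert (Hcc := corr_const_ge0 n s B HB theta Hrho).
exists ((1 + 2 * corr_const n s B theta) / theta), (2 * R0).
split; [apply Rdiv_lt_0_compat; lra|split; [lra|]].
intros u [Hu [M0 [HM0 [Hsupp Hmom]]]].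
assert (Hm : forall M, M0 <= M -> moments c n s M u) by (intros M HM; now apply Hmom).
assert (Hm' : forall M, M0 <= M -> moments c' n' s' M u) by (intros M HM; now apply Hmom).
exists (layer c n s eta u M0); split; [|split; [|split]].
- intros [|k]; [|apply testfun_minus; auto]; now apply (testfun_trunc L c c' n n' s s' eta R0 B).
- intros k z i Hi Hz; destruct k as [|k]; simpl layer.
  + now apply (trunc_out c n s eta R0 B HR0 Heta u M0 0 z i).
  + pose proof (pow2_gt0 k); simpl in Hz.
    rewrite (trunc_out c n s eta R0 B HR0 Heta u M0 (S k) z i),
      (trunc_out c n s eta R0 B HR0 Heta u M0 k z i); auto; simpl; nra.
- intros k z A HA.
  assert (Hw1 : forall y, 1 <= weight sg c n y).
  { intros y; apply Rpower_ge1; [|lra]; pose proof (normn_ge0 n (fun i => y (c i))); lra. }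
  apply (layer_bound L c n s eta R0 B); auto.
  + intros y Hy; specialize (HA y Hy); specialize (Hw1 y); pose proof (Rabs_pos (u y)); nra.
  + intros y i j Hy Hi Hj; specialize (HA y Hy).
    assert (Hpj := pow2_gt0 j).
    (* One coordinate of size [2 ^ j] makes the weight at least [2 ^ (j sg)]; dividing by it turns
       the weighted bound into decay by [theta ^ j]. *)
    assert (Hge : Rpower 2 sg ^ j <= weight sg c n y).
    { rewrite <- Rpower_pow_base by lra; apply Rle_Rpower_l; [lra|]; split; [exact Hpj|].
      pose proof (normn_ge n (fun i => y (c i)) i Hi) as Hn; simpl in Hn; lra. }
    assert (Hp2 : 0 < Rpower 2 sg ^ j) by (apply pow_lt, exp_pos).
    unfold theta; rewrite Rpower_Ropp, pow_inv.
    apply Rle_div_r; [exact Hp2|]; pose proof (Rabs_pos (u y)); nra.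
- destruct (Pow_x_infinity 2 ltac:(rewrite Rabs_pos_eq; lra) M0) as [K HK].
  exists (S K); intros K' HK' z; destruct K' as [|K']; [lia|].
  (* The layers telescope; [S K'] of them add up to the truncation at scale [K']. *)
  assert (E : rsum (S K') (fun k => layer c n s eta u M0 k z) = trunc c n s eta u M0 K' z).
  { clear; induction K' as [|K' IH]; [simpl; ring|].
    change (rsum (S (S K')) (fun k => layer c n s eta u M0 k z))
      with (rsum (S K') (fun k => layer c n s eta u M0 k z) + layer c n s eta u M0 (S K') z).
    rewrite IH; simpl layer; ring. }
  rewrite E, (trunc_large L c n s eta HL u M0 Hsupp Hm K'); [reflexivity|].
  specialize (HK K' ltac:(lia)); rewrite Rabs_pos_eq in HK by (left; apply pow2_gt0); lra.
Qed.

(** * Correspondence with the spaces of the statement *)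

Definition join (x1 x2 : nat -> R) : pt :=
  fun d => match d with inl i => x1 i | inr j => x2 j end.

Definition coords (n1 n2 : nat) : list dir := map inl (seq 0 n1) ++ map inr (seq 0 n2).

Lemma in_coords_l n1 n2 i : In (inl i) (coords n1 n2) <-> (i < n1)%nat.
Proof.
unfold coords; rewrite in_app_iff, !in_map_iff; split.
- intros [[k [E H]]|[k [E H]]]; [|discriminate]; injection E as ->; apply in_seq in H; lia.
- intros H; left; exists i; split; [reflexivity|apply in_seq; lia].
Qed.

Lemma in_coords_r n1 n2 j : In (inr j) (coords n1 n2) <-> (j < n2)%nat.
Proof.
unfold coords; rewrite in_app_iff, !in_map_iff; split.
- intros [[k [E H]]|[k [E H]]]; [discriminate|]; injection E as ->; apply in_seq in H; lia.
- intros H; right; exists j; split; [reflexivity|apply in_seq; lia].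
Qed.

Lemma join_upd_l x1 x2 i t : join (upd x1 i t) x2 = set (join x1 x2) (inl i) t.
Proof.
apply functional_extensionality; intros [k|k]; unfold set, upd, join; [|reflexivity].
destruct (Nat.eqb_spec k i), (dir_eq_dec (inl k) (inl i)); congruence.
Qed.

Lemma join_upd_r x1 x2 j t : join x1 (upd x2 j t) = set (join x1 x2) (inr j) t.
Proof.
apply functional_extensionality; intros [k|k]; unfold set, upd, join; [reflexivity|].
destruct (Nat.eqb_spec k j), (dir_eq_dec (inr k) (inr j)); congruence.
Qed.

Lemma join_proj (z : pt) : join (fun i => z (inl i)) (fun j => z (inr j)) = z.
Proof. apply functional_extensionality; intros [i|j]; reflexivity. Qed.

(* [emb] inserts the block of variables [c] into a point whose other coordinates are fixed. *)
Record embedding (c : nat -> dir) (emb : (nat -> R) -> pt) : Prop := {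
  emb_inj : forall i j, c i = c j -> i = j;
  emb_on : forall x i, emb x (c i) = x i;
  emb_upd : forall x m t, emb (upd x m t) = set (emb x) (c m) t;
  emb_off : forall x y d, (forall i, d <> c i) -> emb x d = emb y d
}.

Lemma embedding_l x2 : embedding inl (fun x1 => join x1 x2).
Proof.
split; try reflexivity.
- intros i j E; now injection E.
- intros; apply join_upd_l.
- intros x y [i|j] H; [|reflexivity]; now destruct (H i).
Qed.

Lemma embedding_r x1 : embedding inr (fun x2 => join x1 x2).
Proof.
split; try reflexivity.
- intros i j E; now injection E.
- intros; apply join_upd_r.
- intros x y [i|j] H; [reflexivity|]; now destruct (H j).
Qed.

Lemma emb_agree c emb n w x : embedding c emb -> agree c n w (emb x) ->
  w = emb (fun i => w (c i)).
Proof.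
intros He Hw; apply functional_extensionality; intros d.
destruct (classic (exists i, d = c i)) as [[i ->]|Hn].
- now rewrite (emb_on _ _ He).
- assert (Hd : forall i, d <> c i) by (intros i E; apply Hn; now exists i).
  rewrite Hw by auto; now apply (emb_off _ _ He).
Qed.

Lemma gridsum_emb c emb n N M H x : embedding c emb ->
  gridsum n N M (fun x => H (emb x)) x = gridsum_dir c n N M H (emb x).
Proof.
intros He; revert x; induction n as [|n IH]; intros x; [reflexivity|]; simpl.
apply rsum_ext; intros k _; rewrite IH, (emb_upd _ _ He); reflexivity.
Qed.

Lemma gridsum_cv L c emb n M H : embedding c emb -> cont L H -> 0 < M ->
  Un_cv (fun m => (2 * M / INR (S m)) ^ n * gridsum n (S m) M (fun x => H (emb x)) (fun _ => 0))
        (integ c n M H (emb (fun _ => 0))).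
Proof.
intros He HH HM eps Heps.
destruct (inbox_exists L (emb (fun _ => 0))) as [M1 [HM1 Hin]].
destruct (riemann_integ L H c n M (Rmax M M1) (eps / 2)) as [N0 HN0];
  [exact HH|exact HM|apply Rmax_l|lra|].
exists N0; intros m Hm; unfold Rdist; rewrite (gridsum_emb c emb) by exact He.
eapply Rle_lt_trans; [apply HN0; [lia|]|lra].
apply (inbox_le L M1); [apply Rmax_r|exact Hin].
Qed.

(** The box [M1] hidden in [Rn_integral_is] is unrelated to [M]. The integrand vanishes outside
    either, so the smaller box can be enlarged to the larger in both cases. *)
Lemma Rn_integral_integ L c emb n M H v : embedding c emb -> cont L H -> 0 < M ->
  (forall x i, (i < n)%nat -> M < Rabs (x i) -> H (emb x) = 0) ->
  Rn_integral_is n (fun x => H (emb x)) v -> integ c n M H (emb (fun _ => 0)) = v.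
Proof.
intros He HH HM Hs [M1 [HM1 [Hs1 Hcv]]].
assert (E1 : integ c n M1 H (emb (fun _ => 0)) = v)
  by (eapply UL_sequence; [now apply (gridsum_cv L)|exact Hcv]).
pose proof (emb_inj _ _ He) as Hinj.
assert (Hz : forall w i, agree c n w (emb (fun _ => 0)) -> (i < n)%nat ->
  M < Rabs (w (c i)) -> H w = 0).
{ intros w i Hw Hi Hwi; rewrite (emb_agree c emb n w _ He Hw); now apply (Hs _ i). }
assert (Hz1 : forall w i, agree c n w (emb (fun _ => 0)) -> (i < n)%nat ->
  M1 < Rabs (w (c i)) -> H w = 0).
{ intros w i Hw Hi Hwi; rewrite (emb_agree c emb n w _ He Hw); apply NNPP; intros Hn.
  specialize (Hs1 _ Hn i Hi); simpl in Hs1; lra. }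
destruct (Rle_lt_dec M M1) as [Hle|Hlt].
- rewrite <- (integ_enlarge L c n M M1); auto; lra.
- rewrite (integ_enlarge L c n M1 M); auto; lra.
Qed.

Lemma integ_Rn_integral L c emb n M H : embedding c emb -> cont L H -> 0 < M ->
  (forall x i, (i < n)%nat -> M < Rabs (x i) -> H (emb x) = 0) ->
  Rn_integral_is n (fun x => H (emb x)) (integ c n M H (emb (fun _ => 0))).
Proof.
intros He HH HM Hs; exists M; split; [exact HM|split; [|now apply (gridsum_cv L)]].
intros x Hx i Hi; destruct (Rle_lt_dec (Rabs (x i)) M) as [Hle|Hlt]; [exact Hle|].
exfalso; apply Hx; now apply (Hs x i).
Qed.

(** * Real and imaginary parts of a function in the space *)

Lemma Cmod_ge0 a : 0 <= Cmod a.
Proof. apply sqrt_pos. Qed.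

Lemma Re_le_Cmod a : Rabs (Re a) <= Cmod a.
Proof.
unfold Cmod; rewrite <- sqrt_Rsqr_abs; apply sqrt_le_1_alt; unfold Rsqr.
pose proof (pow2_ge_0 (Im a)); nra.
Qed.

Lemma Im_le_Cmod a : Rabs (Im a) <= Cmod a.
Proof.
unfold Cmod; rewrite <- sqrt_Rsqr_abs; apply sqrt_le_1_alt; unfold Rsqr.
pose proof (pow2_ge_0 (Re a)); nra.
Qed.

Lemma Cmod_le a : Cmod a <= Rabs (Re a) + Rabs (Im a).
Proof.
pose proof (Rabs_pos (Re a)); pose proof (Rabs_pos (Im a)).
unfold Cmod; rewrite <- (sqrt_pow2 (Rabs (Re a) + Rabs (Im a))) by lra.
apply sqrt_le_1_alt; rewrite <- (pow2_abs (Re a)), <- (pow2_abs (Im a)); nra.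
Qed.

Definition testpair n1 n2 s1 s2 (u : pt -> R) : Prop :=
  testfun (coords n1 n2) inl n1 s1 inr n2 s2 u.

Definition part (pr : Cx -> R) (f : Fn) (z : pt) : R :=
  pr (f (fun i => z (inl i)) (fun j => z (inr j))).

Lemma inD_part n1 n2 s1 s2 f pr : pr = Re \/ pr = Im -> inD n1 n2 s1 s2 f ->
  testpair n1 n2 s1 s2 (part pr f).
Proof.
intros Hpr [_ [[D [D0 [Dc [D1 D2]]]] [[M HM] [Hm1 Hm2]]]].
assert (Hsm : smooth (coords n1 n2) (part pr f)).
{ rewrite <- D0; apply (iterated_partials_smooth _ (fun a => part pr (D a))).
  - intros a z eps Heps.
    destruct (Dc a (fun i => z (inl i)) (fun j => z (inr j)) eps Heps) as [delta [Hd H]].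
    exists delta; split; [exact Hd|]; intros w Hw.
    eapply Rle_lt_trans; [|apply (H (fun i => w (inl i)) (fun j => w (inr j)))].
    + destruct Hpr as [-> | ->]; [eapply Rle_trans; [|apply Re_le_Cmod]|
        eapply Rle_trans; [|apply Im_le_Cmod]]; right; reflexivity.
    + intros i Hi; apply Hw, in_coords_l, Hi.
    + intros j Hj; apply Hw, in_coords_r, Hj.
  - intros a [i|j] Hd z.
    + apply in_coords_l in Hd.
      apply (is_derive_ext (fun t => pr (D a (upd (fun i => z (inl i)) i t) (fun j => z (inr j))))).
      * intros t; replace (set z (inl i) t)
          with (join (upd (fun i => z (inl i)) i t) (fun j => z (inr j)));
          [reflexivity|now rewrite join_upd_l, join_proj].
      * apply is_derive_Reals.
        destruct (D1 a i (fun i => z (inl i)) (fun j => z (inr j)) Hd).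
        destruct Hpr as [-> | ->]; assumption.
    + apply in_coords_r in Hd.
      apply (is_derive_ext (fun t => pr (D a (fun i => z (inl i)) (upd (fun j => z (inr j)) j t)))).
      * intros t; replace (set z (inr j) t)
          with (join (fun i => z (inl i)) (upd (fun j => z (inr j)) j t));
          [reflexivity|now rewrite join_upd_r, join_proj].
      * apply is_derive_Reals.
        destruct (D2 a j (fun i => z (inl i)) (fun j => z (inr j)) Hd).
        destruct Hpr as [-> | ->]; assumption. }
(* [compact_supp] does not ask its radius to be positive, while [testfun] does. *)
assert (Hsupp : supported (coords n1 n2) (Rmax M 1) (part pr f)).
{ intros z d Hd Hz; pose proof (Rmax_l M 1).
  assert (E : f (fun i => z (inl i)) (fun j => z (inr j)) = C0).
  { apply NNPP; intros Hn; destruct (HM _ _ Hn) as [G1 G2]; destruct d as [i|j].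
    - apply in_coords_l in Hd; specialize (G1 i Hd); simpl in G1; lra.
    - apply in_coords_r in Hd; specialize (G2 j Hd); simpl in G2; lra. }
  unfold part; rewrite E; destruct Hpr as [-> | ->]; reflexivity. }
split; [exact Hsm|]; exists (Rmax M 1); pose proof (Rmax_r M 1).
split; [lra|split; [exact Hsupp|]]; intros M' HM'; split; intros a z Ha.
- assert (Hc : cont (coords n1 n2) (fun z => part pr f z * monodir inl n1 a z)).
  { apply smooth_cont, smooth_mult; [exact Hsm|].
    apply smooth_monodir; intros i; apply in_coords_l. }
  (* Grid sums start from the origin of the block, so the integrated coordinates of [z], which do
     not affect the integral, are first reset to 0. *)
  rewrite <- (integ_agree_on (coords n1 n2) inl n1 M' _ z (join (fun _ => 0) (fun j => z (inr j))));
    [|lra|exact Hc|].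
  + apply (Rn_integral_integ (coords n1 n2) inl (fun x1 => join x1 (fun j => z (inr j))));
      [apply embedding_l|exact Hc|lra| |].
    * intros x i Hi Hx; rewrite (Hsupp _ (inl i)); [ring|now apply in_coords_l|simpl; lra].
    * destruct (Hm1 a (fun j => z (inr j)) Ha); destruct Hpr as [-> | ->]; assumption.
  + intros [i|j] Hd Hn; [|reflexivity]; apply in_coords_l in Hd; now destruct (Hn i Hd).
- assert (Hc : cont (coords n1 n2) (fun z => part pr f z * monodir inr n2 a z)).
  { apply smooth_cont, smooth_mult; [exact Hsm|].
    apply smooth_monodir; intros i; apply in_coords_r. }
  rewrite <- (integ_agree_on (coords n1 n2) inr n2 M' _ z (join (fun i => z (inl i)) (fun _ => 0)));
    [|lra|exact Hc|].
  + apply (Rn_integral_integ (coords n1 n2) inr (fun x2 => join (fun i => z (inl i)) x2));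
      [apply embedding_r|exact Hc|lra| |].
    * intros x i Hi Hx; rewrite (Hsupp _ (inr i)); [ring|now apply in_coords_r|simpl; lra].
    * destruct (Hm2 a (fun i => z (inl i)) Ha); destruct Hpr as [-> | ->]; assumption.
  + intros [i|j] Hd Hn; [reflexivity|]; apply in_coords_r in Hd; now destruct (Hn j Hd).
Qed.

(** * Complex functions rebuilt from two real test functions *)

Definition mkF (u v : pt -> R) : Fn := fun x1 x2 => mkC (u (join x1 x2)) (v (join x1 x2)).

Lemma mkF_part f : mkF (part Re f) (part Im f) = f.
Proof.
apply functional_extensionality; intros x1; apply functional_extensionality; intros x2.
unfold mkF, part; simpl; now destruct (f x1 x2).
Qed.

Lemma near_join n1 n2 r x1 x2 y1 y2 :
  (forall i, (i < n1)%nat -> Rabs (y1 i - x1 i) < r) ->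
  (forall j, (j < n2)%nat -> Rabs (y2 j - x2 j) < r) ->
  near (coords n1 n2) r (join x1 x2) (join y1 y2).
Proof.
intros H1 H2 [i|j] Hd; [apply H1, (in_coords_l n1 n2)|apply H2, (in_coords_r n1 n2)]; exact Hd.
Qed.

Lemma smooth2_mkF n1 n2 u v : smooth (coords n1 n2) u -> smooth (coords n1 n2) v ->
  smooth2 n1 n2 (mkF u v).
Proof.
intros Hu Hv.
destruct (smooth_iterated_partials _ _ Hu) as [Du [Du0 [Duc Dup]]].
destruct (smooth_iterated_partials _ _ Hv) as [Dv [Dv0 [Dvc Dvp]]].
exists (fun a => mkF (Du a) (Dv a)); split; [now rewrite Du0, Dv0|split; [|split]].
- intros a x1 x2 eps Heps.
  destruct (smooth_cont _ _ (Duc a) (join x1 x2) (eps / 2)) as [d1 [P1 H1]]; [lra|].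
  destruct (smooth_cont _ _ (Dvc a) (join x1 x2) (eps / 2)) as [d2 [P2 H2]]; [lra|].
  exists (Rmin d1 d2); split; [now apply Rmin_pos|]; intros y1 y2 Hy1 Hy2.
  pose proof (near_join n1 n2 _ x1 x2 y1 y2 Hy1 Hy2) as Hn.
  specialize (H1 _ (near_le _ _ _ _ _ (Rmin_l _ _) Hn)).
  specialize (H2 _ (near_le _ _ _ _ _ (Rmin_r _ _) Hn)).
  eapply Rle_lt_trans; [apply Cmod_le|]; simpl; unfold Rminus in H1, H2; lra.
- intros a i x1 x2 Hi; apply (in_coords_l n1 n2) in Hi; simpl.
  specialize (Dup a (inl i) Hi (join x1 x2)); specialize (Dvp a (inl i) Hi (join x1 x2)).
  apply is_derive_Reals in Dup, Dvp; split.
  + replace (fun t => Du a (join (upd x1 i t) x2)) with (fun t => Du a (set (join x1 x2) (inl i) t));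
      [exact Dup|apply functional_extensionality; intros t; now rewrite join_upd_l].
  + replace (fun t => Dv a (join (upd x1 i t) x2)) with (fun t => Dv a (set (join x1 x2) (inl i) t));
      [exact Dvp|apply functional_extensionality; intros t; now rewrite join_upd_l].
- intros a j x1 x2 Hj; apply (in_coords_r n1 n2) in Hj; simpl.
  specialize (Dup a (inr j) Hj (join x1 x2)); specialize (Dvp a (inr j) Hj (join x1 x2)).
  apply is_derive_Reals in Dup, Dvp; split.
  + replace (fun t => Du a (join x1 (upd x2 j t))) with (fun t => Du a (set (join x1 x2) (inr j) t));
      [exact Dup|apply functional_extensionality; intros t; now rewrite join_upd_r].
  + replace (fun t => Dv a (join x1 (upd x2 j t))) with (fun t => Dv a (set (join x1 x2) (inr j) t));
      [exact Dvp|apply functional_extensionality; intros t; now rewrite join_upd_r].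
Qed.

Lemma testpair_moment_l n1 n2 s1 s2 u a x2 : testpair n1 n2 s1 s2 u -> (nsum n1 a <= s1)%nat ->
  Rn_integral_is n1 (fun x1 => u (join x1 x2) * mono n1 a x1) 0.
Proof.
intros [Hu [M0 [HM0 [Hs Hm]]]] Ha; destruct (Hm M0 (Rle_refl _)) as [H1 _].
rewrite <- (H1 a (join (fun _ => 0) x2) Ha).
apply (integ_Rn_integral (coords n1 n2) inl (fun x1 => join x1 x2) n1 M0
  (fun z => u z * monodir inl n1 a z)); [apply embedding_l| |exact HM0|].
- apply smooth_cont, smooth_mult; [exact Hu|]; apply smooth_monodir; intros i; apply in_coords_l.
- intros x i Hi Hx; rewrite (Hs _ (inl i)); [ring|now apply in_coords_l|exact Hx].
Qed.

Lemma testpair_moment_r n1 n2 s1 s2 u a x1 : testpair n1 n2 s1 s2 u -> (nsum n2 a <= s2)%nat ->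
  Rn_integral_is n2 (fun x2 => u (join x1 x2) * mono n2 a x2) 0.
Proof.
intros [Hu [M0 [HM0 [Hs Hm]]]] Ha; destruct (Hm M0 (Rle_refl _)) as [_ H2].
rewrite <- (H2 a (join x1 (fun _ => 0)) Ha).
apply (integ_Rn_integral (coords n1 n2) inr (fun x2 => join x1 x2) n2 M0
  (fun z => u z * monodir inr n2 a z)); [apply embedding_r| |exact HM0|].
- apply smooth_cont, smooth_mult; [exact Hu|]; apply smooth_monodir; intros i; apply in_coords_r.
- intros x i Hi Hx; rewrite (Hs _ (inr i)); [ring|now apply in_coords_r|exact Hx].
Qed.

Lemma inD_mkF n1 n2 s1 s2 u v : testpair n1 n2 s1 s2 u -> testpair n1 n2 s1 s2 v ->
  inD n1 n2 s1 s2 (mkF u v).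
Proof.
intros Hu Hv; split; [|split; [|split; [|split]]].
- intros x1 y1 x2 y2 H1 H2; unfold mkF.
  assert (E : forall d, In d (coords n1 n2) -> join x1 x2 d = join y1 y2 d).
  { intros [i|j] Hd; [apply H1, (in_coords_l n1 n2)|apply H2, (in_coords_r n1 n2)]; exact Hd. }
  f_equal; apply (cont_agree (coords n1 n2)); auto; apply smooth_cont; [apply Hu|apply Hv].
- apply smooth2_mkF; [apply Hu|apply Hv].
- destruct Hu as [_ [Mu [_ [Su _]]]], Hv as [_ [Mv [_ [Sv _]]]].
  exists (Rmax Mu Mv); intros x1 x2 Hf.
  pose proof (Rmax_l Mu Mv); pose proof (Rmax_r Mu Mv).
  assert (G : forall d, In d (coords n1 n2) -> Rabs (join x1 x2 d) <= Rmax Mu Mv).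
  { intros d Hd; destruct (Rle_lt_dec (Rabs (join x1 x2 d)) (Rmax Mu Mv)) as [Hle|Hlt];
      [exact Hle|]; exfalso; apply Hf; unfold mkF, C0.
    rewrite (Su _ d), (Sv _ d); auto; lra. }
  split; [intros i Hi; apply (G (inl i)), in_coords_l, Hi
         |intros j Hj; apply (G (inr j)), in_coords_r, Hj].
- intros a x2 Ha; split; eapply testpair_moment_l; eassumption.
- intros a x1 Ha; split; eapply testpair_moment_r; eassumption.
Qed.

(** * The operator *)

Lemma rpow_pos x a : 0 < x -> rpow x a = Rpower x a.
Proof. intros H; unfold rpow; destruct (Rle_dec x 0); lra. Qed.

Lemma rpow_nonpos x a : x <= 0 -> rpow x a = 0.
Proof. intros H; unfold rpow; destruct (Rle_dec x 0); lra. Qed.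

Lemma rpow_ge0 x a : 0 <= rpow x a.
Proof. unfold rpow; destruct (Rle_dec x 0); [lra|left; apply exp_pos]. Qed.

Lemma rpow_le x y a : 0 <= a -> x <= y -> rpow x a <= rpow y a.
Proof.
intros Ha H; destruct (Rle_lt_dec x 0) as [Hx|Hx].
- rewrite rpow_nonpos by exact Hx; apply rpow_ge0.
- rewrite 2!rpow_pos by lra; apply Rle_Rpower_l; lra.
Qed.

Lemma rpow_mult x y a : 0 <= x -> 0 <= y -> rpow (x * y) a = rpow x a * rpow y a.
Proof.
intros Hx Hy; destruct (Req_dec x 0) as [->|Hx0].
{ rewrite Rmult_0_l, (rpow_nonpos 0) by lra; ring. }
destruct (Req_dec y 0) as [->|Hy0].
{ rewrite Rmult_0_r, (rpow_nonpos 0) by lra; ring. }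
assert (0 < x * y) by (apply Rmult_lt_0_compat; lra).
rewrite 3!rpow_pos by lra; symmetry; apply Rpower_mult_distr; lra.
Qed.

Lemma rpow_rpow x a b : 0 <= x -> a * b = 1 -> rpow (rpow x a) b = x.
Proof.
intros Hx Hab; destruct (Req_dec x 0) as [->|Hx0].
{ rewrite (rpow_nonpos 0), (rpow_nonpos 0) by lra; reflexivity. }
rewrite (rpow_pos x) by lra; rewrite rpow_pos by apply exp_pos.
rewrite Rpower_mult, Hab; apply Rpower_1; lra.
Qed.

Lemma rpow_pow x k a : 0 < x -> rpow (x ^ k) a = Rpower x a ^ k.
Proof. intros Hx; rewrite rpow_pos by now apply pow_lt. now apply Rpower_pow_base. Qed.

Lemma geometric_sum_le c r K : 0 <= c -> 0 <= r < 1 -> rsum K (fun k => c * r ^ k) <= c * (1 / (1 - r)).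
Proof.
intros Hc Hr; rewrite (rsum_scal K c (fun k => r ^ k)); apply Rmult_le_compat_l; [exact Hc|].
assert (E : rsum K (fun k => r ^ k) = (1 - r ^ K) / (1 - r)).
{ induction K as [|K IH]; simpl; [field; lra|]; rewrite IH; field; lra. }
rewrite E; unfold Rdiv; apply Rmult_le_compat_r; [left; apply Rinv_0_lt_compat; lra|].
pose proof (pow_le r K); lra.
Qed.

(** The condition [0 <= b] covers the default value 0 of [Rsup] on empty or unbounded sets. *)
Lemma Rsup_le E b : 0 <= b -> (forall x, E x -> x <= b) -> Rsup E <= b.
Proof.
intros Hb H; unfold Rsup; destruct (excluded_middle_informative _) as [HE|HE]; [|exact Hb].
destruct (completeness _ _ _) as [m [Hm1 Hm2]]; simpl; apply Hm2; exact H.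
Qed.

Lemma Rsup_ub (E : R -> Prop) x : bound E -> E x -> x <= Rsup E.
Proof.
intros Hb Hx; unfold Rsup; destruct (excluded_middle_informative _) as [HE|HE].
- destruct (completeness _ _ _) as [m [Hm1 Hm2]]; simpl; now apply Hm1.
- exfalso; apply HE; split; [exact Hb|now exists x].
Qed.

Lemma normn_le n x b : 0 <= b -> (forall i, (i < n)%nat -> Rabs (x i) <= b) -> normn n x <= INR n * b.
Proof.
intros Hb H; pose proof (pos_INR n).
assert (0 <= INR n * b) by now apply Rmult_le_pos.
rewrite <- (sqrt_pow2 (INR n * b)) by assumption; apply sqrt_le_1_alt.
apply Rle_trans with (INR n * b ^ 2).
- rewrite <- rsum_const; apply rsum_le; intros i Hi; rewrite <- pow2_abs.
  apply pow_incr; split; [apply Rabs_pos|auto].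
- rewrite Rpow_mult_distr; apply Rmult_le_compat_r; [apply pow2_ge_0|].
  destruct n as [|n]; [simpl; lra|].
  assert (1 <= INR (S n)) by (rewrite S_INR; pose proof (pos_INR n); lra); nra.
Qed.

Lemma distn_le n x y b : 0 <= b -> (forall i, (i < n)%nat -> Rabs (x i) <= b) ->
  (forall i, (i < n)%nat -> Rabs (y i) <= b) -> distn n x y <= INR n * (2 * b).
Proof.
intros Hb Hx Hy; apply normn_le; [lra|]; intros i Hi.
specialize (Hx i Hi); specialize (Hy i Hi).
eapply Rle_trans; [apply Rabs_triang|]; rewrite Rabs_Ropp; lra.
Qed.

Lemma diam1_le n1 f b : 0 <= b ->
  (forall x1 x2, f x1 x2 <> C0 -> forall i, (i < n1)%nat -> Rabs (x1 i) <= b) ->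
  diam1 n1 f <= INR n1 * (2 * b).
Proof.
intros Hb H; apply Rsup_le; [apply Rmult_le_pos; [apply pos_INR|lra]|].
intros r [x2 [x1 [y1 [H1 [H2 ->]]]]]; apply distn_le; eauto.
Qed.

Lemma diam2_le n2 f b : 0 <= b ->
  (forall x1 x2, f x1 x2 <> C0 -> forall j, (j < n2)%nat -> Rabs (x2 j) <= b) ->
  diam2 n2 f <= INR n2 * (2 * b).
Proof.
intros Hb H; apply Rsup_le; [apply Rmult_le_pos; [apply pos_INR|lra]|].
intros r [x1 [x2 [y2 [H1 [H2 ->]]]]]; apply distn_le; eauto.
Qed.

Lemma Cmod_C0 : Cmod C0 = 0.
Proof. unfold Cmod; replace (Re C0 ^ 2 + Im C0 ^ 2) with 0 by (simpl; ring); apply sqrt_0. Qed.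

Lemma Cmod_C1 : Cmod C1 = 1.
Proof. unfold Cmod; replace (Re C1 ^ 2 + Im C1 ^ 2) with 1 by (simpl; ring); apply sqrt_1. Qed.

(** Because [Rsup] is 0 on unbounded sets, the weighted values must first be shown bounded: the
    weights are bounded on the support box, and both parts of [f] by continuity. *)
Lemma Dnorm_bound n1 n2 s1 s2 sg1 sg2 f : 0 <= sg1 -> 0 <= sg2 -> inD n1 n2 s1 s2 f ->
  forall z, weight sg1 inl n1 z * weight sg2 inr n2 z
            * Cmod (f (fun i => z (inl i)) (fun j => z (inr j))) <= Dnorm n1 n2 sg1 sg2 f.
Proof.
intros H1 H2 Hf z; apply Rsup_ub; [|now exists (fun i => z (inl i)), (fun j => z (inr j))].
pose proof (inD_part _ _ _ _ _ Re (or_introl eq_refl) Hf) as [Su _].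
pose proof (inD_part _ _ _ _ _ Im (or_intror eq_refl) Hf) as [Sv _].
destruct Hf as [_ [_ [[M HM] _]]].
destruct (cont_bounded _ _ (Rmax M 0) (smooth_cont _ _ Su)) as [Bu HBu].
destruct (cont_bounded _ _ (Rmax M 0) (smooth_cont _ _ Sv)) as [Bv HBv].
pose proof (Rmax_l M 0); pose proof (Rmax_r M 0).
exists (Rpower (1 + INR n1 * Rmax M 0) sg1 * Rpower (1 + INR n2 * Rmax M 0) sg2 * (Rabs Bu + Rabs Bv)).
intros r [x1 [x2 ->]].
pose proof (Rabs_pos Bu); pose proof (Rabs_pos Bv).
destruct (classic (f x1 x2 = C0)) as [E|Hn].
- rewrite E, Cmod_C0, Rmult_0_r; repeat apply Rmult_le_pos; try (left; apply exp_pos); lra.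
- destruct (HM _ _ Hn) as [G1 G2].
  assert (Hin : inbox (coords n1 n2) (Rmax M 0) (join x1 x2)).
  { intros [i|j] Hd; [apply in_coords_l in Hd; specialize (G1 i Hd)
                     |apply in_coords_r in Hd; specialize (G2 j Hd)]; simpl; lra. }
  apply Rmult_le_compat; [|apply Cmod_ge0| |].
  + apply Rmult_le_pos; left; apply exp_pos.
  + apply Rmult_le_compat; try (left; apply exp_pos); apply Rle_Rpower_l; try assumption; split.
    * pose proof (normn_ge0 n1 x1); lra.
    * apply Rplus_le_compat_l, normn_le; [lra|]; intros i Hi; specialize (G1 i Hi); lra.
    * pose proof (normn_ge0 n2 x2); lra.
    * apply Rplus_le_compat_l, normn_le; [lra|]; intros j Hj; specialize (G2 j Hj); lra.
  + eapply Rle_trans; [apply Cmod_le|]; apply Rplus_le_compat.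
    * eapply Rle_trans; [apply (HBu _ Hin)|apply Rle_abs].
    * eapply Rle_trans; [apply (HBv _ Hin)|apply Rle_abs].
Qed.

(** * Bounds for [T] on pieces and summation of the layers *)

Section Operator.

Variables (n1 n2 : nat) (p q : R) (B : Type) (add : B -> B -> B) (opp : B -> B) (nrm : B -> R)
  (s1 s2 : nat) (T : Fn -> B) (C : R).
Hypothesis Hn1 : (0 < n1)%nat.
Hypothesis Hn2 : (0 < n2)%nat.
Hypothesis Hp : 0 < p.
Hypothesis Hq : 0 < q.
Hypothesis Hnrm : forall x, 0 <= nrm x.
Hypothesis HT : sublinear n1 n2 s1 s2 q B add opp nrm T.
Hypothesis HC : 0 < C.
Hypothesis Hbd : forall f, inD n1 n2 s1 s2 f ->
  nrm (T f) <= C * rpow (diam1 n1 f) (INR n1 / p) * rpow (diam2 n2 f) (INR n2 / p) * Linf f.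

Lemma exponent_gt0 n : (0 < n)%nat -> 0 < INR n / p.
Proof. intros H; apply Rdiv_lt_0_compat; [now apply lt_0_INR|exact Hp]. Qed.

(** Positive exponents make [rpow] monotone, so upper bounds for the diameters can replace them. The
    factor [2 * A] is the sum of the bounds for the real and imaginary parts. *)
Lemma piece_bound u v r1 r2 A : testpair n1 n2 s1 s2 u -> testpair n1 n2 s1 s2 v ->
  0 <= r1 -> 0 <= r2 ->
  (forall z i, (i < n1)%nat -> r1 < Rabs (z (inl i)) -> u z = 0 /\ v z = 0) ->
  (forall z j, (j < n2)%nat -> r2 < Rabs (z (inr j)) -> u z = 0 /\ v z = 0) ->
  (forall z, Rabs (u z) <= A /\ Rabs (v z) <= A) ->
  nrm (T (mkF u v)) <= C * rpow (INR n1 * (2 * r1)) (INR n1 / p)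
                         * rpow (INR n2 * (2 * r2)) (INR n2 / p) * (2 * A).
Proof.
intros Hu Hv Hr1 Hr2 H1 H2 HA.
assert (HA0 : 0 <= A).
{ destruct (HA (fun _ => 0)) as [G _]; pose proof (Rabs_pos (u (fun _ => 0))); lra. }
eapply Rle_trans; [apply Hbd, inD_mkF; assumption|].
pose proof (exponent_gt0 n1 Hn1); pose proof (exponent_gt0 n2 Hn2).
assert (D1 : diam1 n1 (mkF u v) <= INR n1 * (2 * r1)).
{ apply diam1_le; [exact Hr1|]; intros x1 x2 Hf i Hi.
  destruct (Rle_lt_dec (Rabs (x1 i)) r1) as [Hle|Hlt]; [exact Hle|exfalso; apply Hf].
  unfold mkF; destruct (H1 (join x1 x2) i Hi Hlt) as [-> ->]; reflexivity. }
assert (D2 : diam2 n2 (mkF u v) <= INR n2 * (2 * r2)).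
{ apply diam2_le; [exact Hr2|]; intros x1 x2 Hf j Hj.
  destruct (Rle_lt_dec (Rabs (x2 j)) r2) as [Hle|Hlt]; [exact Hle|exfalso; apply Hf].
  unfold mkF; destruct (H2 (join x1 x2) j Hj Hlt) as [-> ->]; reflexivity. }
assert (D3 : Linf (mkF u v) <= 2 * A).
{ apply Rsup_le; [lra|]; intros r [x1 [x2 ->]].
  eapply Rle_trans; [apply Cmod_le|]; simpl; destruct (HA (join x1 x2)); lra. }
pose proof (rpow_ge0 (diam1 n1 (mkF u v)) (INR n1 / p)).
pose proof (rpow_ge0 (diam2 n2 (mkF u v)) (INR n2 / p)).
eapply Rle_trans; [apply Rmult_le_compat_l; [|exact D3]|].
- repeat apply Rmult_le_pos; lra.
- apply Rmult_le_compat_r; [lra|]; apply Rmult_le_compat; try apply rpow_ge0.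
  + apply Rmult_le_pos; lra.
  + apply Rmult_le_compat_l; [lra|]; apply rpow_le; lra.
  + apply rpow_le; lra.
Qed.

Lemma testpair_plus u v : testpair n1 n2 s1 s2 u -> testpair n1 n2 s1 s2 v ->
  testpair n1 n2 s1 s2 (fun z => u z + v z).
Proof.
apply testfun_plus; intros i; [apply in_coords_l|apply in_coords_r].
Qed.

Lemma testpair_rsum K (u : nat -> pt -> R) : (forall k, testpair n1 n2 s1 s2 (u k)) ->
  testpair n1 n2 s1 s2 (fun z => rsum K (fun k => u k z)).
Proof.
intros H; induction K as [|K IH]; [apply testfun_zero|].
apply (testpair_plus (fun z => rsum K (fun k => u k z)) (u K)); auto.
Qed.

Lemma T_zero : nrm (T (mkF (fun _ => 0) (fun _ => 0))) <= 0.
Proof.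
eapply Rle_trans; [apply (piece_bound _ _ 0 0 0); try apply testfun_zero; try lra; auto|].
- intros; rewrite Rabs_R0; lra.
- right; ring.
Qed.

(** Sublinearity is used with both coefficients equal to 1; raising it to the power [q] removes the
    outer exponent [1 / q] and leaves an inequality that iterates without accumulating constants. *)
Lemma T_rsum (u v : nat -> pt -> R) K :
  (forall k, testpair n1 n2 s1 s2 (u k)) -> (forall k, testpair n1 n2 s1 s2 (v k)) ->
  rpow (nrm (T (mkF (fun z => rsum K (fun k => u k z)) (fun z => rsum K (fun k => v k z))))) q
  <= rsum K (fun k => rpow (nrm (T (mkF (u k) (v k)))) q).
Proof.
intros Hu Hv; induction K as [|K IH].
- simpl; rewrite rpow_nonpos; [lra|apply T_zero].
- set (g := mkF (fun z => rsum K (fun k => u k z)) (fun z => rsum K (fun k => v k z))) in *.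
  replace (mkF _ _) with (Fcomb C1 g C1 (mkF (u K) (v K))).
  2: { apply functional_extensionality; intros x1; apply functional_extensionality; intros x2.
       unfold Fcomb, g, mkF, Cadd, Cmul, C1; simpl; f_equal; ring. }
  destruct (HT g (mkF (u K) (v K))) as [H _].
  { apply inD_mkF; now apply testpair_rsum. }
  { now apply inD_mkF. }
  specialize (H C1 C1).
  rewrite Cmod_C1 in H.
  assert (E1 : rpow 1 q = 1).
  { rewrite rpow_pos by lra; unfold Rpower; rewrite ln_1, Rmult_0_r; apply exp_0. }
  rewrite E1, !Rmult_1_l in H.
  apply (rpow_le _ _ q) in H; [|lra].
  rewrite rpow_rpow in H; [simpl; lra| |field; lra].
  apply Rplus_le_le_0_compat; apply rpow_ge0.
Qed.

(** The [l^q] quasi-norm of the sequence [r ^ k]. *)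
Definition geo (r : R) : R := rpow (1 / (1 - Rpower r q)) (1 / q).

(** The number [K] of layers depends on the function, hence the need for a bound free of [K]: after
    taking [q]-th powers the sum is dominated by the full geometric series. *)
Lemma T_rsum_geometric (u v : nat -> pt -> R) K X r :
  (forall k, testpair n1 n2 s1 s2 (u k)) -> (forall k, testpair n1 n2 s1 s2 (v k)) ->
  0 <= X -> 0 < r < 1 -> (forall k, nrm (T (mkF (u k) (v k))) <= X * r ^ k) ->
  nrm (T (mkF (fun z => rsum K (fun k => u k z)) (fun z => rsum K (fun k => v k z)))) <= X * geo r.
Proof.
intros Hu Hv HX Hr H.
assert (Hrq : 0 < Rpower r q < 1).
{ split; [apply exp_pos|]; rewrite <- exp_0; unfold Rpower; apply exp_increasing.
  assert (ln r < 0) by (rewrite <- ln_1; apply ln_increasing; lra); nra. }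
assert (Hg : 0 <= 1 / (1 - Rpower r q)) by (apply Rdiv_le_0_compat; lra).
assert (Hq1 : 0 <= 1 / q) by (apply Rdiv_le_0_compat; lra).
assert (E : q * (1 / q) = 1) by (field; lra).
rewrite <- (rpow_rpow (nrm _) q (1 / q) (Hnrm _) E).
rewrite <- (rpow_rpow X q (1 / q) HX E); unfold geo.
rewrite <- rpow_mult by (apply rpow_ge0 || exact Hg).
apply rpow_le; [exact Hq1|].
eapply Rle_trans; [now apply T_rsum|].
eapply Rle_trans; [|apply (geometric_sum_le (rpow X q) (Rpower r q) K); [apply rpow_ge0|lra]].
apply rsum_le; intros k _.
rewrite <- rpow_pow, <- rpow_mult by (lra || apply pow_le; lra).
apply rpow_le; [lra|apply H].
Qed.

Lemma ratio_lt1 n sg : INR n / p < sg -> 0 < Rpower 2 (INR n / p) * Rpower 2 (- sg) < 1.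
Proof.
intros H; rewrite <- Rpower_plus; split; [apply exp_pos|].
rewrite <- (Rpower_O 2) by lra; apply Rpower_lt; lra.
Qed.

(** The half-way estimate, for functions already localised in the first block. The radius [r] is
    kept explicit with its power [n1 / p], since it will be [R1 * 2 ^ k] when the first block is
    layered. *)
Lemma second_variable_bound sg2 : INR n2 / p < sg2 -> INR (n2 + s2) < sg2 ->
  exists K2, 0 <= K2 /\ forall u v r A,
    testpair n1 n2 s1 s2 u -> testpair n1 n2 s1 s2 v -> 0 <= r -> 0 <= A ->
    (forall z i, (i < n1)%nat -> r < Rabs (z (inl i)) -> u z = 0 /\ v z = 0) ->
    (forall z, weight sg2 inr n2 z * Rabs (u z) <= A /\ weight sg2 inr n2 z * Rabs (v z) <= A) ->
    nrm (T (mkF u v)) <= K2 * (rpow r (INR n1 / p) * A).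
Proof.
intros Hsg Hsg'.
destruct (layer_decomposition (coords n1 n2) inr n2 s2 inl n1 s1 sg2)
  as [C2 [R2 [HC2 [HR2 Hdec]]]]; try congruence.
{ intros j; apply in_coords_r. }
{ intros i; apply in_coords_l. }
set (th := Rpower 2 (- sg2)) in *.
assert (Hth : 0 < th) by apply exp_pos.
set (e1 := INR n1 / p); set (e2 := INR n2 / p).
set (rho := Rpower 2 e2 * th).
assert (Hrho : 0 < rho < 1) by now apply ratio_lt1.
exists (C * rpow (INR n1 * 2) e1 * rpow (INR n2 * (2 * R2)) e2 * (2 * C2) * geo rho).
assert (HN1 := pos_INR n1); assert (HN2 := pos_INR n2).
split; [repeat apply Rmult_le_pos; try apply rpow_ge0; lra|].
intros u v r A Hu Hv Hr HA Hsupp Hw.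
destruct (Hdec u (testfun_sym _ _ _ _ _ _ _ _ Hu)) as [wu [Tu [Su [Bu [Ku Eu]]]]].
destruct (Hdec v (testfun_sym _ _ _ _ _ _ _ _ Hv)) as [wv [Tv [Sv [Bv [Kv Ev]]]]].
set (K := Nat.max Ku Kv).
replace (mkF u v) with (mkF (fun z => rsum K (fun k => wu k z)) (fun z => rsum K (fun k => wv k z))).
2: { f_equal; apply functional_extensionality; intros z; [apply Eu|apply Ev]; lia. }
replace (C * rpow (INR n1 * 2) e1 * rpow (INR n2 * (2 * R2)) e2 * (2 * C2) * geo rho * (rpow r e1 * A))
  with (C * rpow (INR n1 * 2) e1 * rpow (INR n2 * (2 * R2)) e2 * (2 * C2) * rpow r e1 * A * geo rho)
  by ring.
apply T_rsum_geometric; auto.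
- intros k; apply testfun_sym, Tu.
- intros k; apply testfun_sym, Tv.
- repeat apply Rmult_le_pos; try apply rpow_ge0; lra.
- intros k; pose proof (pow2_gt0 k) as Hk.
  assert (Hthk : 0 < th ^ k) by now apply pow_lt.
  assert (Hoff : forall z y i, agree inr n2 y z -> (i < n1)%nat ->
    r < Rabs (z (inl i)) -> r < Rabs (y (inl i))).
  { intros z y i Hy Hi Hz; rewrite Hy; [exact Hz|congruence]. }
  eapply Rle_trans; [apply (piece_bound (wu k) (wv k) r (R2 * 2 ^ k) (C2 * th ^ k * A)); auto|].
  + apply testfun_sym, Tu.
  + apply testfun_sym, Tv.
  + apply Rmult_le_pos; lra.
  + intros z i Hi Hz.
    (* Layering in the second block preserves the support in the first: where the first block is
       beyond [r], the whole fibre of [u] is zero and the layer bound applies with constant 0. *)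
    assert (Z : forall x, Rabs x <= C2 * th ^ k * 0 -> x = 0).
    { intros x Hx; rewrite Rmult_0_r in Hx; destruct (Req_dec x 0) as [E|E]; [exact E|].
      pose proof (Rabs_pos_lt x E); lra. }
    split; apply Z; [apply Bu|apply Bv]; intros y Hy;
      destruct (Hsupp y i Hi (Hoff z y i Hy Hi Hz)) as [E1 E2];
      rewrite ?E1, ?E2, Rabs_R0; lra.
  + intros z j Hj Hz; split; [now apply (Su k z j)|now apply (Sv k z j)].
  + intros z; split; [apply Bu|apply Bv]; intros y _; apply Hw.
  + right; fold e1 e2.
    replace (INR n1 * (2 * r)) with (INR n1 * 2 * r) by ring.
    replace (INR n2 * (2 * (R2 * 2 ^ k))) with (INR n2 * (2 * R2) * 2 ^ k) by ring.
    rewrite (rpow_mult (INR n1 * 2)), (rpow_mult (INR n2 * (2 * R2)))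
      by (try apply Rmult_le_pos; lra).
    rewrite rpow_pow by lra; unfold rho; rewrite Rpow_mult_distr; ring.
Qed.

(** Each layer in the first block meets the half-way estimate at radius [R1 * 2 ^ k]; the growth
    [2 ^ (k n1 / p)] against the decay [2 ^ (- k sg1)] gives the ratio [rho]. *)
Lemma weighted_bound sg1 sg2 :
  INR n1 / p < sg1 -> INR (n1 + s1) < sg1 -> INR n2 / p < sg2 -> INR (n2 + s2) < sg2 ->
  exists C', 0 < C' /\
    forall f, inD n1 n2 s1 s2 f -> nrm (T f) <= C' * Dnorm n1 n2 sg1 sg2 f.
Proof.
intros Hsg1 Hsg1' Hsg2 Hsg2'.
destruct (second_variable_bound sg2 Hsg2 Hsg2') as [K2 [HK2 Hsecond]].
destruct (layer_decomposition (coords n1 n2) inl n1 s1 inr n2 s2 sg1)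
  as [C1' [R1 [HC1 [HR1 Hdec]]]]; try congruence.
{ intros i; apply in_coords_l. }
{ intros j; apply in_coords_r. }
set (th := Rpower 2 (- sg1)) in *.
assert (Hth : 0 < th) by apply exp_pos.
set (e1 := INR n1 / p) in *.
set (rho := Rpower 2 e1 * th).
assert (Hrho : 0 < rho < 1) by now apply ratio_lt1.
assert (Hs1 : 0 <= sg1) by (pose proof (pos_INR (n1 + s1)); lra).
assert (Hs2 : 0 <= sg2) by (pose proof (pos_INR (n2 + s2)); lra).
set (Q := K2 * rpow R1 e1 * C1' * geo rho).
assert (HQ : 0 <= Q) by (repeat apply Rmult_le_pos; try apply rpow_ge0; lra).
(* [Q] is only known to be nonnegative; adding 1 makes the constant strictly positive. *)
exists (Q + 1); split; [lra|]; intros f Hf.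
pose proof (Dnorm_bound _ _ _ _ sg1 sg2 f Hs1 Hs2 Hf) as HD.
set (N := Dnorm n1 n2 sg1 sg2 f) in *.
assert (Hw2 : forall z, 0 < weight sg2 inr n2 z) by (intros; apply exp_pos).
assert (Hw1 : forall z, 0 < weight sg1 inl n1 z) by (intros; apply exp_pos).
assert (HN : 0 <= N).
{ eapply Rle_trans; [|apply (HD (fun _ => 0))].
  repeat apply Rmult_le_pos; try apply Cmod_ge0; left; [apply Hw1|apply Hw2]. }
pose proof (inD_part _ _ _ _ _ Re (or_introl eq_refl) Hf) as Hu.
pose proof (inD_part _ _ _ _ _ Im (or_intror eq_refl) Hf) as Hv.
destruct (Hdec _ Hu) as [wu [Tu [Su [Bu [Ku Eu]]]]].
destruct (Hdec _ Hv) as [wv [Tv [Sv [Bv [Kv Ev]]]]].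
set (K := Nat.max Ku Kv).
rewrite <- (mkF_part f) at 1.
replace (mkF (part Re f) (part Im f))
  with (mkF (fun z => rsum K (fun k => wu k z)) (fun z => rsum K (fun k => wv k z))).
2: { f_equal; apply functional_extensionality; intros z; [apply Eu|apply Ev]; lia. }
apply Rle_trans with (K2 * rpow R1 e1 * C1' * N * geo rho).
2: { replace (K2 * rpow R1 e1 * C1' * N * geo rho) with (Q * N) by (unfold Q; ring); nra. }
apply T_rsum_geometric; auto.
- repeat apply Rmult_le_pos; try apply rpow_ge0; lra.
- intros k; pose proof (pow2_gt0 k) as Hk.
  assert (Hthk : 0 < th ^ k) by now apply pow_lt.
  (* The weight of the second block is constant along fibres of the first, so the fibrewise bound
     can be used with the norm divided by that weight, and the weight is then multiplied back. *)
  assert (Hlay : forall pr (w : nat -> pt -> R) z, (forall a, Rabs (pr a) <= Cmod a) ->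
    (forall k z A, (forall y, agree inl n1 y z -> weight sg1 inl n1 y * Rabs (part pr f y) <= A) ->
       Rabs (w k z) <= C1' * th ^ k * A) ->
    weight sg2 inr n2 z * Rabs (w k z) <= C1' * th ^ k * N).
  { intros pr w z Hpr Hb; specialize (Hw2 z).
    assert (G : Rabs (w k z) <= C1' * th ^ k * (N / weight sg2 inr n2 z)).
    { apply Hb; intros y Hy; apply -> Rle_div_r; [|exact Hw2].
      assert (Ey : weight sg2 inr n2 y = weight sg2 inr n2 z).
      { unfold weight; do 3 f_equal; apply functional_extensionality; intros j.
        apply Hy; congruence. }
      specialize (HD y); rewrite Ey in HD; specialize (Hw1 y).
      eapply Rle_trans; [|exact HD].
      rewrite Rmult_assoc, (Rmult_comm (Rabs _)), <- Rmult_assoc.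
      apply Rmult_le_compat_l; [apply Rmult_le_pos; lra|apply Hpr]. }
    replace (C1' * th ^ k * N)
      with (weight sg2 inr n2 z * (C1' * th ^ k * (N / weight sg2 inr n2 z))) by (field; lra).
    apply Rmult_le_compat_l; lra. }
  eapply Rle_trans; [apply (Hsecond (wu k) (wv k) (R1 * 2 ^ k) (C1' * th ^ k * N)); [apply Tu|apply Tv| | | |]|].
  + apply Rmult_le_pos; lra.
  + repeat apply Rmult_le_pos; lra.
  + intros z i Hi Hz; split; [now apply (Su k z i)|now apply (Sv k z i)].
  + intros z; split; [apply (Hlay Re wu z Re_le_Cmod Bu)|apply (Hlay Im wv z Im_le_Cmod Bv)].
  + right; rewrite rpow_mult, rpow_pow by lra.
    unfold rho; rewrite Rpow_mult_distr; ring.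
Qed.

End Operator.

Theorem lemma2p4 (n1 n2 : nat) (Hn1 : (0 < n1)%nat) (Hn2 : (0 < n2)%nat)
  (p q : R) (Hp : 0 < p <= 1) (Hq : p <= q <= 1)
  (B : Type) (zero : B) (add : B -> B -> B) (opp : B -> B)
  (scal : Cx -> B -> B) (nrm : B -> R)
  (HB : qBanach q B zero add opp scal nrm)
  (s1 s2 : nat) (sg1 sg2 : R)
  (Hsg1 : Rmax (INR n1 / p) (INR (n1 + s1)) < sg1 < INR (n1 + s1 + 1))
  (Hsg2 : Rmax (INR n2 / p) (INR (n2 + s2)) < sg2 < INR (n2 + s2 + 1))
  (T : Fn -> B) (HT : sublinear n1 n2 s1 s2 q B add opp nrm T)
  (C : R) (HC : 0 < C)
  (Hbd : forall f, inD n1 n2 s1 s2 f ->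
     nrm (T f) <= C * rpow (diam1 n1 f) (INR n1 / p)
                    * rpow (diam2 n2 f) (INR n2 / p) * Linf f) :
  exists C', 0 < C' /\
    forall f, inD n1 n2 s1 s2 f -> nrm (T f) <= C' * Dnorm n1 n2 sg1 sg2 f.
Proof.
pose proof (Rmax_l (INR n1 / p) (INR (n1 + s1))); pose proof (Rmax_r (INR n1 / p) (INR (n1 + s1))).
pose proof (Rmax_l (INR n2 / p) (INR (n2 + s2))); pose proof (Rmax_r (INR n2 / p) (INR (n2 + s2))).
apply (weighted_bound n1 n2 p q B add opp nrm s1 s2 T C); auto; try lra.
apply (qb_nrm_ge0 _ _ _ _ _ _ _ HB).
Qed.
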